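(* Suppose that $f$ satisfies (f1), (f2) and (f3), that $V(r,t)$ ($r=|x|$) is a radial terrace solution connecting $p$ to $0$, and that $u(x,t)$ is the solution of $$u_t-\Delta u=f(u)\ \ (x\in\mathbb R^N,\ t>0),\qquad u(x,0)=u_0(x)\ \ (x\in\mathbb R^N),$$ satisfying $u(x,t)\to p$ locally uniformly in $x\in\mathbb R^N$ as $t\to\infty$. If $u_0\in\mathcal T(f)$, then there exist positive constants $T,T_0,\sigma$ and $\beta$ such that, for all $x\in\mathbb R^N$ and all $t\ge T$, $$V(|x|,t-T)-\sigma e^{-\beta(t-T)}\le u(x,t)\le V(|x|,t+T_0)+\sigma e^{-\beta(t-T)}.$$
   Context: $N$ is a positive integer. Assumptions on $f:\mathbb R\to\mathbb R$. (f1) $f$ is $C^1$ and $f(0)=0>f'(0)$. (f2) There is $p>0$ with $f(p)=0>f'(p)$ and $\int_u^p f(s)\,ds>0$ for all $u\in[0,p)$. (f3) Any zero $q\in(0,p)$ of $f$ which is asymptotically stable from below (i.e. $f>0$ on $(q-\epsilon,q)$ for some $\epsilon>0$) is linearly stable (i.e. $f'(q)<0$); moreover $f(u)>0$ for $u<0$ and $f(u)<0$ for $u>p$. Propagating terrace. Under (f1)-(f3) there is a unique propagating terrace of $u_t=u_{rr}+f(u)$ ($r\in\mathbb R$) connecting $p$ to $0$, denoted $\{Q_k,U_k,c_k\}_{1\le k\le n_0}$: it consists of zeros of $f$, $p=Q_0>Q_1>\dots>Q_{n_0}=0$ (the platforms; all are linearly stable), speeds $0<c_1\le c_2\le\dots\le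 c_{n_0}$, and functions $U_k$ with $$U_k''+c_kU_k'+f(U_k)=0,\quad U_k'<0\ \text{ on }\mathbb R,\quad U_k(-\infty)=Q_{k-1},\ U_k(+\infty)=Q_k,$$ for $1\le k\le n_0$. (Uniqueness means that the set of platforms is unique and each $U_k$ is unique up to translation.) Each $U_k$ is normalized by $U_k(0)=(Q_{k-1}+Q_k)/2$. The class $\mathcal T(f)$. Let $b_*\in(0,p)$ be the number with $f(b_* )=0$ and $f(u)<0$ for $u\in(0,b_* )$. Then $$\mathcal T(f)=\Big\{\phi\in L^\infty(\mathbb R^N):\ \text{there exists }R>0\text{ such that }\sup_{|x|>R}\phi(x)<b_*\Big\}.$$ Radial terrace solution. A function $v\in C^2(\mathbb R^N\times(0,\infty))\cap C(\mathbb R^N\times[0,\infty))$ is called a radial terrace solution connecting $p$ to $0$ if: (i) $v_t-\Delta v=f(v)$, $0<v<p$ and $v_t>0$ for $x\in\mathbb R^N$, $t>0$; (ii) $v(x,0)$ is continuous, nonnegative, radially symmetric and has compact support (therefore for each $t\ge0$, $v(x,t)=V(r,t)$ with $r=|x|$; $V$ is also called a radial terrace solution); (iii) there are $C^1$ functions $\eta_k$ on $(0,\infty)$, $k=1,\dots,n_0$, with $\lim_{t\to\infty}\eta_k'(t)=0$, and with $\lim_{t\to\infty}[\eta_{k+1}(t)-\eta_k(t)]=+\infty$ whenever $c_k=c_{k+1}$, such that $$\lim_{t\to\infty}\Big(V(r,t)-\sum_{k=1}^{n_0}\big[U_k(r-c_kt-\eta_k(t))-Q_k\big]\Big)=0\quad\text{uniformly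 for }r\in[0,\infty).$$ *)

(* Defs.v *)
From HB Require Import structures.
From mathcomp Require Import all_boot all_order all_algebra.
From mathcomp Require Import all_classical all_reals all_analysis.

Set Implicit Arguments.
Unset Strict Implicit.
Unset Printing Implicit Defensive.

Import Order.TTheory GRing.Theory Num.Def Num.Theory.
Import numFieldNormedType.Exports.

Local Open Scope ring_scope.
Local Open Scope classical_set_scope.

(* The library norm on 'rV[R]_N is the sup norm, so |x| needs its own name.   *)
Definition enorm (R : realType) (N : nat) (x : 'rV[R]_N) : R :=
  Num.sqrt (\sum_(i < N) x 0 i ^+ 2).

(* Lebesgue measure on R^N: the outer measure by countable covers by boxes,
   restricted by the library to its Caratheodory measurable sets.             *)
Section lebesgue_rV.
Context (R : realType) (N : nat).
Implicit Types A : set 'rV[R]_N.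

Definition box (ab : 'rV[R]_N * 'rV[R]_N) : set 'rV[R]_N :=
  [set x | forall i, ab.1 0 i < x 0 i <= ab.2 0 i].

Definition box_vol (ab : 'rV[R]_N * 'rV[R]_N) : R :=
  \prod_(i < N) Num.max 0 (ab.2 0 i - ab.1 0 i).

(* The index set D allows finite and empty covers. *)
Definition box_cover A (D : set nat) (ab : nat -> 'rV[R]_N * 'rV[R]_N) :=
  A `<=` \bigcup_(k in D) box (ab k).

Local Open Scope ereal_scope.

Definition lebesgue_outer A : \bar R :=
  ereal_inf [set s | exists D ab,
    box_cover A D ab /\ s = \esum_(k in D) (box_vol (ab k))%:E].

Let vol_ge0 ab : 0 <= (box_vol ab)%:E.
Proof. by rewrite lee_fin; apply: prodr_ge0 => i _; rewrite le_max lexx. Qed.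

Let lebesgue_outer_ge0 A : 0 <= lebesgue_outer A.
Proof. by apply: le_ereal_inf_tmp => _ [D [ab [_ ->]]]; exact: esum_ge0. Qed.

Let lebesgue_outer0 : lebesgue_outer set0 = 0.
Proof.
apply/eqP; rewrite eq_le lebesgue_outer_ge0 andbT.
apply: ereal_inf_lbound; exists set0, (fun=> (0, 0)%R); split; first by [].
by rewrite esum_set0.
Qed.

Let le_lebesgue_outer : {homo lebesgue_outer : A B / A `<=` B >-> A <= B}.
Proof.
move=> A B AB; apply: ereal_inf_le_tmp => _ [D [ab [Bab ->]]].
by exists D, ab; split => //; exact: subset_trans Bab.
Qed.

Let lebesgue_outer_sigma_subadditive : sigma_subadditive lebesgue_outer.
Proof.
move=> A; have [[i ioo]|] := pselect (exists i, lebesgue_outer (A i) = +oo).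
  rewrite (eseries_pinfty _ _ ioo) ?leey// => n _.
  by rewrite -ltNye (lt_le_trans _ (lebesgue_outer_ge0 _)).
rewrite -forallNE => Aoo.
suff add2e (e : {posnum R}) : lebesgue_outer (\bigcup_n A n) <=
    \sum_(i <oo) lebesgue_outer (A i) + e%:num%:E.
  by apply/lee_addgt0Pr => _/posnumP[].
rewrite (le_trans _ (epsilon_trick _ _ _))//.
pose P n (F : set nat * (nat -> 'rV[R]_N * 'rV[R]_N)) :=
  box_cover (A n) F.1 F.2 /\ \esum_(k in F.1) (box_vol (F.2 k))%:E <=
    lebesgue_outer (A n) + (e%:num / (2 ^ n.+1)%:R)%:E.
have [G PG] : {G : nat -> set nat * (nat -> 'rV[R]_N * 'rV[R]_N)
    & forall n, P n (G n)}.
  apply: (@choice _ _ P) => n.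
  have fA : lebesgue_outer (A n) \is a fin_num.
    by rewrite ge0_fin_numE// ltey; apply/eqP/Aoo.
  have en1 : (0 < e%:num / (2 ^ n.+1)%:R)%R by [].
  have [_ [D [ab [Aab ->]]] /ltW le_ab] := lb_ereal_inf_adherent en1 fA.
  by exists (D, ab).
have /card_esym/ppcard_eqP[g] := card_nat2.
pose a ij := (box_vol ((G ij.1).2 ij.2))%:E.
pose K := [set: nat] `*`` (fun i => (G i).1).
have -> : \sum_(n <oo) (lebesgue_outer (A n) + (e%:num / (2 ^ n.+1)%:R)%:E) =
    \esum_(n in [set: nat])
      (lebesgue_outer (A n) + (e%:num / (2 ^ n.+1)%:R)%:E).
  rewrite nneseries_esumT// => n.
  by rewrite adde_ge0 ?lebesgue_outer_ge0.
apply: (@le_trans _ _ (\esum_(n in [set: nat])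
    \esum_(k in (G n).1) (box_vol ((G n).2 k))%:E)); last first.
  by apply: le_esum => n _; exact: (PG n).2.
rewrite esum_esum//.
apply: ereal_inf_lbound.
exists (g @^-1` K), (fun k => (G (g k).1).2 (g k).2); split.
  move=> x [n _ /(PG n).1[k Gk xk]].
  by exists (g^-1%FUN (n, k)); rewrite /= invK ?inE.
apply: (reindex_esum (g @^-1` K) K g (fun ij => a ij)).
split.
- by move=> n.
- by move=> m n _ _; apply: inj; rewrite inE.
- by move=> ij Kij; exists (g^-1%FUN ij); rewrite /= invK ?inE.
Qed.

HB.instance Definition _ := isOuterMeasure.Build R 'rV[R]_N lebesgue_outer
  lebesgue_outer0 lebesgue_outer_ge0 le_lebesgue_outer
  lebesgue_outer_sigma_subadditive.

(* A copy of 'rV[R]_N carrying the sigma-algebra of Lebesgue measurable sets. *)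
Definition leb_rV := caratheodory_type lebesgue_outer.

Definition lebesgue_rV (A : set leb_rV) : \bar R := lebesgue_outer A.

HB.instance Definition _ := isMeasure.Build _ leb_rV R lebesgue_rV
  (@caratheodory_measure0 _ _ lebesgue_outer)
  (@caratheodory_measure_ge0 _ _ lebesgue_outer)
  (@caratheodory_measure_sigma_additive _ _ lebesgue_outer).

End lebesgue_rV.

(* sup over A of an element of L^oo is the essential supremum over A. *)
Definition ess_sup_on (R : realType) (N : nat) (A : set 'rV[R]_N)
    (phi : 'rV[R]_N -> R) : \bar R :=
  ereal_inf [set y |
    {ae @lebesgue_rV R N, forall x, A x -> ((phi x)%:E <= y)%E}].

Section nonlinearity.
Context (R : realType).
Implicit Types (f : R -> R) (p b : R).

Definition cond_f1 f : Prop :=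
  [/\ forall s : R, derivable f s 1, continuous f^`(), f 0 = 0 & f^`() 0 < 0].

Definition cond_f2 f p : Prop :=
  [/\ 0 < p, f p = 0, f^`() p < 0 &
      forall u : R, 0 <= u < p ->
        0 < \int[lebesgue_measure]_(s in `[u, p]) f s].

Definition stable_from_below f (q : R) : Prop :=
  exists2 e : R, 0 < e & forall s : R, q - e < s < q -> 0 < f s.

Definition cond_f3 f p : Prop :=
  [/\ forall q : R, 0 < q < p -> f q = 0 ->
        stable_from_below f q -> f^`() q < 0,
      forall u : R, u < 0 -> 0 < f u &
      forall u : R, p < u -> f u < 0].

Definition is_b_star f p b : Prop :=
  [/\ 0 < b < p, f b = 0 & forall u : R, 0 < u < b -> f u < 0].

(* The class T(f); b is meant to be b_*. *)
Definition class_T (N : nat) b (phi : 'rV[R]_N -> R) : Prop :=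
  (phi : leb_rV R N -> R) \in Lfun (@lebesgue_rV R N) +oo%E /\
  exists2 r : R, 0 < r &
    (ess_sup_on [set x | (r < enorm x)%R] phi < b%:E)%E.

(* U, c are used at the indices 1, ..., n0 and Q at 0, ..., n0. *)
Record propagating_terrace f p (n0 : nat) (Q : nat -> R) (U : nat -> R -> R)
    (c : nat -> R) : Prop := {
  terrace_first : Q 0%N = p;
  terrace_last : Q n0 = 0;
  terrace_decr : forall k, (k < n0)%N -> Q k.+1 < Q k;
  terrace_zero : forall k, (k <= n0)%N -> f (Q k) = 0;
  terrace_stable : forall k, (k <= n0)%N -> f^`() (Q k) < 0;
  terrace_speed_gt0 : forall k, (1 <= k <= n0)%N -> 0 < c k;
  terrace_speed_le : forall k, (1 <= k < n0)%N -> c k <= c k.+1;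
  terrace_derivable : forall k, (1 <= k <= n0)%N ->
    forall z : R, derivable (U k) z 1 /\ derivable (U k)^`() z 1;
  terrace_ode : forall k, (1 <= k <= n0)%N ->
    forall z : R,
      derive1 (derive1 (U k)) z + c k * derive1 (U k) z + f (U k z) = 0;
  terrace_wave_decr : forall k, (1 <= k <= n0)%N ->
    forall z : R, (U k)^`() z < 0;
  terrace_wave_left : forall k, (1 <= k <= n0)%N ->
    U k z @[z --> -oo] --> Q k.-1;
  terrace_wave_right : forall k, (1 <= k <= n0)%N ->
    U k z @[z --> +oo] --> Q k;
  terrace_normalized : forall k, (1 <= k <= n0)%N ->
    U k 0 = (Q k.-1 + Q k) / 2 }.

End nonlinearity.

Section parabolic.
Context (R : realType) (N : nat).
Implicit Types (u v : 'rV[R]_N -> R -> R) (d : option 'I_N).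

(* Partial derivatives of u(x, t): None is the time variable t and Some i is
   the space variable x_i.                                                    *)
Definition has_partial d u (x : 'rV[R]_N) (t : R) : Prop :=
  if d is Some i then derivable (u^~ t) x (delta_mx 0 i)
  else derivable (u x) t 1.

Definition partial d u (x : 'rV[R]_N) (t : R) : R :=
  if d is Some i then 'D_(delta_mx 0 i) (u^~ t) x else derive1 (u x) t.

Definition laplacian u (x : 'rV[R]_N) (t : R) : R :=
  \sum_(i < N) partial (Some i) (partial (Some i) u) x t.

(* The partial derivative exists and is jointly continuous on
   R^N x (0, +oo).                                                            *)
Definition C1_along d u : Prop := forall x (t : R), 0 < t ->
  has_partial d u x t /\
  {for (x, t), continuous (fun z : 'rV[R]_N * R => partial d u z.1 z.2)}.

Definition C1_pos u : Prop := forall d, C1_along d u.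

Definition C2_pos u : Prop := C1_pos u /\ forall d, C1_pos (partial d u).

(* C^{2,1}: twice in x, once in t. *)
Definition C21_pos u : Prop :=
  C1_pos u /\ forall i j, C1_along (Some j) (partial (Some i) u).

Definition solves_eq (f : R -> R) u : Prop := forall x (t : R), 0 < t ->
  partial None u x t - laplacian u x t = f (u x t).

(* For u0 in L^oo, "the" solution is the classical one for t > 0, bounded on
   bounded time intervals, which takes the initial value u0 in L^1_loc.       *)
Record cauchy_solution (f : R -> R) (u0 : 'rV[R]_N -> R) u : Prop := {
  cauchy_reg : C21_pos u;
  cauchy_eq : solves_eq f u;
  cauchy_bounded : forall tau : R, 0 < tau ->
    exists M : R, forall x (t : R), 0 < t <= tau -> `|u x t| <= M;
  cauchy_init : forall K : set 'rV[R]_N, compact K ->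
    (\int[@lebesgue_rV R N]_(x in K) `|u x t - u0 x|%:E)%E
      @[t --> 0^'+] --> 0%E }.

Definition cvg_loc_unif u (l : R) : Prop :=
  forall K : set 'rV[R]_N, compact K -> forall e : R, 0 < e ->
  \forall t \near +oo, forall x, K x -> `|u x t - l| < e.

(* v is the solution on R^N x [0, +oo) and V its radial profile. *)
Record radial_terrace_solution (f : R -> R) (p : R) (n0 : nat) (Q : nat -> R)
    (U : nat -> R -> R) (c : nat -> R) v (V : R -> R -> R) : Prop := {
  rts_C2 : C2_pos v;
  rts_continuous : {within [set z : 'rV[R]_N * R | 0 <= z.2],
    continuous (fun z : 'rV[R]_N * R => v z.1 z.2)};
  rts_eq : solves_eq f v;
  rts_bounds : forall x (t : R), 0 < t -> 0 < v x t < p;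
  rts_incr : forall x (t : R), 0 < t -> 0 < partial None v x t;
  rts_init_continuous : continuous (v^~ 0);
  rts_init_ge0 : forall x, 0 <= v x 0;
  rts_init_radial : forall x y, enorm x = enorm y -> v x 0 = v y 0;
  rts_init_support : compact (closure [set x | v x 0 != 0]);
  rts_profile : forall x (t : R), 0 <= t -> v x t = V (enorm x) t;
  rts_terrace : exists eta : nat -> R -> R,
    [/\ forall k, (1 <= k <= n0)%N -> forall t : R, 0 < t ->
          derivable (eta k) t 1 /\ {for t, continuous (eta k)^`()},
        forall k, (1 <= k <= n0)%N -> (eta k)^`() t @[t --> +oo] --> 0,
        forall k, (1 <= k < n0)%N -> c k = c k.+1 ->
          eta k.+1 t - eta k t @[t --> +oo] --> +oo &
        forall e : R, 0 < e -> \forall t \near +oo, forall r : R, 0 <= r ->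
          `|V r t - \sum_(1 <= k < n0.+1)
              (U k (r - c k * t - eta k t) - Q k)| < e] }.

End parabolic.

(* Main.v *)
Require Import Defs.
From HB Require Import structures.
From mathcomp Require Import all_boot all_order all_algebra.
From mathcomp Require Import all_classical all_reals all_analysis.
From mathcomp Require Import measurable_realfun.
From mathcomp Require Import ring lra.

Set Implicit Arguments.
Unset Strict Implicit.
Unset Printing Implicit Defensive.

Import Order.TTheory GRing.Theory Num.Def Num.Theory.
Import numFieldNormedType.Exports.

Local Open Scope ring_scope.
Local Open Scope classical_set_scope.

(** The solution u is trapped between two deformations of v, the functions
    v(x, theta(t)) - sigma e(t) and v(x, theta(t)) + sigma e(t), where
    e(t) = exp (- beta (t - T)) and theta is a shift of time that changes by a
    bounded total amount. They are a sub- and a supersolution for the following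
    reason. Where v is near a platform, f has slope at most - beta and damps the
    perturbation sigma e. Elsewhere v_t is bounded below by some kap > 0, and the
    term theta' v_t dominates as soon as theta' - 1 is a suitable multiple of
    e(t). The comparison is wave_comparison; what remains is to bound v_t from
    below and to fit the initial order.

    The lower bound on v_t (platform_or_speed). The convergence to the terrace is
    only uniform, and gives v(t + tau) - v(t) >= kap tau off the platforms
    (platform_or_increase), hence v_t >= kap at some time in [t, t + tau]. To
    bring this to the time t, v_t has to be uniformly continuous in time. All the
    estimates for that come from the maximum principle: reflection_bound bounds
    the gradient of a bounded function whose heat operator is bounded, and is
    applied successively to v, to its difference quotients in space, which bounds
    the second derivatives and v_t, and to its difference quotients in time;
    time_growth turns the last gradient bound into a modulus of continuity in
    time.

    The initial order. On compact sets u is close to p. Ordinary differential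
    equations for constants show that u eventually lies in
    [- sigma / 2, p + sigma / 2] everywhere. Far away the class of initial values
    has to be used: there u0 is below b up to a null set, and initial_far_le shows
    that u is below b at a small positive time; since f < 0 on (0, b), u then
    decays to 0 far away (far_le_decay). The initial values are attained in L^1
    only. The passage to pointwise values replaces u by its mean over the points
    of a fine grid, which still solves a heat equation with bounded right-hand
    side and starts below the essential bound (grid_average).

    The maximum principle itself (comparison) is the classical one on the whole
    space, with a quadratic penalty at infinity. *)

(** * Derivatives in one real variable *)

Section one_variable.
Context {R : realType}.
Implicit Types (f g : R -> R) (x t a b e : R).

Lemma is_derive_funD f g x a b : is_derive x 1 f a -> is_derive x 1 g b ->
  is_derive x 1 (fun s => f s + g s) (a + b).
Proof. exact: is_deriveD. Qed.

Lemma is_derive_funB f g x a b : is_derive x 1 f a -> is_derive x 1 g b ->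
  is_derive x 1 (fun s => f s - g s) (a - b).
Proof. exact: is_deriveB. Qed.

Lemma is_derive_funM f g x a b : is_derive x 1 f a -> is_derive x 1 g b ->
  is_derive x 1 (fun s => f s * g s) (a * g x + f x * b).
Proof.
move=> fa gb; have := is_deriveM fa gb.
by move/is_derive_eq; apply; rewrite addrC /GRing.scale /= [g x * a]mulrC.
Qed.

Lemma is_derive_affine x a b : is_derive x 1 (fun s => a * s + b) a.
Proof.
have ha : is_derive x 1 (fun s : R => a * s) (a * 1).
  by have := is_deriveZ a (is_derive_id x (1 : R)).
have := is_derive_funD ha (is_derive_cst b x 1).
by rewrite mulr1 addr0.
Qed.

Lemma is_derive_ext f g x a b : is_derive x 1 f a -> f =1 g -> a = b ->
  is_derive x 1 g b.
Proof. by move=> fa /funext <- <-. Qed.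

Lemma is_derive_comp f g x a b : is_derive (g x) 1 f a -> is_derive x 1 g b ->
  is_derive x 1 (fun s => f (g s)) (a * b).
Proof. by move=> fa gb; have := is_derive1_comp fa gb. Qed.

(** The first-order expansion in the form used below, where the derivative is
    only ever confronted with inequalities. *)
Lemma is_derive_small_o f x a e : is_derive x 1 f a -> 0 < e ->
  exists2 d : R, 0 < d & forall h : R, `|h| < d -> `|f (x + h) - f x - a * h| <= e * `|h|.
Proof.
move=> [df fa] e0.
have /cvgrPdist_le /(_ _ e0) : h^-1 *: (f (h *: 1 + x) - f x) @[h --> 0^'] --> a.
  by rewrite -fa; exact: df.
rewrite near_withinE => -[d /= d0 hd]; exists d => // h hlt.
have [->|h0] := eqVneq h 0; first by rewrite addr0 subrr mulr0 subrr normr0 mulr0.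
have := hd h; rewrite /ball /= sub0r normrN => /(_ hlt h0).
rewrite [h *: 1]mulr1 addrC => hle.
have -> : f (x + h) - f x - a * h = - (h * (a - h^-1 *: (f (h + x) - f x))).
  have : h * (h^-1 *: (f (h + x) - f x)) = f (h + x) - f x by exact: mulVKf.
  by rewrite mulrBr [h + x]addrC => ->; ring.
by rewrite normrN normrM mulrC ler_pM2r ?normr_gt0// addrC.
Qed.

End one_variable.

(** * Necessary conditions at a maximum *)

Section extrema.
Context {R : realType}.
Implicit Types (f g : R -> R) (t a b e : R).

(** Only the values on the left are compared, because a maximum over a time
    interval may sit at its final time. *)
Lemma left_max_derive_ge0 f t a e : is_derive t 1 f a -> 0 < e ->
  (forall s, t - e < s < t -> f s <= f t) -> 0 <= a.
Proof.
move=> fa e0 fle; rewrite leNgt; apply/negP => a0.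
have [d d0 hd] := is_derive_small_o fa (e := - a / 2) ltac:(lra).
pose h := - (Num.min d e / 2).
have m0 : 0 < Num.min d e by rewrite lt_min d0.
have md : Num.min d e <= d by rewrite ge_min lexx.
have me : Num.min d e <= e by rewrite ge_min lexx orbT.
have h0 : h < 0 by rewrite /h; lra.
have nh : `|h| = - h by rewrite ltr0_norm.
have := hd h; rewrite nh => /(_ ltac:(rewrite /h; lra)).
rewrite ler_norml => /andP[h1 _].
have := fle (t + h) ltac:(rewrite /h; lra) => h2.
have : 0 < a * h by nra.
nra.
Qed.

Lemma local_max_derive_eq0 f t a e : is_derive t 1 f a -> 0 < e ->
  (forall s, `|s - t| < e -> f s <= f t) -> a = 0.
Proof.
move=> fa e0 fle; apply/eqP; rewrite eq_le; apply/andP; split; last first.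
  apply: (left_max_derive_ge0 fa e0) => s hs; apply: fle.
  by rewrite ltr_norml; apply/andP; split; lra.
have dm : is_derive (- t) 1 (fun s : R => - 1 * s + 0) (- 1).
  exact: is_derive_affine.
have fa' : is_derive (-1 * (- t) + 0) 1 f a by rewrite (_ : _ + 0 = t)//; ring.
have h := is_derive_comp (g := fun s : R => -1 * s + 0) fa' dm.
rewrite -oppr_ge0 -mulrN1.
apply: (left_max_derive_ge0 h e0) => s hs.
rewrite (_ : -1 * - t + 0 = t); last by ring.
by apply: fle; rewrite ltr_norml; apply/andP; split; lra.
Qed.

(** The first derivative vanishes at the maximum; if the second one were
    positive, the first would be positive just to the right and the function
    would increase there. *)
Lemma local_max_derive2_le0 f g t b e : (forall s : R, is_derive s 1 f (g s)) ->
  is_derive t 1 g b -> 0 < e ->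
  (forall s, `|s - t| < e -> f s <= f t) -> b <= 0.
Proof.
move=> fg gb e0 fle; rewrite leNgt; apply/negP => b0.
have g0 : g t = 0 by exact: (local_max_derive_eq0 (fg t) e0 fle).
have [d d0 hd] := is_derive_small_o gb (e := b / 2) ltac:(lra).
pose h := Num.min d e / 2.
have m0 : 0 < Num.min d e by rewrite lt_min d0.
have md : Num.min d e <= d by rewrite ge_min lexx.
have me : Num.min d e <= e by rewrite ge_min lexx orbT.
have h0 : 0 < h by rewrite /h; lra.
have fc : {within `[t, t + h], continuous f}.
  apply: derivable_within_continuous => s _; exact: ex_derive.
have [|c cI hc] := @MVT R f g t (t + h) _ (fun x _ => fg x) fc.
  by rewrite ltrDl.
have fh : f (t + h) <= f t.
  apply: fle; rewrite (_ : t + h - t = h); last by ring.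
  by rewrite gtr0_norm// /h; lra.
move: cI; rewrite in_itv /= => /andP[tc ch].
have nc : `|c - t| = c - t by rewrite gtr0_norm//; lra.
have := hd (c - t); rewrite nc g0 => /(_ ltac:(rewrite /h in ch; lra)).
rewrite (_ : t + (c - t) = c); last by ring.
rewrite ler_norml => /andP[h1 _].
have gc : 0 < g c by nra.
have : 0 < g c * (t + h - t) by rewrite mulr_gt0//; lra.
lra.
Qed.

End extrema.

(** * The heat operator, pointwise and coordinate by coordinate *)

Section heat_operator.
Context {R : realType} {N : nat}.
Implicit Types (x y : 'rV[R]_N) (z : 'rV[R]_N -> R -> R) (t a b c : R).

Definition unit_row (i : 'I_N) : 'rV[R]_N := delta_mx 0 i.
Local Notation e_ := unit_row.

Definition sqnorm x : R := \sum_(i < N) x 0 i ^+ 2.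

Definition jointly_continuous_at z x t : Prop :=
  {for (x, t), continuous (fun q : 'rV[R]_N * R => z q.1 q.2)}.

(** Everything the maximum principle tests at a point: the time derivative and
    the pure second derivatives along the axes. Each second derivative is
    taken along a line on which the first derivative exists throughout, and is
    not required to be continuous, so that translates, difference quotients
    and finite averages of solutions qualify without further work. *)
Definition has_derivs z x t a (l : 'I_N -> R) : Prop :=
  is_derive t 1 (z x) a /\ forall i, exists2 g : R -> R,
    (forall s : R, is_derive s 1 (fun s => z (x + s *: e_ i) t) (g s)) &
    is_derive (0 : R) 1 g (l i).

(** c is the value of the heat operator (d/dt - Laplacian) z at (x, t). *)
Definition heat_at z x t c : Prop := jointly_continuous_at z x t /\
  exists a l, has_derivs z x t a l /\ a - \sum_i l i = c.

Lemma jointly_continuous_funD z1 z2 x t : jointly_continuous_at z1 x t ->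
  jointly_continuous_at z2 x t ->
  jointly_continuous_at (fun x t => z1 x t + z2 x t) x t.
Proof. by move=> h1 h2; exact: cvgD h1 h2. Qed.

Lemma jointly_continuous_funM z1 z2 x t : jointly_continuous_at z1 x t ->
  jointly_continuous_at z2 x t ->
  jointly_continuous_at (fun x t => z1 x t * z2 x t) x t.
Proof. by move=> h1 h2; exact: cvgM h1 h2. Qed.

Lemma jointly_continuous_comp z x t y (th : R -> R) : jointly_continuous_at z (x + y) (th t) ->
  {for t, continuous th} ->
  jointly_continuous_at (fun x t => z (x + y) (th t)) x t.
Proof.
move=> hz ct.
have h : (fun q : 'rV[R]_N * R => (q.1 + y, th q.2)) @ (x, t) -->
    (x + y, th t).
  have h1 : (fun q : 'rV[R]_N * R => q.1 + y) @ (x, t) --> x + y.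
    by apply: cvgD; [exact: cvg_fst|exact: cvg_cst].
  have h2 : (fun q : 'rV[R]_N * R => th q.2) @ (x, t) --> th t.
    by apply: (@cvg_comp _ _ _ snd th); [exact: cvg_snd|exact: ct].
  exact: cvg_pair h1 h2.
by apply: (continuous_comp (f := fun q : 'rV[R]_N * R => (q.1 + y, th q.2))
  (g := fun q : 'rV[R]_N * R => z q.1 q.2)).
Qed.

Lemma jointly_continuous_time (al : R -> R) x t : {for t, continuous al} ->
  jointly_continuous_at (fun _ t => al t) x t.
Proof. by move=> ct; apply: (@cvg_comp _ _ _ snd al); [exact: cvg_snd|exact: ct]. Qed.

Lemma is_derive_continuous (al : R -> R) t a : is_derive t 1 al a ->
  {for t, continuous al}.
Proof. by move=> [h _]; apply: differentiable_continuous; exact/derivable1_diffP. Qed.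

Lemma heat_at_funD z1 z2 x t c1 c2 : heat_at z1 x t c1 -> heat_at z2 x t c2 ->
  heat_at (fun x t => z1 x t + z2 x t) x t (c1 + c2).
Proof.
move=> [k1 [a1 [l1 [[d1 h1] <-]]]] [k2 [a2 [l2 [[d2 h2] <-]]]].
split; first exact: jointly_continuous_funD.
exists (a1 + a2), (fun i => l1 i + l2 i); split; last first.
  by rewrite big_split /=; ring.
split=> [|i]; first exact: is_derive_funD.
have [g1 g1d g1e] := h1 i; have [g2 g2d g2e] := h2 i.
by exists (fun s => g1 s + g2 s) => [s|]; exact: is_derive_funD.
Qed.

Lemma heat_at_time al x t a : is_derive t 1 al a ->
  heat_at (fun _ t => al t) x t a.
Proof.
move=> ad; split; first by apply: jointly_continuous_time; exact: is_derive_continuous ad.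
exists a, (fun=> 0); split; last by rewrite big1// subr0.
split => // i; exists (fun=> 0) => [s|]; exact: is_derive_cst.
Qed.

Lemma heat_at_timeM z al x t a c : heat_at z x t c -> is_derive t 1 al a ->
  heat_at (fun x t => al t * z x t) x t (a * z x t + al t * c).
Proof.
move=> [k1 [a1 [l1 [[d1 h1] <-]]]] ad.
split.
  apply: jointly_continuous_funM => //; apply: jointly_continuous_time.
  exact: is_derive_continuous ad.
exists (a * z x t + al t * a1), (fun i => al t * l1 i); split; last first.
  by rewrite -mulr_sumr; ring.
split=> [|i]; first exact: is_derive_funM.
have [g1 g1d g1e] := h1 i.
exists (fun s => al t * g1 s) => [s|].
  apply: is_derive_ext (is_derive_funM (is_derive_cst (al t) s (1 : R)) (g1d s)) _ _ => //.
  by rewrite mul0r add0r.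
apply: is_derive_ext (is_derive_funM (is_derive_cst (al t) (0 : R) (1 : R)) g1e) _ _ => //.
by rewrite mul0r add0r.
Qed.

Lemma heat_at_funZ z k x t c : heat_at z x t c ->
  heat_at (fun x t => k * z x t) x t (k * c).
Proof.
move=> h; have := heat_at_timeM h (is_derive_cst k t (1 : R)).
by rewrite mul0r add0r.
Qed.

Lemma heat_at_funN z x t c : heat_at z x t c ->
  heat_at (fun x t => - z x t) x t (- c).
Proof.
move=> h; have := heat_at_funZ (-1) h.
by rewrite mulN1r; congr heat_at; apply/funext => y; apply/funext => s; rewrite mulN1r.
Qed.

Lemma heat_at_funB z1 z2 x t c1 c2 : heat_at z1 x t c1 -> heat_at z2 x t c2 ->
  heat_at (fun x t => z1 x t - z2 x t) x t (c1 - c2).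
Proof. by move=> h1 h2; exact: heat_at_funD h1 (heat_at_funN h2). Qed.

(** Replacing t by th t multiplies the time derivative by the speed of th and
    leaves the Laplacian alone: this is how a shift in time turns a solution
    into a sub- or supersolution. *)
Lemma heat_at_reparam z x y t (th : R -> R) a b c :
  heat_at z (x + y) (th t) c ->
  is_derive (th t) 1 (z (x + y)) a -> is_derive t 1 th b ->
  heat_at (fun x t => z (x + y) (th t)) x t (c + a * (b - 1)).
Proof.
move=> [k1 [a1 [l1 [[d1 h1] <-]]]] ad bd.
split; first by apply: jointly_continuous_comp => //; exact: is_derive_continuous bd.
have aa : a1 = a by rewrite -(derive_val (is_derive := d1)) -(derive_val (is_derive := ad)).
exists (a * b), l1; split; last by rewrite aa; ring.
split=> [|i]; first exact: (is_derive_comp ad bd).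
have [g1 g1d g1e] := h1 i.
exists g1 => // s.
apply: is_derive_ext (g1d s) _ _ => // r.
by rewrite addrAC.
Qed.

Lemma heat_at_shift z x y t b c : heat_at z (x + y) (t + b) c ->
  heat_at (fun x t => z (x + y) (t + b)) x t c.
Proof.
move=> h; have [_ [a [l [[d _] _]]]] := h.
have hb : is_derive t 1 (fun t => t + b) 1.
  by apply: is_derive_ext (is_derive_affine t 1 b) _ _ => // s; rewrite mul1r.
have := heat_at_reparam (th := fun t => t + b) h d hb.
by rewrite subrr mulr0 addr0.
Qed.

Lemma coord_line x i j s : (x + s *: e_ i) 0 j = x 0 j + s * (i == j)%:R.
Proof. by rewrite !mxE eqxx /= eq_sym. Qed.

Lemma sqnorm_line x i s : sqnorm (x + s *: e_ i) = sqnorm x + 2 * x 0 i * s + s ^+ 2.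
Proof.
rewrite /sqnorm (bigD1 i) //= [in RHS](bigD1 i) //= coord_line eqxx mulr1.
rewrite (eq_bigr (fun j => x 0 j ^+ 2)) => [|j /negbTE ji]; first by ring.
by rewrite coord_line eq_sym ji mulr0 addr0.
Qed.

Lemma sqnorm_ge0 x : 0 <= sqnorm x.
Proof. by apply: sumr_ge0 => i _; exact: sqr_ge0. Qed.

Lemma continuous_sqnorm : continuous sqnorm.
Proof.
rewrite (_ : sqnorm = fun x => \big[+%R/0]_(i < N) (x 0 i ^+ 2)) //.
apply: continuous_big => [|i _]; first exact: add_continuous.
move=> x; apply: (@continuous_comp _ _ _ (fun x : 'rV[R]_N => x 0 i) (fun s : R => s ^+ 2)).
  exact: coord_continuous.
exact: exprn_continuous.
Qed.

Lemma heat_at_sqdist x y t :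
  heat_at (fun x _ => sqnorm (x - y)) x t (- (2 * N%:R)).
Proof.
split.
  apply: (@continuous_comp _ _ _ fst (fun x : 'rV[R]_N => sqnorm (x - y))).
    exact: cvg_fst.
  have hB : (fun x : 'rV[R]_N => x - y) @ x --> x - y.
    apply: (@continuousB _ _ _ (fun x : 'rV[R]_N => x) (fun=> y)).
      by move=> ? ?; exact.
    exact: cst_continuous.
  exact: (continuous_comp hB (@continuous_sqnorm _)).
exists 0, (fun=> 2); split; last by rewrite sumr_const card_ord mulr_natr sub0r.
split=> [|i]; first exact: is_derive_cst.
exists (fun s => 2 * s + 2 * (x - y) 0 i) => [s|]; last exact: is_derive_affine.
have h := is_derive_affine s (1 : R) 0.
have h2 := is_derive_affine s (2 * (x - y) 0 i) (sqnorm (x - y)).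
apply: is_derive_ext (is_derive_funD (is_derive_funM h h) h2) _ _ => [r|].
  by rewrite addrAC sqnorm_line expr2; ring.
ring.
Qed.

End heat_operator.

(** * From partial derivatives to joint continuity *)

Section regularity.
Context {R : realType}.

Lemma MVT_is_derive (f g : R -> R) (a b : R) : a <= b ->
  (forall s, a <= s <= b -> is_derive s 1 f (g s)) ->
  exists2 c, a <= c <= b & f b - f a = g c * (b - a).
Proof.
move=> ab fg.
have fc : {within `[a, b], continuous f}.
  apply: derivable_within_continuous => s; rewrite in_itv /= => hs.
  by have := fg s hs => h; exact: ex_derive.
have fg' s : s \in `]a, b[%R -> is_derive s 1 f (g s).
  by rewrite in_itv /= => /andP[h1 h2]; apply: fg; rewrite !ltW.
have [c cI ->] := MVT_segment ab fg' fc.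
by exists c; first by move: cI; rewrite in_itv.
Qed.

Lemma derive_bound_lipschitz (f g : R -> R) (a b C : R) :
  (forall s, (a <= s <= b) || (b <= s <= a) ->
    is_derive s 1 f (g s) /\ `|g s| <= C) ->
  `|f b - f a| <= C * `|b - a|.
Proof.
move=> h.
have [ab|/ltW ba] := leP a b.
  have fg s : a <= s <= b -> is_derive s 1 f (g s).
    by move=> hs; have [|] := h s; first by rewrite hs.
  have [c hc ->] := MVT_is_derive ab fg.
  by rewrite normrM ler_wpM2r//; have [|] := h c; first by rewrite hc.
have fg s : b <= s <= a -> is_derive s 1 f (g s).
  by move=> hs; have [|] := h s; first by rewrite hs orbT.
have [c hc e] := MVT_is_derive ba fg.
rewrite distrC e [`|b - a|]distrC normrM ler_wpM2r//.
by have [|] := h c; first by rewrite hc orbT.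
Qed.

Context {N : nat}.
Implicit Types (x y : 'rV[R]_N) (u z : 'rV[R]_N -> R -> R) (s t : R).
Local Notation e_ := (@unit_row R N).

Lemma is_derive_line (f : 'rV[R]_N -> R) x e (s a : R) :
  is_derive (x + s *: e) e f a -> is_derive s 1 (fun r : R => f (x + r *: e)) a.
Proof.
move=> [df fa].
have E : (fun h : R => h^-1 *: (((fun r : R => f (x + r *: e)) \o shift s) (h *: 1)
      - f (x + s *: e))) =
    (fun h : R => h^-1 *: ((f \o shift (x + s *: e)) (h *: e) - f (x + s *: e))).
  apply/funext => h /=; congr (_ *: (f _ - _)).
  by rewrite [h *: 1]mulr1 scalerDl addrCA.
split; first by rewrite /derivable E.
by rewrite /derive E.
Qed.

(** The point x is moved to y one coordinate at a time; a product domain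
    contains the whole staircase. *)
Lemma coord_lipschitz (P : 'I_N -> R -> Prop) (f : 'rV[R]_N -> R) (C : R) :
  (forall y i s, (forall j, P j (y 0 j)) -> P i (y 0 i + s) ->
    `|f (y + s *: e_ i) - f y| <= C * `|s|) ->
  forall x y, (forall j, P j (x 0 j)) -> (forall j, P j (y 0 j)) ->
  `|f y - f x| <= C * \sum_i `|y 0 i - x 0 i|.
Proof.
move=> hf x y Px Py.
pose mix k := \row_(i < N) if (i < k)%N then y 0 i else x 0 i.
have Pmix k j : P j (mix k 0 j) by rewrite mxE; case: ifP.
have key k : (k <= N)%N ->
    `|f (mix k) - f x| <= C * \sum_(i < N | (i < k)%N) `|y 0 i - x 0 i|.
  elim: k => [_|k IH kN].
    rewrite big_pred0 => [|i]; last by rewrite ltn0.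
    rewrite (_ : mix 0%N = x) ?subrr ?normr0 ?mulr0//.
    by apply/rowP => i; rewrite mxE ltn0.
  pose i := Ordinal kN.
  have -> : mix k.+1 = mix k + (y 0 i - x 0 i) *: e_ i.
    apply/rowP => j; rewrite coord_line !mxE ltnS leq_eqVlt.
    have [<-|ij] := eqVneq i j; first by rewrite eqxx ltnn /= mulr1 addrC subrK.
    rewrite [(j == k :> nat)]eq_sym (_ : (k == j :> nat) = (i == j))//.
    by rewrite (negbTE ij) /= mulr0 addr0.
  rewrite (bigD1 i) //= (eq_bigl (fun j : 'I_N => (j < k)%N)); last first.
    move=> j /=; rewrite ltnS leq_eqVlt -(inj_eq val_inj) /=.
    by case: ltngtP.
  rewrite mulrDr; apply: le_trans (ler_distD (f (mix k)) _ _) _; apply: lerD.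
    by apply: hf => //; rewrite mxE /= ltnn addrC subrK; exact: Py.
  by apply: IH; exact: ltnW.
have := key N (leqnn N).
rewrite (_ : mix N = y); last by apply/rowP => i; rewrite mxE ltn_ord.
by rewrite (eq_bigl xpredT)// => i; rewrite ltn_ord.
Qed.

Lemma C1_along_is_derive u x t i s : C1_along (Some i) u -> 0 < t ->
  is_derive s 1 (fun r : R => u (x + r *: e_ i) t)
    (partial (Some i) u (x + s *: e_ i) t).
Proof.
move=> hu t0; have [hd _] := hu (x + s *: e_ i) t t0.
exact: (@is_derive_line (u^~ t)) (derivableP hd).
Qed.

Lemma C1_time_is_derive u x t : C1_along None u -> 0 < t ->
  is_derive t 1 (u x) (partial None u x t).
Proof.
move=> hu t0; have [hd _] := hu x t t0.
by rewrite /= derive1E; exact/derivableP.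
Qed.

Lemma coord_le_norm x i : `|x 0 i| <= `|x|.
Proof.
rewrite [leRHS]/normr /= mx_normrE.
by apply/bigmax_geP; right => /=; exists (ord0, i).
Qed.

Lemma jointly_continuous_atP u x t : jointly_continuous_at u x t <->
  forall e, 0 < e -> exists2 d : R, 0 < d & forall y s,
    `|y - x| < d -> `|s - t| < d -> `|u y s - u x t| <= e.
Proof.
split=> [h e e0|h].
  have /cvgrPdist_le /(_ _ e0) := h.
  move=> /nbhs_ballP[d /= d0 hd]; exists d => // y s yx st.
  rewrite distrC; apply: (hd (y, s)); split.
    by rewrite -ball_normE /= distrC.
  by rewrite -ball_normE /= distrC.
apply/cvgrPdist_le => e e0; have [d d0 hd] := h e e0.
apply: filterS (nbhsx_ballx ((x, t) : 'rV[R]_N * R) d d0) => -[y s] [/= yx st].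
rewrite distrC; apply: hd.
  by move: yx; rewrite -ball_normE /= distrC.
by move: st; rewrite -ball_normE /= distrC.
Qed.

(** The partial derivatives are continuous, hence bounded near (x, t), so u is
    Lipschitz there. *)
Lemma C1_pos_jointly_continuous u x t : C1_pos u -> 0 < t ->
  jointly_continuous_at u x t.
Proof.
move=> hu t0.
have [B [r [r0 B0 hB]]] : exists B r : R, [/\ 0 < r, 0 < B & forall y s d,
    `|y - x| < r -> `|s - t| < r -> `|partial d u y s| <= B].
  pose B := 1 + \sum_(d : option 'I_N) `|partial d u x t|.
  have /(@nbhs_ballP R ('rV[R]_N * R)%type)[r /= r0 hr] : nbhs ((x, t) : 'rV[R]_N * R)
      [set q | forall d, `|partial d u q.1 q.2| <= B].
    apply: (@filter_forall _ (option 'I_N)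
      (fun d q => `|partial d u q.1 q.2| <= B) (nbhs ((x, t) : 'rV[R]_N * R))) => d.
    have [_ /cvgrPdist_le /(_ _ ltr01)] := hu d x t t0.
    apply: filterS => q /= hq.
    rewrite -(subrK (partial d u x t) (partial d u q.1 q.2)).
    rewrite (le_trans (ler_normD _ _))// lerD//; first by rewrite distrC.
    by rewrite (bigD1 d) //= lerDl sumr_ge0.
  exists B, r; split => //.
    by rewrite ltr_wpDr// sumr_ge0.
  move=> y s d yx st; apply: (hr (y, s)); split.
    by rewrite -ball_normE /= distrC.
  by rewrite -ball_normE /= distrC.
pose r' := Num.min r t.
have r'0 : 0 < r' by rewrite lt_min r0.
have r'r : r' <= r by rewrite ge_min lexx.
have r't : r' <= t by rewrite ge_min lexx orbT.
clearbody r'.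
have key y s : `|y - x| < r' -> `|s - t| < r' ->
    `|u y s - u x t| <= B * \sum_i `|y 0 i - x 0 i| + B * `|s - t|.
  move=> yx st.
  have s0 : 0 < s by move: st; rewrite ltr_norml => /andP[]; lra.
  apply: le_trans (ler_distD (u x s) _ _) _; apply: lerD.
    apply: (@coord_lipschitz (fun i a => `|a - x 0 i| < r') (u^~ s)); last 2 first.
    - by move=> j; rewrite subrr normr0.
    - by move=> j; have := coord_le_norm (y - x) j; rewrite !mxE => /le_lt_trans; apply.
    move=> w i h Pw Pwh.
    have := @derive_bound_lipschitz (fun k => u (w + k *: e_ i) s)
      (fun k => partial (Some i) u (w + k *: e_ i) s) 0 h B.
    rewrite scale0r addr0 subr0; apply => k hk; split.
      by apply: C1_along_is_derive => //; exact: hu.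
    apply: hB; last exact: lt_le_trans st r'r.
    have wk j : `|w 0 j + k * (i == j)%:R - x 0 j| < r'.
      have [<-|ij] := eqVneq i j; last by rewrite mulr0 addr0; exact: Pw.
      rewrite mulr1; have := Pw i; move: Pwh; rewrite !ltr_norml.
      by move=> /andP[h1 h2] /andP[h3 h4]; case/orP: hk => /andP[h5 h6]; apply/andP; split; lra.
    rewrite [`|_ - x|]/normr /= mx_normrE; apply/bigmax_ltP; split => // -[a j] _ /=.
    rewrite (ord1 a) !mxE eqxx /= [j == i]eq_sym.
    exact: lt_le_trans (wk j) r'r.
  apply: (@derive_bound_lipschitz (u x) (fun k => partial None u x k)) => k hk.
  have hkt : `|k - t| < r'.
    move: st; rewrite !ltr_norml => /andP[h1 h2].
    by case/orP: hk => /andP[h5 h6]; apply/andP; split; lra.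
  split; last by apply: hB; [rewrite subrr normr0|exact: lt_le_trans hkt r'r].
  by apply: C1_time_is_derive; [exact: hu|move: hkt; rewrite ltr_norml => /andP[]; lra].
apply/jointly_continuous_atP => e e0.
have M0 : 0 < B * (N%:R + 1) by rewrite mulr_gt0// ltr_wpDl.
exists (Num.min r' (e / (B * (N%:R + 1)))).
  by rewrite lt_min r'0 divr_gt0.
move=> y s; rewrite !lt_min => /andP[y1 y2] /andP[s1 s2].
apply: le_trans (key y s y1 s1) _.
rewrite -mulrDr.
move: y2 s2; rewrite !ltr_pdivlMr// => y2 s2.
have h1 : \sum_i `|y 0 i - x 0 i| <= N%:R * `|y - x|.
  apply: (@le_trans _ _ (\sum_(i < N) `|y - x|)).
    by apply: ler_sum => i _; have := coord_le_norm (y - x) i; rewrite !mxE.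
  by rewrite sumr_const card_ord mulr_natl.
pose m := Num.max `|y - x| `|s - t|.
have m1 : `|y - x| <= m by rewrite le_max lexx.
have m2 : `|s - t| <= m by rewrite le_max lexx orbT.
apply: (@le_trans _ _ (m * (B * (N%:R + 1)))).
  rewrite (_ : m * _ = B * (N%:R * m + m)); last by ring.
  rewrite ler_pM2l// lerD// (le_trans h1)//.
  by rewrite ler_wpM2l.
by rewrite /m /Num.max; case: ifP => _; exact: ltW.
Qed.

Lemma C21_pos_heat f u x t : C21_pos u -> solves_eq f u -> 0 < t ->
  heat_at u x t (f (u x t)).
Proof.
move=> [h1 h2] heq t0; split; first exact: C1_pos_jointly_continuous.
exists (partial None u x t), (fun i => partial (Some i) (partial (Some i) u) x t).
split; last exact: heq.
split; first exact: C1_time_is_derive.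
move=> i; exists (fun s => partial (Some i) u (x + s *: e_ i) t).
  by move=> s; apply: C1_along_is_derive.
have := C1_along_is_derive x 0 (h2 i i) t0.
by rewrite scale0r addr0.
Qed.

End regularity.

(** * The maximum principle on the whole space *)

Section maximum_principle.
Context {R : realType} {N : nat}.
Implicit Types (x y : 'rV[R]_N) (z w d : 'rV[R]_N -> R -> R) (s t : R).
Local Notation e_ := (@unit_row R N).

Definition cube (D : R) : set 'rV[R]_N := [set x | forall i, `|x 0 i| <= D].

Lemma compact_cube D : compact (cube D).
Proof.
have := @rV_compact R N (fun=> `[- D, D]%classic) (fun=> @segment_compact _ _ _).
congr compact; apply/seteqP; split => x /= h i; have := h i; rewrite in_itv /=;
  by rewrite ler_norml.
Qed.

Lemma coord_sqr_le_sqnorm x i : x 0 i ^+ 2 <= sqnorm x.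
Proof.
by rewrite /sqnorm (bigD1 i) //= lerDl sumr_ge0// => j _; exact: sqr_ge0.
Qed.

Lemma heat_at_max z x t c r : heat_at z x t c -> 0 < r ->
  (forall i s, `|s| < r -> z (x + s *: e_ i) t <= z x t) ->
  (forall s, t - r < s < t -> z x s <= z x t) -> 0 <= c.
Proof.
move=> [_ [a [l [[da dl] <-]]]] r0 hx ht.
rewrite subr_ge0 (@le_trans _ _ 0)//; last exact: left_max_derive_ge0 da r0 ht.
apply: sumr_le0 => i _; have [g gd ge] := dl i.
apply: (local_max_derive2_le0 gd ge r0) => s; rewrite subr0 => hs.
by rewrite scale0r addr0; exact: hx.
Qed.

(** The weight exp (- K (t - t0)) makes the zero-order term dissipative, and
    the penalty del (1 + |x|^2) forces the maximum to be attained. At a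
    positive maximum the heat operator is nonnegative, while K is chosen so
    that it is at most 2 N del - (2 N + 1) del < 0. Finally del tends to 0. *)
Lemma comparison d t0 t1 L M : 0 <= L ->
  (forall x t, t0 <= t <= t1 -> exists2 c, heat_at d x t c &
     (t0 < t -> 0 <= d x t -> c <= L * d x t)) ->
  (forall x t, t0 <= t <= t1 -> d x t <= M) ->
  (forall x, d x t0 <= 0) ->
  forall x t, t0 <= t <= t1 -> d x t <= 0.
Proof.
move=> L0 hd hM h0 x1 s1 s1I.
(* K exceeds L by 2 N, the Laplacian of |x|^2, and by 1 for strictness. *)
pose K := L + 2 * N%:R + 1.
pose al s := expR (- K * (s - t0)).
have al_gt0 s : 0 < al s by exact: expR_gt0.
have al_le1 s : t0 <= s -> al s <= 1.
  move=> ts; rewrite -expR0 ler_expR /K.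
  have : 0 <= (L + 2 * N%:R + 1) * (s - t0).
    by apply: mulr_ge0; [have := ler0n R N; lra|lra].
  lra.
have al_d s : is_derive s 1 al (- K * al s).
  have h := is_derive_affine s (- K) (K * t0).
  have h2 := is_derive_comp (g := fun s => - K * s + K * t0) (is_derive_expR (- K * s + K * t0)) h.
  apply: is_derive_ext h2 _ _ => [r|]; rewrite /al.
    by congr expR; ring.
  by rewrite mulrC; congr (_ * expR _); ring.
suff main del : 0 < del -> al s1 * d x1 s1 <= del * (1 + sqnorm x1).
  rewrite leNgt; apply/negP => d0.
  have p0 : 0 < al s1 * d x1 s1 by exact: mulr_gt0.
  have q0 : 0 < 1 + sqnorm x1 by have := sqnorm_ge0 x1; lra.
  have := main (al s1 * d x1 s1 / (2 * (1 + sqnorm x1))).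
  rewrite divr_gt0 ?mulr_gt0// => /(_ isT).
  rewrite invfM mulrA mulrVK ?unitfE ?gt_eqF//; lra.
move=> del0; rewrite leNgt; apply/negP => hlt.
pose z x s := al s * d x s - (del * sqnorm (x - 0) + del).
pose M' := `|M|.
have M'M : M <= M' by exact: ler_norm.
have M'0 : 0 <= M' by exact: normr_ge0.
pose D := M' / del + 1 + sqnorm x1.
have q1 := sqnorm_ge0 x1.
have MD0 : 0 <= M' / del by rewrite divr_ge0// ltW.
have D1 : 1 <= D by rewrite /D; lra.
have hz x s : t0 <= s <= t1 -> jointly_continuous_at z x s /\
    exists2 c, heat_at z x s c & (t0 < s -> 0 < z x s -> c < 0).
  move=> sI; have [c hc cle] := hd x s sI.
  have H := heat_at_funB (heat_at_timeM hc (al_d s))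
    (heat_at_funD (heat_at_funZ del (heat_at_sqdist x 0 s))
       (heat_at_time x (is_derive_cst del s (1 : R)))).
  split; first exact: H.1.
  exists (- K * al s * d x s + al s * c - (del * - (2 * N%:R) + 0)); first exact: H.
  move=> ts z0; have {}z0 : del < al s * d x s.
    have : 0 <= del * sqnorm (x - 0) by rewrite mulr_ge0 ?sqnorm_ge0// ltW.
    by move: z0; rewrite /z; lra.
  have dp : 0 <= d x s by rewrite -(pmulr_rge0 _ (al_gt0 s)); lra.
  have := ler_wpM2l (ltW (al_gt0 s)) (cle ts dp).
  have : (2 * N%:R + 1) * del < (2 * N%:R + 1) * (al s * d x s).
    by rewrite ltr_pM2l//; have := ler0n R N; lra.
  rewrite /K; lra.
have cK : compact (cube D `*` `[t0, t1]%classic).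
  by apply: compact_setX; [exact: compact_cube|exact: segment_compact].
have zpos x s : t0 <= s <= t1 -> 0 < z x s -> t0 < s /\ forall i, `|x 0 i| < D.
  move=> sI z0.
  have hsq : 0 <= del * sqnorm (x - 0) by rewrite mulr_ge0 ?sqnorm_ge0// ltW.
  split.
    rewrite lt_neqAle; case/andP: (sI) => -> _; rewrite andbT; apply/eqP => e0.
    move: z0; rewrite /z -e0.
    by have := mulr_ge0_le0 (ltW (al_gt0 t0)) (h0 x); lra.
  move=> i; rewrite ltNge; apply/negP => Di.
  have : D <= sqnorm (x - 0).
    apply: le_trans (coord_sqr_le_sqnorm (x - 0) i).
    rewrite subr0 -(real_normK (num_real (x 0 i))) expr2.
    have : D * D <= `|x 0 i| * `|x 0 i| by apply: ler_pM => //; lra.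
    have : D <= D * D by rewrite ler_peMl//; lra.
    lra.
  have : al s * d x s <= M'.
    case/andP: (sI) => ts _.
    have [d0|d0] := leP (d x s) 0.
      by have := mulr_ge0_le0 (ltW (al_gt0 s)) d0; lra.
    apply: (@le_trans _ _ (d x s)); last exact: le_trans (hM x s sI) _.
    by rewrite ler_piMl ?al_le1// ltW.
  move=> a1 a2; have : M' < del * sqnorm (x - 0).
    apply: (@lt_le_trans _ _ (del * D)); last by rewrite ler_pM2l.
    rewrite /D !mulrDr mulrCA divff ?mulr1 ?gt_eqF//.
    by have := mulr_ge0 (ltW del0) q1; lra.
  by move: z0; rewrite /z; lra.
have z1 : 0 < z x1 s1 by rewrite /z subr0; lra.
have x1I : cube D x1.
  by move=> i; have [_ /(_ i) /ltW] := zpos x1 s1 s1I z1.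
have zc : {within cube D `*` `[t0, t1]%classic, continuous (fun q => z q.1 q.2)}.
  apply: continuous_in_subspaceT => -[x s] /set_mem[/= _]; rewrite in_itv /= => sI.
  exact: (hz x s sI).1.
have ne : (cube D `*` `[t0, t1]%classic) !=set0 by exists (x1, s1); split => //=; rewrite in_itv.
have [[xm tm] /set_mem[/= xmI tmI] hmax] := compact_EVT_max ne cK zc.
rewrite /= in_itv /= in tmI.
have {}hmax x s : cube D x -> t0 <= s <= t1 -> z x s <= z xm tm.
  by move=> xI sI; apply: (hmax (x, s)); rewrite inE; split => //=; rewrite in_itv.
have zm : 0 < z xm tm by apply: lt_le_trans z1 _; exact: hmax.
have [tm0 xmD] := zpos xm tm tmI zm.
have [_ [c hc c0]] := hz xm tm tmI.
have := c0 tm0 zm; apply/negP; rewrite -leNgt.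
have [r r0 hr] : exists2 r : R, 0 < r & forall i, `|xm 0 i| + r <= D.
  exists (\big[Num.min/1]_i (D - `|xm 0 i|)) => [|i].
    by apply/bigmin_gtP; split => // i _; rewrite subr_gt0.
  rewrite addrC -lerBrDr.
  by apply/bigmin_leP; right; exists i.
apply: (@heat_at_max z xm tm c (Num.min r (tm - t0)) hc) => [|i s hs|s hs].
- by rewrite lt_min r0 subr_gt0.
- apply: hmax => // j; rewrite coord_line.
  have := hr j; apply: le_trans; apply: le_trans (ler_normD _ _) _.
  have hsr : `|s| <= r by apply: le_trans (ltW hs) _; rewrite ge_min lexx.
  rewrite lerD2l normrM; apply: le_trans _ hsr.
  by rewrite ler_piMr// normr_nat; case: (i == j).
- apply: hmax => //; case/andP: tmI => _ tm1.
  have h1 : Num.min r (tm - t0) <= tm - t0 by rewrite ge_min lexx orbT.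
  by apply/andP; split; lra.
Qed.

End maximum_principle.

(** * Gradient bounds by reflection *)

Section doubling.
Context {R : realType} {N : nat}.
Implicit Types (x : 'rV[R]_N) (w : 'rV[R]_N -> R -> R) (s t y M G : R).
Local Notation e_ := (@unit_row R N).

(** The second derivative test along a line for k om plus a quadratic
    polynomial. *)
Lemma line_max_derive2 (om g : R -> R) (l k al be r : R) :
  (forall s : R, is_derive s 1 om (g s)) -> is_derive (0 : R) 1 g l -> 0 < r ->
  (forall s, `|s| < r -> k * om s + (al * s ^+ 2 + be * s) <= k * om 0) ->
  k * l + 2 * al <= 0.
Proof.
move=> gd ge r0 h.
pose F s := k * om s + (al * s + be) * s.
pose G s := k * g s + (2 * al * s + be).
have FG (s : R) : is_derive s 1 F (G s).
  have h1 := is_derive_affine s al be.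
  have h2 := is_derive_affine s (1 : R) 0.
  have h3 := is_derive_funM (is_derive_cst k s (1 : R)) (gd s).
  apply: is_derive_ext (is_derive_funD h3 (is_derive_funM h1 h2)) _ _ => [q|].
    by rewrite /F /= mul1r addr0.
  by rewrite /G /=; ring.
have GE : is_derive (0 : R) 1 G (k * l + 2 * al).
  have h3 := is_derive_funM (is_derive_cst k (0 : R) (1 : R)) ge.
  apply: is_derive_ext (is_derive_funD h3 (is_derive_affine 0 (2 * al) be)) _ _ => [q|] //.
  by rewrite mul0r add0r.
apply: (local_max_derive2_le0 FG GE r0) => s; rewrite subr0 => hs.
have := h s hs; rewrite /F; lra.
Qed.

(** A. Brandt's device. The odd difference w(x + y e_i) - w(x - y e_i), seen as
    a function of (x, y, t), solves a parabolic equation of its own: the two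
    points move independently along the axis e_i when x and y move by equal
    or opposite amounts. It vanishes for y = 0, so after multiplication by
    t - t0, which removes the initial values, it lies below the concave
    barrier H (2 y - y^2). The slope of the barrier at y = 0 bounds the
    gradient of w at time t0 + 1 without any regularity of the initial
    values. *)
Lemma reflection_bound w i t0 M G : 0 <= M -> 0 <= G ->
  (forall x t, t0 <= t <= t0 + 1 -> exists2 c, heat_at w x t c & `|c| <= G) ->
  (forall x t, t0 <= t <= t0 + 1 -> `|w x t| <= M) ->
  forall x y, 0 <= y <= 1 ->
  w (x + y *: e_ i) (t0 + 1) - w (x - y *: e_ i) (t0 + 1)
    <= 2 * (2 * G + 2 * M + 1) * y.
Proof.
move=> M0 G0 hw hM x1 y1 y1I.
(* 2 G from the two right-hand sides, 2 M from differentiating t - t0, and 1 to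
   absorb the penalty del. *)
pose H := 2 * G + 2 * M + 1.
pose B y : R := H * (2 * y - y ^+ 2).
pose P x y t := w (x + y *: e_ i) t - w (x - y *: e_ i) t.
have PM x y t : t0 <= t <= t0 + 1 -> P x y t <= 2 * M.
  move=> tI; have := hM (x + y *: e_ i) t tI; have := hM (x - y *: e_ i) t tI.
  by rewrite /P !ler_norml => /andP[h1 h2] /andP[h3 h4]; lra.
suff main del : 0 < del < (2 * N%:R + 2)^-1 ->
    P x1 y1 (t0 + 1) <= B y1 + del * (1 + sqnorm x1).
  have PB : P x1 y1 (t0 + 1) <= B y1.
    rewrite leNgt; apply/negP => d0.
    have q0 : 0 < 1 + sqnorm x1 by have := sqnorm_ge0 x1; lra.
    have n0 : 0 < (2 * N%:R + 2)^-1 :> R by rewrite invr_gt0; have := ler0n R N; lra.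
    pose gap := P x1 y1 (t0 + 1) - B y1.
    have gap0 : 0 < gap by rewrite /gap; lra.
    pose del := Num.min (gap / (1 + sqnorm x1)) (2 * N%:R + 2)^-1 / 2.
    have m0 : 0 < Num.min (gap / (1 + sqnorm x1)) (2 * N%:R + 2)^-1.
      by rewrite lt_min divr_gt0.
    have m1 : Num.min (gap / (1 + sqnorm x1)) (2 * N%:R + 2)^-1 <= gap / (1 + sqnorm x1).
      by rewrite ge_min lexx.
    have m2 : Num.min (gap / (1 + sqnorm x1)) (2 * N%:R + 2)^-1 <= (2 * N%:R + 2)^-1.
      by rewrite ge_min lexx orbT.
    have := main del ltac:(rewrite /del; lra).
    have : del * (1 + sqnorm x1) < gap.
      rewrite -ltr_pdivlMr// /del; have : 0 < gap / (1 + sqnorm x1) by exact: divr_gt0.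
      lra.
    by rewrite /gap; lra.
  apply: le_trans PB _; rewrite -/H.
  have H0 : 0 <= H by rewrite /H; lra.
  by have := mulr_ge0 H0 (sqr_ge0 y1); rewrite /B; lra.
move=> /andP[del0 delN]; rewrite leNgt; apply/negP => hlt.
have delN' : 2 * N%:R * del + 2 * del < 1.
  have n1 : 0 < 2 * N%:R + 2 :> R by have := ler0n R N; lra.
  by rewrite -mulrDl mulrC -ltr_pdivlMr// mul1r.
pose E x y t := (t - t0) * P x y t - B y - del * (1 + sqnorm x).
pose D := 2 * M / del + 1 + sqnorm x1.
have q1 := sqnorm_ge0 x1.
have MD0 : 0 <= 2 * M / del by rewrite divr_ge0// ?mulr_ge0// ltW.
have D1 : 1 <= D by rewrite /D; lra.
have Bge0 y : 0 <= y <= 1 -> 0 <= B y.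
  move=> yI; rewrite /B mulr_ge0//; first by rewrite /H; lra.
  by rewrite expr2; nra.
have Epos x y t : 0 <= y <= 1 -> t0 <= t <= t0 + 1 -> 0 < E x y t ->
    [/\ 0 < y < 1, t0 < t & forall j, `|x 0 j| < D].
  move=> yI tI E0.
  have d1 : 0 <= del * sqnorm x by rewrite mulr_ge0 ?sqnorm_ge0// ltW.
  have tP : (t - t0) * P x y t <= 2 * M.
    have [P0|P0] := leP 0 (P x y t).
      apply: le_trans (PM x y t tI); rewrite ler_piMl//; lra.
    have : (t - t0) * P x y t <= 0 by apply: mulr_ge0_le0; [lra|exact: ltW].
    lra.
  have By := Bge0 y yI.
  move: E0; rewrite /E => E0.
  split.
  - apply/andP; split; rewrite lt_neqAle; case/andP: (yI) => y0 yy1.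
      rewrite y0 andbT; apply/eqP => ye; move: E0.
      by rewrite /P /B -ye scale0r addr0 subr0 subrr mulr0; lra.
    rewrite yy1 andbT; apply/eqP => ye; move: E0 tP.
    by rewrite /B ye /H; lra.
  - rewrite lt_neqAle; case/andP: (tI) => -> _; rewrite andbT; apply/eqP => te.
    by move: E0; rewrite -te subrr mul0r; lra.
  - move=> j; rewrite ltNge; apply/negP => Dj.
    have : D <= sqnorm x.
      apply: le_trans (coord_sqr_le_sqnorm x j).
      rewrite -(real_normK (num_real (x 0 j))) expr2.
      have : D * D <= `|x 0 j| * `|x 0 j| by apply: ler_pM => //; lra.
      have : D <= D * D by rewrite ler_peMl//; lra.
      lra.
    move=> a1; have : 2 * M < del * sqnorm x.
      apply: (@lt_le_trans _ _ (del * D)); last by rewrite ler_pM2l.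
      rewrite /D !mulrDr [del * (2 * M / del)]mulrC divfK ?gt_eqF//.
      by have := mulr_ge0 (ltW del0) q1; lra.
    lra.
have E1 : 0 < E x1 y1 (t0 + 1).
  by rewrite /E (_ : t0 + 1 - t0 = 1); [move: hlt; lra|ring].
have t1I : t0 <= t0 + 1 <= t0 + 1 by apply/andP; split; lra.
have x1I : cube D x1.
  by move=> j; have [_ _ /(_ j) /ltW] := Epos x1 y1 (t0 + 1) y1I t1I E1.
pose K : set (('rV[R]_N * R) * R) := (cube D `*` `[0, 1]%classic) `*` `[t0, t0 + 1]%classic.
have cK : compact K.
  apply: compact_setX; last exact: segment_compact.
  by apply: compact_setX; [exact: compact_cube|exact: segment_compact].
have Pc k x y t : t0 <= t <= t0 + 1 ->
    {for ((x, y), t), continuous (fun q : ('rV[R]_N * R) * R =>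
      w (q.1.1 + (k * q.1.2) *: e_ i) q.2)}.
  move=> tI; have [c [hc _] _] := hw (x + (k * y) *: e_ i) t tI.
  have c11 : (fun q : ('rV[R]_N * R) * R => q.1.1) @ ((x, y), t) --> x.
    by apply: (@cvg_comp _ _ _ fst fst); [exact: cvg_fst|exact: cvg_fst].
  have c12 : (fun q : ('rV[R]_N * R) * R => q.1.2) @ ((x, y), t) --> y.
    by apply: (@cvg_comp _ _ _ fst snd); [exact: cvg_fst|exact: cvg_snd].
  have c2 : (fun q : ('rV[R]_N * R) * R => q.2) @ ((x, y), t) --> t by exact: cvg_snd.
  have h1 : (fun q : ('rV[R]_N * R) * R => q.1.1 + (k * q.1.2) *: e_ i) @ ((x, y), t)
      --> x + (k * y) *: e_ i.
    apply: cvgD => //; apply: cvgZr_tmp; apply: cvgM c12; exact: cvg_cst.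
  have h2 : (fun q : ('rV[R]_N * R) * R => (q.1.1 + (k * q.1.2) *: e_ i, q.2))
      @ ((x, y), t) --> (x + (k * y) *: e_ i, t) by exact: cvg_pair h1 c2.
  exact: (@continuous_comp _ _ _
    (fun q : ('rV[R]_N * R) * R => (q.1.1 + (k * q.1.2) *: e_ i, q.2))
    (fun q : 'rV[R]_N * R => w q.1 q.2) _ h2 hc).
have c12 x y t : (fun q : ('rV[R]_N * R) * R => q.1.2) @ ((x, y), t) --> y.
  by apply: (@cvg_comp _ _ _ fst snd); [exact: cvg_fst|exact: cvg_snd].
have c11 x y t : (fun q : ('rV[R]_N * R) * R => q.1.1) @ ((x, y), t) --> x.
  by apply: (@cvg_comp _ _ _ fst fst); [exact: cvg_fst|exact: cvg_fst].
have EE x y t : E x y t = (t - t0) * (w (x + (1 * y) *: e_ i) t -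
    w (x + (- 1 * y) *: e_ i) t) - H * (2 * y - y * y) - del * (1 + sqnorm x).
  by rewrite /E /P /B mul1r mulN1r scaleNr expr2.
have Ec : {within K, continuous (fun q => E q.1.1 q.1.2 q.2)}.
  apply: continuous_in_subspaceT => -[[x y] t] /set_mem[/= _]; rewrite in_itv /= => tI.
  rewrite (_ : (fun q => _) = (fun q : ('rV[R]_N * R) * R =>
    (q.2 - t0) * (w (q.1.1 + (1 * q.1.2) *: e_ i) q.2 -
    w (q.1.1 + (- 1 * q.1.2) *: e_ i) q.2) - H * (2 * q.1.2 - q.1.2 * q.1.2)
      - del * (1 + sqnorm q.1.1))); last by apply/funext => q; exact: EE.
  have h1 := Pc 1 x y t tI; have h2 := Pc (-1) x y t tI.
  apply: cvgB; first apply: cvgB; first apply: cvgM.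
  - by apply: cvgB; [exact: cvg_snd|exact: cvg_cst].
  - by apply: cvgB; [exact: h1|exact: h2].
  - apply: cvgM; first exact: cvg_cst.
    apply: cvgB; last exact: cvgM (c12 x y t) (c12 x y t).
    by apply: cvgM (c12 x y t); exact: cvg_cst.
  - apply: cvgM; first exact: cvg_cst.
    apply: cvgD; first exact: cvg_cst.
    exact: (@cvg_comp _ _ _ _ _ _ _ _ (c11 x y t) (@continuous_sqnorm _ _ x)).
have ne : K !=set0.
  by exists ((x1, y1), t0 + 1); split => /=; [split => //|]; rewrite /= in_itv.
have [[[x y] t] /set_mem[/= [xI yI] tI] hmax] := compact_EVT_max ne cK Ec.
rewrite /= in_itv /= in tI; rewrite /= in_itv /= in yI.
have {}hmax x' y' t' : cube D x' -> 0 <= y' <= 1 -> t0 <= t' <= t0 + 1 ->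
    E x' y' t' <= E x y t.
  move=> xI' yI' tI'; apply: (hmax ((x', y'), t')); rewrite inE.
  by split => /=; [split => //|]; rewrite /= in_itv.
have Em : 0 < E x y t by apply: lt_le_trans E1 _; exact: hmax.
have [y01 tt0 xD] := Epos x y t yI tI Em.
have [c [_ [a [l [[da dl] dc]]]] cG] := hw (x + y *: e_ i) t tI.
have [c' [_ [a' [l' [[da' dl'] dc']]]] cG'] := hw (x - y *: e_ i) t tI.
have testt : 0 <= (t - t0) * (a - a') + P x y t.
  have h := is_derive_funM (is_derive_affine t 1 (- t0)) (is_derive_funB da da').
  have -> : (t - t0) * (a - a') + P x y t = 1 * (w (x + y *: e_ i) t -
    w (x - y *: e_ i) t) + (1 * t - t0) * (a - a') by rewrite /P; ring.
  apply: (left_max_derive_ge0 h (_ : 0 < t - t0)) => [|s hs]; first by rewrite subr_gt0.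
  have := hmax x y s xI yI ltac:(clear -hs tI tt0; apply/andP; split; lra).
  by rewrite /E /P; clear -x; lra.
have testj j : j != i -> (t - t0) * (l j - l' j) - 2 * del <= 0.
  move=> ji; have [g gd ge] := dl j; have [g' gd' ge'] := dl' j.
  have fd s : is_derive s 1 (fun s => w (x + y *: e_ i + s *: e_ j) t -
    w (x - y *: e_ i + s *: e_ j) t) (g s - g' s) by exact: is_derive_funB.
  have := @line_max_derive2 _ _ _ (t - t0) (- del) (- del * (2 * x 0 j))
    (D - `|x 0 j|) fd (is_derive_funB ge ge').
  rewrite subr_gt0 => /(_ (xD j)).
  rewrite mulrN; apply => s hs.
  have xsI : cube D (x + s *: e_ j).
    move=> k; rewrite coord_line; have [<-|jk] := eqVneq j k.
      by rewrite mulr1 (le_trans (ler_normD _ _))//; clear -hs; lra.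
    by rewrite mulr0 addr0 ltW.
  have := hmax (x + s *: e_ j) y t xsI yI tI.
  rewrite /E /P sqnorm_line !scale0r !addr0 [x + s *: _ + _]addrAC [x + s *: _ - _]addrAC.
  by clear -x; lra.
have dist_line s : `|s| < D - `|x 0 i| -> cube D (x + (s / 2) *: e_ i).
  move=> hs k; rewrite coord_line; have [<-|ik] := eqVneq i k.
    rewrite mulr1 (le_trans (ler_normD _ _))// normrM (ger0_norm (_ : 0 <= 2^-1))//.
    by have := normr_ge0 s; clear -hs; lra.
  by rewrite mulr0 addr0 ltW.
pose r := Num.min (D - `|x 0 i|) (Num.min y (1 - y)).
have r0 : 0 < r by rewrite !lt_min subr_gt0 xD; clear -y01; lra.
have rI s : `|s| < r -> `|s| < D - `|x 0 i| /\ 0 <= y + s / 2 <= 1 /\ 0 <= y - s / 2 <= 1.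
  rewrite !lt_min => /and3P[h1 h2 h3]; split => //.
  have h4 := ler_norm s; have h5 := ler_norm (- s); rewrite normrN in h5.
  by clear -h2 h3 h4 h5; split; apply/andP; split; lra.
have E2 s : e_ i = 2^-1 *: e_ i + 2^-1 *: e_ i :> 'rV[R]_N.
  by rewrite -scalerDl (_ : 2^-1 + 2^-1 = 1 :> R) ?scale1r//; field.
(* Moving x and y by the same amount moves x + y e_i and fixes x - y e_i. *)
have testp : (t - t0) * l i + 2 * (H / 4 - del / 4) <= 0.
  have [g gd ge] := dl i.
  apply: (@line_max_derive2 _ _ _ (t - t0) (H / 4 - del / 4)
    (H * (y - 1) - del * x 0 i) r gd ge r0) => s /rI[h1 [h2 h3]].
  have := hmax _ _ t (dist_line s h1) h2 tI.
  rewrite /E /P /B sqnorm_line scale0r addr0.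
  have -> : x + (s / 2) *: e_ i + (y + s / 2) *: e_ i = x + y *: e_ i + s *: e_ i.
    by rewrite -!addrA -!scalerDl; congr (_ + _ *: _); field.
  have -> : x + (s / 2) *: e_ i - (y + s / 2) *: e_ i = x - y *: e_ i.
    by rewrite -!addrA -!scaleNr -!scalerDl; congr (_ + _ *: _); field.
  by clear -x; lra.
(* Moving x and y by opposite amounts fixes x + y e_i instead. *)
have testm : (t - t0) * (- l' i) + 2 * (H / 4 - del / 4) <= 0.
  have [g gd ge] := dl' i.
  rewrite mulrN -mulNr.
  apply: (@line_max_derive2 _ _ _ (- (t - t0)) (H / 4 - del / 4)
    (H * (1 - y) - del * x 0 i) r gd ge r0) => s /rI[h1 [h2 h3]].
  have := hmax _ _ t (dist_line s h1) h3 tI.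
  rewrite /E /P /B sqnorm_line scale0r addr0.
  have -> : x + (s / 2) *: e_ i + (y - s / 2) *: e_ i = x + y *: e_ i.
    by rewrite -!addrA -!scalerDl; congr (_ + _ *: _); field.
  have -> : x + (s / 2) *: e_ i - (y - s / 2) *: e_ i = x - y *: e_ i + s *: e_ i.
    by rewrite -!addrA -(scaleNr (y - s / 2)) -(scaleNr y) -!scalerDl;
      congr (_ + _ *: _); field.
  by clear -x; lra.
have sum_l : (t - t0) * (\sum_j l j - \sum_j l' j) <= 2 * N%:R * del - del - H.
  rewrite -sumrB mulr_sumr (bigD1 i) //=.
  have : \sum_(j < N | j != i) (t - t0) * (l j - l' j) <= \sum_(j < N | j != i) 2 * del.
    by apply: ler_sum => j /testj; clear -x; lra.
  have : \sum_(j < N | j != i) 2 * del = 2 * N%:R * del - 2 * del.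
    have : \sum_(j < N) 2 * del = 2 * N%:R * del.
      by rewrite sumr_const card_ord -mulr_natl; ring.
    by rewrite (bigD1 i) //= => <-; ring.
  by move=> ->; clear -testp testm; lra.
have cc : (t - t0) * (c - c') <= 2 * G.
  apply: (@le_trans _ _ ((t - t0) * (2 * G))).
    by apply: ler_wpM2l; [clear -tt0; lra|move: cG cG'; rewrite !ler_norml; clear -x; lra].
  by apply: ler_piMl; clear -G0 tI; lra.
have PM' := PM x y t tI.
have : (t - t0) * (a - a') = (t - t0) * (\sum_j l j - \sum_j l' j) + (t - t0) * (c - c').
  by rewrite -dc -dc'; ring.
by move: testt sum_l; rewrite /H; clear -PM' cc del0 delN'; lra.
Qed.

End doubling.

(** * Uniform continuity in time of the time derivative *)

Section moduli_of_continuity.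
Context {R : realType} {N : nat}.
Implicit Types (x y : 'rV[R]_N) (w v : 'rV[R]_N -> R -> R) (s t h r a b M G C L F : R).
Local Notation e_ := (@unit_row R N).

Lemma axis_lipschitz w t0 M G : 0 <= M -> 0 <= G ->
  (forall x t, t0 <= t <= t0 + 1 -> exists2 c, heat_at w x t c & `|c| <= G) ->
  (forall x t, t0 <= t <= t0 + 1 -> `|w x t| <= M) ->
  forall x i s,
  `|w (x + s *: e_ i) (t0 + 1) - w x (t0 + 1)| <= (2 * G + 2 * M + 1) * `|s|.
Proof.
move=> M0 G0 hw hM.
have pos x i s : 0 <= s <= 2 ->
    `|w (x + s *: e_ i) (t0 + 1) - w x (t0 + 1)| <= (2 * G + 2 * M + 1) * s.
  move=> s02.
  have sE : s = s / 2 + s / 2 by field.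
  have E1 : x + (s / 2) *: e_ i + (s / 2) *: e_ i = x + s *: e_ i.
    by rewrite -addrA -scalerDl -sE.
  have E2 : x + (s / 2) *: e_ i - (s / 2) *: e_ i = x by rewrite addrK.
  have hy : 0 <= s / 2 <= 1 by apply/andP; split; lra.
  have := reflection_bound i M0 G0 hw hM (x + (s / 2) *: e_ i) hy.
  have hwN z t : t0 <= t <= t0 + 1 -> exists2 c, heat_at (fun x t => - w x t) z t c & `|c| <= G.
    by move=> tI; have [c hc cG] := hw z t tI; exists (- c); [exact: heat_at_funN|rewrite normrN].
  have hMN z t : t0 <= t <= t0 + 1 -> `|- w z t| <= M by rewrite normrN; exact: hM.
  have := reflection_bound i M0 G0 hwN hMN (x + (s / 2) *: e_ i) hy.
  by rewrite E1 E2 ler_norml => h1 h2; apply/andP; split; lra.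
move=> x i s; have [s2|s2] := leP `|s| 2; last first.
  have tI : t0 <= t0 + 1 <= t0 + 1 by apply/andP; split; lra.
  apply: le_trans (ler_normB _ _) _.
  apply: le_trans (lerD (hM _ _ tI) (hM _ _ tI)) _.
  have := ler_pM (_ : 0 <= 2 * G + 2 * M + 1) (_ : 0 <= 2) (lexx (2 * G + 2 * M + 1)) (ltW s2).
  by move=> /(_ ltac:(lra) ltac:(lra)); lra.
have [s0|s0] := leP 0 s.
  by rewrite (ger0_norm s0) pos// s0 -(ger0_norm s0).
have := pos (x + s *: e_ i) i (- s).
rewrite -addrA -scalerDl subrr scale0r addr0 distrC (ltr0_norm s0) => -> //.
by rewrite -(ltr0_norm s0) s2 normr_ge0.
Qed.

(** A Lipschitz function lies below the paraboloids C (eps + s^2 / (4 eps)), and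
    adding a linear function of time makes them supersolutions. *)
Lemma time_growth w x0 t0 tau M G C eps : 0 <= G -> 0 <= C -> 0 < eps -> 0 <= tau ->
  (forall x t, t0 <= t <= t0 + tau -> exists2 c, heat_at w x t c & c <= G) ->
  (forall x t, t0 <= t <= t0 + tau -> `|w x t| <= M) ->
  (forall x i s, `|w (x + s *: e_ i) t0 - w x t0| <= C * `|s|) ->
  w x0 (t0 + tau) - w x0 t0 <=
    N%:R * C * eps + (G + N%:R * C / (2 * eps)) * tau.
Proof.
move=> G0 C0 e0 tau0 hw hM hC.
pose k := C / (4 * eps).
have k0 : 0 <= k by rewrite divr_ge0// mulr_ge0// ltW.
pose A := G + N%:R * C / (2 * eps).
pose q x t := k * sqnorm (x - x0) + (A * t + (N%:R * C * eps + w x0 t0 - A * t0)).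
pose d x t := w x t - q x t.
have hd x t : t0 <= t <= t0 + tau -> exists2 c, heat_at d x t c &
    (t0 < t -> 0 <= d x t -> c <= 0 * d x t).
  move=> tI; have [c hc cG] := hw x t tI.
  exists (c - (k * - (2 * N%:R) + A)).
    apply: heat_at_funB => //; apply: heat_at_funD.
      exact: heat_at_funZ (heat_at_sqdist _ _ _).
    by apply: heat_at_time; exact: is_derive_affine.
  have -> : k * - (2 * N%:R) = - (N%:R * C / (2 * eps)).
    by rewrite /k; field; rewrite gt_eqF.
  by rewrite /A; lra.
have tI0 : t0 <= t0 <= t0 + tau by apply/andP; split; lra.
have NC0 : 0 <= N%:R * C by rewrite mulr_ge0.
have A0 : 0 <= A by rewrite /A addr_ge0// divr_ge0// mulr_ge0// ltW.
have hdM x t : t0 <= t <= t0 + tau -> d x t <= 2 * M.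
  move=> tI; have := hM x t tI; have := hM x0 t0 tI0; rewrite /d /q.
  have h1 : 0 <= k * sqnorm (x - x0) by rewrite mulr_ge0// sqnorm_ge0.
  have h2 : 0 <= A * (t - t0) by rewrite mulr_ge0//; lra.
  have h3 : 0 <= N%:R * C * eps by rewrite mulr_ge0// ltW.
  by rewrite !ler_norml => /andP[? ?] /andP[? ?]; lra.
have hd0 x : d x t0 <= 0.
  have := @coord_lipschitz R N (fun _ _ => True) (w^~ t0) C.
  move=> /(_ (fun z i s _ _ => hC z i s) x0 x (fun=> I) (fun=> I)).
  have : C * \sum_i `|x 0 i - x0 0 i| <= N%:R * C * eps + k * sqnorm (x - x0).
    have -> : N%:R * C * eps = \sum_(i < N) C * eps.
      by rewrite sumr_const card_ord -[RHS]mulr_natl mulrA.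
    rewrite /sqnorm !mulr_sumr -big_split /=; apply: ler_sum => i _.
    rewrite !mxE; set r := x 0 i - x0 0 i.
    have -> : r ^+ 2 = `|r| ^+ 2 by rewrite real_normK// num_real.
    have -> : C * eps + k * `|r| ^+ 2 = C * `|r| + k * (`|r| - 2 * eps) ^+ 2.
      by rewrite /k; field; rewrite gt_eqF.
    by rewrite lerDl mulr_ge0// sqr_ge0.
  by rewrite ler_norml /d /q /= => h1 /andP[h2 h3]; lra.
have tI1 : t0 <= t0 + tau <= t0 + tau by apply/andP; split; lra.
have := comparison (lexx 0) hd hdM hd0 x0 tI1.
rewrite /d /q subrr (_ : sqnorm 0 = 0); last first.
  by rewrite /sqnorm big1// => i _; rewrite mxE expr0n.
by rewrite /A; lra.
Qed.

Lemma derive_le_lipschitz (g : R -> R) (x a C r : R) : is_derive x 1 g a ->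
  0 < r -> (forall h, 0 < h < r -> `|g (x + h) - g x| <= C * h) -> `|a| <= C.
Proof.
move=> ga r0 hg; rewrite leNgt; apply/negP => Ca.
have [d d0 hd] := is_derive_small_o ga (e := (`|a| - C) / 2) ltac:(lra).
pose h := Num.min d r / 2.
have m0 : 0 < Num.min d r by rewrite lt_min d0.
have md : Num.min d r <= d by rewrite ge_min lexx.
have mr : Num.min d r <= r by rewrite ge_min lexx orbT.
have h0 : 0 < h by rewrite /h; lra.
have := hd h; rewrite gtr0_norm// => /(_ ltac:(rewrite /h; lra)).
have := hg h ltac:(apply/andP; split; rewrite /h; lra).
set D := g (x + h) - g x => h1 h2.
have : `|a * h| <= C * h + (`|a| - C) / 2 * h.
  rewrite -(subrK D (a * h)) [C * h + _]addrC (le_trans (ler_normD _ _))// lerD//.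
  by rewrite distrC.
rewrite normrM (gtr0_norm h0) -mulrDl ler_pM2r//; lra.
Qed.

Variables (f : R -> R) (p L F : R) (v : 'rV[R]_N -> R -> R).
Hypothesis L0 : 0 <= L.
Hypothesis f_lip : forall a b, 0 <= a <= p -> 0 <= b <= p ->
  `|f a - f b| <= L * `|a - b|.
Hypothesis f_bound : forall a, 0 <= a <= p -> `|f a| <= F.
Hypothesis v_C2 : C2_pos v.
Hypothesis v_eq : solves_eq f v.
Hypothesis v_range : forall x t, 0 < t -> 0 <= v x t <= p.

Let p0 : 0 <= p.
Proof. by have /andP[h1 h2] := v_range 0 ltr01; exact: le_trans h1 h2. Qed.

Let F0 : 0 <= F.
Proof. by apply: le_trans (f_bound (_ : 0 <= 0 <= p)); rewrite ?lexx. Qed.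

Let v_C21 : C21_pos v.
Proof. by split; [exact: v_C2.1|move=> i j; exact: v_C2.2]. Qed.

Let v_heat x t : 0 < t -> heat_at v x t (f (v x t)).
Proof. exact: C21_pos_heat. Qed.

Let C1 := 2 * F + 2 * p + 1.
Let C1_ge0 : 0 <= C1. Proof. by rewrite /C1; have := F0; have := p0; lra. Qed.

Lemma space_lipschitz x i s t : 1 < t -> `|v (x + s *: e_ i) t - v x t| <= C1 * `|s|.
Proof.
move=> t1; have := @axis_lipschitz v (t - 1) p F p0 F0.
rewrite subrK; apply => [y r rI|y r rI].
  have r0 : 0 < r by lra.
  by exists (f (v y r)); [exact: v_heat|apply: f_bound; exact: v_range].
by have /andP[h1 h2] := v_range y (ltac:(lra) : 0 < r); rewrite ger0_norm.
Qed.

Let C2 := 2 * (L * C1) + 2 * C1 + 1.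
Let C2_ge0 : 0 <= C2.
Proof. by rewrite /C2; have := C1_ge0; have := mulr_ge0 L0 C1_ge0; lra. Qed.

(** The gradient bound applied to a difference quotient of v, itself bounded by
    the gradient bound for v: the equation is never differentiated. *)
Lemma space_second_difference x i s h t : 2 < t ->
  `|v (x + s *: e_ i + h *: e_ i) t - v (x + s *: e_ i) t
    - (v (x + h *: e_ i) t - v x t)| <= C2 * `|s| * `|h|.
Proof.
move=> t2; have [->|h0] := eqVneq h 0.
  by rewrite !scale0r !addr0 !subrr normr0 mulr0.
pose w x t := h^-1 * (v (x + h *: e_ i) (t + 0) - v x t).
have nh0 : 0 < `|h| by rewrite normr_gt0.
have key y r (D : R) : `|v (y + h *: e_ i) r - v y r| <= D * `|h| ->
    `|h^-1 * (v (y + h *: e_ i) (r + 0) - v y r)| <= D.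
  by move=> hD; rewrite addr0 normrM normfV mulrC ler_pdivrMr.
have := @axis_lipschitz w (t - 1) C1 (L * C1) C1_ge0 (mulr_ge0 L0 C1_ge0).
rewrite subrK => /(_ _ _ x i s).
have hw y r : t - 1 <= r <= t -> exists2 c, heat_at w y r c & `|c| <= L * C1.
  move=> rI; have r0 : 0 < r by lra.
  exists (h^-1 * (f (v (y + h *: e_ i) (r + 0)) - f (v y r))).
    apply: heat_at_funZ; apply: heat_at_funB; last exact: v_heat.
    by apply: heat_at_shift; apply: v_heat; rewrite addr0.
  rewrite addr0 normrM normfV mulrC ler_pdivrMr//.
  apply: le_trans (f_lip (v_range _ _) (v_range _ _)) _ => //.
  by rewrite -mulrA ler_wpM2l// space_lipschitz//; lra.
have hM y r : t - 1 <= r <= t -> `|w y r| <= C1.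
  by move=> rI; apply: key; apply: space_lipschitz; lra.
move=> /(_ hw hM); rewrite /w !addr0 -mulrBr normrM normfV mulrC ler_pdivrMr//.
Qed.

Lemma space_second_derive_bound x i t : 2 < t ->
  `|partial (Some i) (partial (Some i) v) x t| <= C2.
Proof.
move=> t2; have t0 : 0 < t by lra.
have d1 s : is_derive s 1 (fun r : R => v (x + r *: e_ i) t)
    (partial (Some i) v (x + s *: e_ i) t).
  exact: C1_along_is_derive (v_C21.1 _) t0.
have lip s : `|partial (Some i) v (x + s *: e_ i) t - partial (Some i) v x t|
    <= C2 * `|s|.
  pose g r := v (x + s *: e_ i + r *: e_ i) t - v (x + r *: e_ i) t.
  have gd : is_derive (0 : R) 1 g
      (partial (Some i) v (x + s *: e_ i) t - partial (Some i) v x t).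
    apply: is_derive_funB; last by have := d1 0; rewrite scale0r addr0.
    have := C1_along_is_derive (x + s *: e_ i) 0 (v_C21.1 (Some i)) t0.
    by rewrite scale0r addr0.
  apply: (derive_le_lipschitz gd ltr01) => h /andP[h0 _].
  have := space_second_difference x i s h t2.
  rewrite /g add0r scale0r !addr0 (gtr0_norm h0).
  by congr (_ <= _); congr `|_|; ring.
have := C1_along_is_derive x 0 (v_C21.2 i i) t0.
rewrite scale0r addr0 => gd.
apply: (derive_le_lipschitz gd ltr01) => h /andP[h0 _].
by have := lip h; rewrite add0r scale0r addr0 (gtr0_norm h0).
Qed.

Let C3 := N%:R * C2 + F.
Let C3_ge0 : 0 <= C3.
Proof. by rewrite addr_ge0// mulr_ge0. Qed.

Lemma time_derive_bound x t : 2 < t -> `|partial None v x t| <= C3.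
Proof.
move=> t2; have t0 : 0 < t by lra.
have -> : partial None v x t = laplacian v x t + f (v x t).
  by rewrite -(v_eq x t0) addrC subrK.
apply: le_trans (ler_normD _ _) _; apply: lerD; last by apply: f_bound; exact: v_range.
apply: le_trans (ler_norm_sum _ _ _) _.
apply: (@le_trans _ _ (\sum_(i < N) C2)).
  by apply: ler_sum => i _; exact: space_second_derive_bound.
by rewrite sumr_const card_ord mulr_natl.
Qed.

Let C4 := 2 * (L * C3) + 2 * C3 + 1.
Let C4_ge0 : 0 <= C4.
Proof. by rewrite /C4; have := C3_ge0; have := mulr_ge0 L0 C3_ge0; lra. Qed.

(** Difference quotients in time; the summand 0 presents them as combinations
    of translates. *)
Let quotient h x t := h^-1 * (v (x + 0) (t + h) - v x t).

Let quotient_bound h x t : 0 < h -> 2 < t -> `|quotient h x t| <= C3.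
Proof.
move=> h0 t2; rewrite /quotient addr0 normrM normfV mulrC ler_pdivrMr ?normr_gt0 ?gt_eqF//.
have := @derive_bound_lipschitz _ (v x) (partial None v x) t (t + h) C3.
rewrite [t + h - t]addrC addKr; apply => r rI.
have r2 : 2 < r by case/orP: rI; lra.
split; first by apply: C1_time_is_derive; [exact: v_C21.1|lra].
exact: time_derive_bound.
Qed.

(** f is Lipschitz on the range of v, so the quotient solves a heat equation
    with a bounded right-hand side, uniformly in h. *)
Let quotient_heat h x t : 0 < h -> 2 < t ->
  exists2 c, heat_at (quotient h) x t c & `|c| <= L * C3.
Proof.
move=> h0 t2; exists (h^-1 * (f (v (x + 0) (t + h)) - f (v x t))).
  apply: heat_at_funZ; apply: heat_at_funB; last by apply: v_heat; lra.
  by apply: heat_at_shift; apply: v_heat; lra.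
rewrite normrM.
have := quotient_bound x h0 t2; rewrite /quotient addr0 normrM => hq.
apply: (@le_trans _ _ (`|h^-1| * (L * `|v x (t + h) - v x t|))).
  by apply: ler_wpM2l => //; apply: f_lip; apply: v_range; lra.
by rewrite mulrCA ler_wpM2l.
Qed.

Let time_derive_growth x t tau eps : 3 < t -> 0 <= tau -> 0 < eps ->
  `|partial None v x (t + tau) - partial None v x t| <=
  N%:R * C4 * eps + (L * C3 + N%:R * C4 / (2 * eps)) * tau.
Proof.
move=> t3 tau0 e0.
have LC0 : 0 <= L * C3 by exact: mulr_ge0.
have lip h : 0 < h -> forall y i s,
    `|quotient h (y + s *: e_ i) t - quotient h y t| <= C4 * `|s|.
  move=> h0; have := @axis_lipschitz (quotient h) (t - 1) C3 (L * C3) C3_ge0 LC0.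
  rewrite subrK => H y i s; apply: H => z r rI.
    by apply: quotient_heat => //; lra.
  by apply: quotient_bound => //; lra.
have tp : 0 < t by lra. have ttp : 0 < t + tau by lra.
have d1 := C1_time_is_derive x (v_C21.1 None) tp.
have d2 := C1_time_is_derive x (v_C21.1 None) ttp.
have shift (r a : R) : is_derive r 1 (v x) a -> is_derive (0 : R) 1 (fun h => v x (r + h)) a.
  move=> da; have da' : is_derive (1 * 0 + r) 1 (v x) a by rewrite mulr0 add0r.
  have := is_derive_comp (g := fun s => 1 * s + r) da' (is_derive_affine 0 1 r).
  rewrite mulr1 => dd; apply: is_derive_ext dd _ _ => // h.
  by rewrite mul1r addrC.
apply: (derive_le_lipschitz (is_derive_funB (shift _ _ d2) (shift _ _ d1)) ltr01).
move=> h /andP[h0 _]; rewrite !add0r !addr0.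
have -> : v x (t + tau + h) - v x (t + h) - (v x (t + tau) - v x t) =
    h * (quotient h x (t + tau) - quotient h x t).
  by rewrite /quotient addr0; field; rewrite gt_eqF.
rewrite normrM (gtr0_norm h0) mulrC ler_pM2r// ler_norml; apply/andP; split.
  rewrite lerNl opprB -[quotient h x t]opprK [- - quotient h x t - _]addrC.
  have := @time_growth (fun x t => - quotient h x t) x t tau C3 (L * C3) C4 eps
    LC0 C4_ge0 e0 tau0.
  apply => [y r rI|y r rI|y i s].
  - have [c hc cb] := @quotient_heat h y r h0 ltac:(lra).
    exists (- c); first exact: heat_at_funN.
    by rewrite (le_trans (ler_norm _))// normrN.
  - by rewrite normrN; apply: quotient_bound => //; lra.
  - by rewrite -opprD normrN; exact: lip.
apply: (@time_growth (quotient h) x t tau C3 (L * C3) C4 eps) => //.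
- move=> y r rI; have [c hc cb] := @quotient_heat h y r h0 ltac:(lra).
  by exists c => //; exact: le_trans (ler_norm _) cb.
- by move=> y r rI; apply: quotient_bound => //; lra.
- exact: lip.
Qed.

(** The gradient bound for the quotients (v(t + h) - v(t)) / h is uniform in h;
    time_growth turns it into a modulus of continuity in time, which survives
    the limit h -> 0. *)
Lemma time_derive_unif_continuous kap : 0 < kap -> exists2 tau, 0 < tau &
  forall x t s, 3 < t -> 0 <= s <= tau ->
    `|partial None v x (t + s) - partial None v x t| <= kap.
Proof.
move=> k0.
have NC : 0 <= N%:R * C4 by rewrite mulr_ge0.
pose eps := kap / (2 * (N%:R * C4 + 1)).
have e0 : 0 < eps by rewrite divr_gt0// mulr_gt0//; lra.
pose A := L * C3 + N%:R * C4 / (2 * eps) + 1.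
have A0 : 0 < A.
  have LC0 : 0 <= L * C3 by exact: mulr_ge0.
  have : 0 <= N%:R * C4 / (2 * eps) by rewrite divr_ge0//; lra.
  by rewrite /A; lra.
exists (kap / (2 * A)); first by rewrite divr_gt0// mulr_gt0.
move=> x t s t3 /andP[s0 sk].
apply: le_trans (time_derive_growth x t3 s0 e0) _.
have h1 : N%:R * C4 * eps <= kap / 2.
  have : (N%:R * C4 + 1) * eps = kap / 2 by rewrite /eps; field; rewrite gt_eqF//; lra.
  by move=> <-; rewrite ler_pM2r//; lra.
have h2 : (L * C3 + N%:R * C4 / (2 * eps)) * s <= kap / 2.
  apply: (@le_trans _ _ (A * s)); first by apply: ler_wpM2r => //; rewrite /A; lra.
  have -> : kap / 2 = A * (kap / (2 * A)) by field; rewrite gt_eqF.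
  by rewrite ler_pM2l.
lra.
Qed.

End moduli_of_continuity.

(** * Affine supersolutions of the reaction-diffusion equation *)

Section reaction.
Context {R : realType}.
Implicit Types (f : R -> R) (a b K : R).

Lemma derivable_continuous f : (forall s : R, derivable f s 1) -> continuous f.
Proof. by move=> df s; apply: is_derive_continuous (derivableP (df s)). Qed.

Lemma C1_bounded_lipschitz f K : (forall s : R, derivable f s 1) ->
  continuous f^`() -> 0 <= K ->
  exists2 L, 0 <= L & forall a b, - K <= a <= K -> - K <= b <= K ->
    `|f a - f b| <= L * `|a - b|.
Proof.
move=> df cf K0.
have KK : - K <= K by lra.
have nc : {within `[- K, K], continuous (fun s => `|f^`() s|)}.
  apply: continuous_subspaceT => s.
  exact: (@continuous_comp _ _ _ f^`() (fun r : R => `|r|) _ (cf s) (@norm_continuous _ _ _)).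
have [c _ hc] := EVT_max KK nc.
exists `|f^`() c| => // a b aK bK.
apply: (@derive_bound_lipschitz _ f f^`()) => s sI; split.
  by rewrite derive1E; exact: derivableP.
by apply: hc; rewrite in_itv /=; case/orP: sI; lra.
Qed.

Lemma neg_on_segment f a b : continuous f -> a <= b ->
  (forall s, a <= s <= b -> f s < 0) ->
  exists2 m, 0 < m & forall s, a <= s <= b -> f s <= - m.
Proof.
move=> cf ab fneg.
have [c cI hc] := EVT_max ab (continuous_subspaceT cf).
exists (- f c); first by rewrite oppr_gt0 fneg//; move: cI; rewrite in_itv.
by move=> s sI; rewrite opprK; apply: hc; rewrite in_itv.
Qed.

End reaction.

Section affine_supersolutions.
Context {R : realType} {N : nat}.
Implicit Types (x y : 'rV[R]_N) (z : 'rV[R]_N -> R -> R) (f : R -> R).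
Implicit Types (s t a b A mu M L D eps : R).

Lemma sqnormB_ge x y : sqnorm y <= 2 * sqnorm x + 2 * sqnorm (x - y).
Proof.
rewrite /sqnorm !mulr_sumr -big_split /=; apply: ler_sum => i _; rewrite !mxE.
have := sqr_ge0 (x 0 i + (x 0 i - y 0 i)).
rewrite !expr2; lra.
Qed.

(** The barrier is A + mu (t - s0) plus a multiple of
    exp (L (t - s0)) (|x - x0|^2 + 2 N (t - s0)) / D, whose heat operator is
    L times itself. It exceeds M outside the ball where z is controlled
    initially, and is of order 1 / D at x0. *)
Lemma local_affine_bound z f x0 s0 s1 A mu M L D :
  s0 <= s1 -> 0 < D -> 0 <= L -> A <= M ->
  (forall x t, s0 <= t <= s1 -> exists2 c, heat_at z x t c & c <= f (z x t)) ->
  (forall x t, s0 <= t <= s1 -> z x t <= M) ->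
  (forall t b, s0 <= t <= s1 -> A + mu * (t - s0) <= b <= M ->
     f b <= mu + L * (b - (A + mu * (t - s0)))) ->
  (forall x, sqnorm (x - x0) <= D -> z x s0 <= A) ->
  z x0 s1 <= A + mu * (s1 - s0)
    + (M - A) * expR (L * (s1 - s0)) * (2 * N%:R * (s1 - s0)) / D.
Proof.
move=> s01 D0 L0 AM hz hM hf hinit.
pose m := (M - A) / D.
have m0 : 0 <= m by rewrite divr_ge0 ?subr_ge0// ltW.
pose al t := m * expR (L * (t - s0)).
have al0 t : 0 <= al t by rewrite mulr_ge0// expR_ge0.
have al_d t : is_derive t 1 al (L * al t).
  have h := is_derive_affine t L (- (L * s0)).
  have h2 := is_derive_comp (g := fun s => L * s - L * s0)
    (is_derive_expR (L * t - L * s0)) h.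
  apply: is_derive_ext (is_derive_funM (is_derive_cst m t (1 : R)) h2) _ _ => [r|].
    by rewrite /al mulrBr.
  by rewrite /al mulrBr /=; ring.
pose phi t := mu * t + (A - mu * s0).
have phiE t : phi t = A + mu * (t - s0) by rewrite /phi; ring.
pose q x t := al t * (sqnorm (x - x0) + (2 * N%:R * t + - (2 * N%:R * s0))).
have NN : 0 <= N%:R :> R by [].
have q0 x t : s0 <= t -> 0 <= q x t.
  move=> st; rewrite mulr_ge0// addr_ge0 ?sqnorm_ge0//.
  by rewrite -mulrBr mulr_ge0//; lra.
pose d x t := z x t - (phi t + q x t).
have hd x t : s0 <= t <= s1 -> exists2 c, heat_at d x t c &
    (s0 < t -> 0 <= d x t -> c <= L * d x t).
  move=> tI; have [c hc cf] := hz x t tI.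
  have hq := heat_at_timeM (heat_at_funD (heat_at_sqdist x x0 t)
    (heat_at_time x (is_derive_affine t (2 * N%:R) (- (2 * N%:R * s0))))) (al_d t).
  have hp := heat_at_time x (is_derive_affine t mu (A - mu * s0)).
  exists (c - (mu + L * q x t)).
    apply: heat_at_funB => //; apply: heat_at_funD => //.
    by move: hq; rewrite addNr mulr0 addr0 -(mulrA L).
  move=> _ d0; have qge : 0 <= q x t by apply: q0; lra.
  have zI : A + mu * (t - s0) <= z x t <= M.
    by rewrite hM// -phiE andbT; move: d0; rewrite /d; lra.
  have := hf t (z x t) tI zI; rewrite -phiE => h1.
  by rewrite /d; lra.
have hdM x t : s0 <= t <= s1 -> d x t <= M + `|A| + `|mu| * (s1 - s0).
  move=> tI; have h1 := hM x t tI; have h2 : 0 <= q x t by apply: q0; lra.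
  have h3 : - `|A| <= A by rewrite lerNl -normrN ler_norm.
  have h4 : - (`|mu| * (s1 - s0)) <= mu * (t - s0).
    rewrite lerNl -mulNr; apply: le_trans (ler_norm _) _.
    by rewrite normrM normrN ler_wpM2l// ger0_norm; lra.
  by rewrite /d phiE; lra.
have hd0 x : d x s0 <= 0.
  rewrite /d phiE subrr mulr0 addr0 /q /al !subrr addr0 mulr0 expR0 mulr1.
  have [le|lt] := leP (sqnorm (x - x0)) D.
    by have := hinit x le; have := mulr_ge0 m0 (sqnorm_ge0 (x - x0)); lra.
  have s0I : s0 <= s0 <= s1 by rewrite lexx.
  have h1 : M - A <= m * sqnorm (x - x0).
    apply: (@le_trans _ _ (m * D)); first by rewrite /m divfK// gt_eqF.
    by apply: ler_wpM2l => //; exact: ltW.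
  by have := hM x s0 s0I; lra.
have s1I : s0 <= s1 <= s1 by rewrite lexx s01.
have := comparison L0 hd hdM hd0 x0 s1I.
rewrite /d phiE /q subrr (_ : sqnorm 0 = 0); last first.
  by rewrite /sqnorm big1// => i _; rewrite mxE expr0n.
rewrite add0r -mulrBr subr_le0 => h; apply: le_trans h _.
rewrite lerD2l /al /m.
rewrite (_ : _ / D * _ * _ =
  (M - A) * expR (L * (s1 - s0)) * (2 * N%:R * (s1 - s0)) / D) //; ring.
Qed.

Lemma affine_error_small A M L T eps : 0 < eps -> A <= M -> 0 <= T ->
  exists2 D, 0 < D &
    (M - A) * expR (L * T) * (2 * N%:R * T) / D <= eps.
Proof.
move=> e0 AM T0; set C := (M - A) * expR (L * T) * (2 * N%:R * T).
have C0 : 0 <= C.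
  by rewrite !mulr_ge0 ?subr_ge0// expR_ge0.
exists (C / eps + 1); first by have := divr_ge0 C0 (ltW e0); lra.
rewrite ler_pdivrMr; last by have := divr_ge0 C0 (ltW e0); lra.
rewrite mulrDr mulr1 mulrCA divff ?gt_eqF// mulr1; lra.
Qed.

Lemma affine_bound z f s0 s1 A mu M L :
  s0 <= s1 -> 0 <= L -> A <= M ->
  (forall x t, s0 <= t <= s1 -> exists2 c, heat_at z x t c & c <= f (z x t)) ->
  (forall x t, s0 <= t <= s1 -> z x t <= M) ->
  (forall t b, s0 <= t <= s1 -> A + mu * (t - s0) <= b <= M ->
     f b <= mu + L * (b - (A + mu * (t - s0)))) ->
  (forall x, z x s0 <= A) ->
  forall x, z x s1 <= A + mu * (s1 - s0).
Proof.
move=> s01 L0 AM hz hM hf hinit x; apply/ler_addgt0Pr => eps e0.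
have T0 : 0 <= s1 - s0 by rewrite subr_ge0.
have [D D0 hD] := affine_error_small L e0 AM T0.
have := @local_affine_bound z f x s0 s1 A mu M L D s01 D0 L0 AM hz hM hf
  (fun y _ => hinit y).
by move/le_trans; apply; rewrite lerD2l.
Qed.

Definition far_le z s A := exists S : R, forall x, S <= sqnorm x -> z x s <= A.

Lemma far_affine_bound z f s0 s1 A mu M L eps :
  s0 <= s1 -> 0 <= L -> A <= M -> 0 < eps ->
  (forall x t, s0 <= t <= s1 -> exists2 c, heat_at z x t c & c <= f (z x t)) ->
  (forall x t, s0 <= t <= s1 -> z x t <= M) ->
  (forall t b, s0 <= t <= s1 -> A + mu * (t - s0) <= b <= M ->
     f b <= mu + L * (b - (A + mu * (t - s0)))) ->
  far_le z s0 A -> far_le z s1 (A + mu * (s1 - s0) + eps).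
Proof.
move=> s01 L0 AM e0 hz hM hf [S hS].
have T0 : 0 <= s1 - s0 by rewrite subr_ge0.
have [D D0 hD] := affine_error_small L e0 AM T0.
exists (2 * S + 2 * D) => x0 hx0.
have := @local_affine_bound z f x0 s0 s1 A mu M L D s01 D0 L0 AM hz hM hf.
move=> /(_ _)/le_trans; apply; last by rewrite lerD2l.
by move=> x hx; apply: hS; have := sqnormB_ge x x0; lra.
Qed.

Variables (f : R -> R) (z : 'rV[R]_N -> R -> R).
Hypothesis f_derivable : forall s : R, derivable f s 1.
Hypothesis f_C1 : continuous f^`().
Hypothesis z_heat : forall x t, 0 < t -> heat_at z x t (f (z x t)).
Hypothesis z_bounded : forall tau : R, 0 < tau ->
  exists M, forall x t, 0 < t <= tau -> `|z x t| <= M.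

Let z_sub s0 s1 x t : 0 < s0 -> s0 <= t <= s1 ->
  exists2 c, heat_at z x t c & c <= f (z x t).
Proof. by move=> s0p tI; exists (f (z x t)) => //; apply: z_heat; lra. Qed.

(** A slope mu >= f along the segment is the hypothesis of the affine bounds,
    by the Lipschitz continuity of f. *)
Let slope_ok s0 s1 A mu M K L t b :
  (forall a b, - K <= a <= K -> - K <= b <= K -> `|f a - f b| <= L * `|a - b|) ->
  M <= K -> - K <= A + mu * (t - s0) -> f (A + mu * (t - s0)) <= mu ->
  s0 <= t <= s1 -> A + mu * (t - s0) <= b <= M ->
  f b <= mu + L * (b - (A + mu * (t - s0))).
Proof.
move=> lip MK Kphi fphi tI /andP[h1 h2].
set phi := A + _ in Kphi fphi h1 *.
have := lip b phi ltac:(lra) ltac:(lra).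
rewrite [`|b - _|]ger0_norm ?subr_ge0// ler_norml => /andP[_ h3]; lra.
Qed.

(** A bound M2 that is constant in x is lowered at speed m, the minimum of |f| on
    [P + eps, M2], until it reaches P + eps, where it stays. *)
Lemma eventually_le_above P eps : 0 < eps -> (forall a, P < a -> f a < 0) ->
  exists2 T, 0 < T & forall x t, T <= t -> z x t <= P + eps.
Proof.
move=> e0 fneg.
have [M1 hM1] := z_bounded ltr01.
pose M2 := Num.max M1 (P + eps).
have M21 : M1 <= M2 by rewrite le_max lexx.
have M2P : P + eps <= M2 by rewrite le_max lexx orbT.
have z1 x : z x 1 <= M2.
  by apply: le_trans M21; apply: le_trans (ler_norm _) _; apply: hM1; rewrite ltr01 lexx.
have [m m0 hm] := neg_on_segment (derivable_continuous f_derivable) M2P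
  (fun s (h : P + eps <= s <= M2) => fneg s ltac:(lra)).
pose T := 1 + (M2 - (P + eps)) / m.
have T1 : 1 <= T by rewrite /T lerDl divr_ge0// ?subr_ge0// ltW.
have mT : m * (T - 1) = M2 - (P + eps).
  by rewrite /T addrAC subrr add0r mulrCA divff ?mulr1// gt_eqF.
have zT x : z x T <= P + eps.
  have Tp : 0 < T by lra.
  have [M3 hM3] := z_bounded Tp.
  pose M := Num.max M2 M3.
  have MM2 : M2 <= M by rewrite le_max lexx.
  have MM3 : M3 <= M by rewrite le_max lexx orbT.
  pose K := `|M| + `|P + eps|.
  have h1 := ler_norm M; have h2 := ler_norm (- (P + eps)).
  have h3 := normr_ge0 M; have h4 := normr_ge0 (P + eps).
  rewrite normrN in h2.
  have [|L L0 lip] := @C1_bounded_lipschitz _ f K f_derivable f_C1; first by rewrite /K; lra.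
  have := @affine_bound z f 1 T M2 (- m) M L T1 L0 MM2.
  rewrite mulNr mT (_ : M2 - (M2 - (P + eps)) = P + eps); last by ring.
  apply=> //.
  - by move=> y t; exact: z_sub.
  - move=> y t tI; apply: le_trans MM3; apply: le_trans (ler_norm _) _.
    by apply: hM3; lra.
  move=> t b tI bI.
  have h5 : m * (t - 1) <= m * (T - 1) by rewrite ler_pM2l//; lra.
  have h6 : 0 <= m * (t - 1) by rewrite mulr_ge0//; lra.
  have phiI : P + eps <= M2 + - m * (t - 1) <= M2 by rewrite mulNr; lra.
  apply: (slope_ok lip _ _ _ tI bI).
  - by rewrite /K; lra.
  - by rewrite /K; lra.
  - exact: hm.
exists T; first by lra.
move=> x t Tt.
have tp : 0 < t by lra.
have [M3 hM3] := z_bounded tp.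
pose M := Num.max (P + eps) M3.
have MM2 : P + eps <= M by rewrite le_max lexx.
have MM3 : M3 <= M by rewrite le_max lexx orbT.
have := @affine_bound z f T t (P + eps) 0 M 0 Tt (lexx 0) MM2.
rewrite mul0r addr0; apply => //.
- by move=> y s; apply: z_sub; lra.
- move=> y s sI; apply: le_trans MM3; apply: le_trans (ler_norm _) _.
  by apply: hM3; lra.
- by move=> s b sI; rewrite !mul0r !addr0 => bI; apply/ltW/fneg; lra.
Qed.

(** Far away z obeys the ordinary differential equation, and f < 0 on (0, b)
    drives every value below b to 0. *)
Lemma far_le_decay b t1 A sig : 0 < t1 -> 0 < A < b ->
  (forall a, 0 < a < b -> f a < 0) -> far_le z t1 A -> 0 < sig ->
  exists2 T, t1 <= T & forall t, T <= t -> far_le z t sig.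
Proof.
move=> t10 Ab fneg farA sig0.
pose s1 := Num.min (sig / 2) (A / 2).
have s1p : 0 < s1 by rewrite lt_min; apply/andP; split; lra.
have s1s : s1 <= sig / 2 by rewrite ge_min lexx.
have s1A : s1 <= A / 2 by rewrite ge_min lexx orbT.
pose a1 := s1 / 2.
have a1A : a1 <= A by rewrite /a1; lra.
have [m m0 hm] := neg_on_segment (derivable_continuous f_derivable) a1A
  (fun s (h : a1 <= s <= A) => fneg s ltac:(rewrite /a1 in h; lra)).
pose T := t1 + (A - a1) / m.
have T1 : t1 <= T by rewrite /T lerDl divr_ge0// ?subr_ge0// ltW.
have mT : m * (T - t1) = A - a1.
  by rewrite /T addrAC subrr add0r mulrCA divff ?mulr1// gt_eqF.
have farT : far_le z T s1.
  have Tp : 0 < T by lra.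
  have [M3 hM3] := z_bounded Tp.
  pose M := Num.max A M3.
  have MM2 : A <= M by rewrite le_max lexx.
  have MM3 : M3 <= M by rewrite le_max lexx orbT.
  have [|L L0 lip] := @C1_bounded_lipschitz _ f M f_derivable f_C1; first by lra.
  have := @far_affine_bound z f t1 T A (- m) M L a1 T1 L0 MM2 _.
  rewrite mulNr mT (_ : A - (A - a1) + a1 = s1); last by rewrite /a1; field.
  apply => //.
  - by rewrite /a1; lra.
  - by move=> y t; exact: z_sub.
  - move=> y t tI; apply: le_trans MM3; apply: le_trans (ler_norm _) _.
    by apply: hM3; lra.
  move=> t c tI cI.
  have h5 : m * (t - t1) <= m * (T - t1) by rewrite ler_pM2l//; lra.
  have h6 : 0 <= m * (t - t1) by rewrite mulr_ge0//; lra.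
  have phiI : a1 <= A + - m * (t - t1) <= A by rewrite mulNr; lra.
  apply: (slope_ok lip _ _ _ tI cI) => //; last exact: hm.
  by rewrite /a1 in phiI; lra.
exists T => // t Tt.
have tp : 0 < t by lra.
have [M3 hM3] := z_bounded tp.
pose M := Num.max s1 M3.
have MM2 : s1 <= M by rewrite le_max lexx.
have MM3 : M3 <= M by rewrite le_max lexx orbT.
have [|L L0 lip] := @C1_bounded_lipschitz _ f M f_derivable f_C1; first by lra.
have s2 : 0 < sig / 2 by lra.
have [|||S hS] := @far_affine_bound z f T t s1 0 M L (sig / 2) Tt L0 MM2 s2 _ _ _ farT.
- by move=> y s; apply: z_sub; lra.
- move=> y s sI; apply: le_trans MM3; apply: le_trans (ler_norm _) _.
  by apply: hM3; lra.
- move=> s c sI cI; apply: (slope_ok lip _ _ _ sI cI) => //.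
    by rewrite mul0r addr0; lra.
  by rewrite mul0r addr0 ltW// fneg//; lra.
by exists S => x /hS; rewrite mul0r addr0; lra.
Qed.

End affine_supersolutions.

(** * Motion of the terrace *)

Section eventually.
Context {R : realType}.

Lemma near_pinfty_ge (P : R -> Prop) : (\forall t \near +oo, P t) ->
  exists2 T, 0 < T & forall t, T <= t -> P t.
Proof.
move=> [M [_ hM]]; exists (`|M| + 1) => [|t tM]; first by rewrite ltr_wpDl.
by apply: hM; apply: lt_le_trans tM; rewrite ltr_pwDr// ler_norm.
Qed.

Lemma finitely_many_large (n : nat) (P : nat -> R -> Prop) :
  (forall k, (1 <= k <= n)%N -> exists T, forall t, T <= t -> P k t) ->
  exists2 T, 0 < T & forall k, (1 <= k <= n)%N -> forall t, T <= t -> P k t.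
Proof.
elim: n => [|n IH] hP; first by exists 1 => // -[].
have [k /andP[k1 kn]|T T0 hT] := IH; first by apply: hP; rewrite k1 ltnW.
have [T' hT'] := hP n.+1 (leqnn _).
exists (Num.max T T') => [|k /andP[k1]]; first by rewrite lt_max T0.
rewrite leq_eqVlt => /predU1P[->|kn] t; rewrite ge_max => /andP[h1 h2].
  exact: hT'.
by apply: hT => //; rewrite k1.
Qed.

Lemma finitely_many_small (n : nat) (P : nat -> R -> Prop) :
  (forall k, (1 <= k <= n)%N -> exists2 m, 0 < m & forall t, 0 < t <= m -> P k t) ->
  exists2 m, 0 < m & forall k, (1 <= k <= n)%N -> forall t, 0 < t <= m -> P k t.
Proof.
elim: n => [|n IH] hP; first by exists 1 => // -[].
have [k /andP[k1 kn]|T T0 hT] := IH; first by apply: hP; rewrite k1 ltnW.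
have [T' T0' hT'] := hP n.+1 (leqnn _).
exists (Num.min T T') => [|k /andP[k1]]; first by rewrite lt_min T0.
rewrite leq_eqVlt => /predU1P[->|kn] t; rewrite le_min => /and3P[h0 h1 h2].
  by apply: hT'; rewrite h0.
by apply: hT; rewrite ?k1 ?h0.
Qed.

End eventually.

Section terrace.
Context {R : realType}.
Variables (f : R -> R) (p : R) (n0 : nat) (Q : nat -> R) (U : nat -> R -> R).
Variables (c : nat -> R).
Hypothesis Hter : propagating_terrace f p n0 Q U c.
Implicit Types (k : nat) (r s t xi e tau : R).

Let U_derive k s : (1 <= k <= n0)%N -> is_derive s 1 (U k) ((U k)^`() s).
Proof.
move=> kI; have [h _] := terrace_derivable Hter kI s.
by rewrite derive1E; exact: derivableP.
Qed.

Let U_decr k s t : (1 <= k <= n0)%N -> s <= t -> U k t <= U k s.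
Proof.
move=> kI st.
have [x xI e] := MVT_is_derive st (fun r _ => U_derive r kI).
have := terrace_wave_decr Hter kI x => /ltW hx.
by rewrite -subr_le0 e mulr_le0_ge0 ?subr_ge0.
Qed.

Let U_right k e : (1 <= k <= n0)%N -> 0 < e ->
  exists A, forall xi, A <= xi -> `|U k xi - Q k| <= e.
Proof.
move=> kI e0; have /cvgrPdist_le /(_ _ e0) := terrace_wave_right Hter kI.
by move=> /near_pinfty_ge[A _ hA]; exists A => xi /hA; rewrite distrC.
Qed.

Let U_left k e : (1 <= k <= n0)%N -> 0 < e ->
  exists A, forall xi, xi <= - A -> `|U k xi - Q k.-1| <= e.
Proof.
move=> kI e0; have /cvgrPdist_le /(_ _ e0) := terrace_wave_left Hter kI.
move=> [M [_ hM]]; exists (`|M| + 1) => xi hxi; rewrite distrC; apply: hM.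
apply: le_lt_trans hxi _.
have := ler_norm (- M); rewrite normrN; lra.
Qed.

(** The profiles decrease strictly, hence at a definite rate on compact sets;
    kap ranges below the optimal constant so that one value serves all k. *)
Let U_drop k A : (1 <= k <= n0)%N -> 0 < A -> exists2 m, 0 < m &
  forall kap, 0 < kap <= m -> forall xi tau, - A <= xi <= A -> 0 <= tau <= 1 ->
    kap * tau <= U k (xi - c k / 2 * tau) - U k xi.
Proof.
move=> kI A0.
have c0 : 0 < c k / 2 by rewrite divr_gt0// (terrace_speed_gt0 Hter kI).
have cU : continuous (U k)^`().
  move=> s; have [_ h] := terrace_derivable Hter kI s.
  exact: is_derive_continuous (derivableP h).
have AA : - A - c k / 2 <= A by lra.
have [m m0 hm] := neg_on_segment cU AA (fun s _ => terrace_wave_decr Hter kI s).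
exists (m * (c k / 2)); first exact: mulr_gt0.
move=> kap /andP[_ kapm] xi tau xiI /andP[tau0 tau1].
have ct0 : 0 <= c k / 2 * tau by rewrite mulr_ge0// ltW.
have ct1 : c k / 2 * tau <= c k / 2 by rewrite ler_piMr// ltW.
have le1 : xi - c k / 2 * tau <= xi by lra.
have [x xI e] := MVT_is_derive le1 (fun s _ => U_derive s kI).
have := hm x ltac:(apply/andP; split; lra).
have -> : U k (xi - c k / 2 * tau) - U k xi = - derive1 (U k) x * (c k / 2 * tau).
  by rewrite -opprB e; ring.
move=> h1; apply: (@le_trans _ _ (m * (c k / 2) * tau)); first exact: ler_wpM2r.
by rewrite -mulrA ler_wpM2r//; lra.
Qed.

Variable eta : nat -> R -> R.
Hypothesis eta_derivable : forall k, (1 <= k <= n0)%N -> forall t : R, 0 < t ->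
  derivable (eta k) t 1 /\ {for t, continuous (eta k)^`()}.
Hypothesis eta_sublinear : forall k, (1 <= k <= n0)%N ->
  (eta k)^`() t @[t --> +oo] --> 0.
Hypothesis eta_separate : forall k, (1 <= k < n0)%N -> c k = c k.+1 ->
  eta k.+1 t - eta k t @[t --> +oo] --> +oo.

Definition front_position k t := c k * t + eta k t.

Let eta_derive k t : (1 <= k <= n0)%N -> 0 < t ->
  is_derive t 1 (eta k) ((eta k)^`() t).
Proof.
move=> kI t0; have [h _] := eta_derivable kI t0.
by rewrite derive1E; exact: derivableP.
Qed.

Let eta_small k e : (1 <= k <= n0)%N -> 0 < e -> exists2 T, 0 < T &
  forall s t, T <= s <= t -> `|eta k t - eta k s| <= e * (t - s).
Proof.
move=> kI e0; have /cvgrPdist_le /(_ _ e0) := eta_sublinear kI.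
move=> /near_pinfty_ge[T T0 hT]; exists T => // s t /andP[Ts st].
have := @derive_bound_lipschitz _ (eta k) (eta k)^`() s t e.
rewrite (ger0_norm (_ : 0 <= t - s)) ?subr_ge0//; apply => r rI.
have Tr : T <= r by case/orP: rI => /andP[]; lra.
split; first by apply: eta_derive => //; lra.
by have := hT r Tr; rewrite sub0r normrN.
Qed.

Lemma front_advance k : (1 <= k <= n0)%N -> exists2 T, 0 < T &
  forall t tau, T <= t -> 0 <= tau ->
    c k / 2 * tau <= front_position k (t + tau) - front_position k t.
Proof.
move=> kI; have c0 : 0 < c k / 2 by rewrite divr_gt0// (terrace_speed_gt0 Hter kI).
have [T T0 hT] := eta_small kI c0; exists T => // t tau Tt tau0.
have := hT t (t + tau) ltac:(apply/andP; split; lra).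
rewrite /front_position ler_norml [t + tau - t]addrC addKr => /andP[h1 h2]; lra.
Qed.

Lemma front_to_infinity k A : (1 <= k <= n0)%N -> exists2 T, 0 < T &
  forall t, T <= t -> A <= front_position k t.
Proof.
move=> kI; have [T T0 hT] := front_advance kI.
have c0 : 0 < c k / 2 by rewrite divr_gt0// (terrace_speed_gt0 Hter kI).
pose B := `|A - front_position k T| / (c k / 2).
have B0 : 0 <= B by rewrite divr_ge0// ltW.
exists (T + B) => [|t Tt]; first by lra.
have := hT T (t - T) (lexx T) ltac:(lra).
rewrite [T + _]addrC subrK.
have : c k / 2 * B <= c k / 2 * (t - T) by rewrite ler_pM2l//; lra.
rewrite {1}/B mulrCA divff ?gt_eqF// mulr1.
have := ler_norm (A - front_position k T); lra.
Qed.

(** Consecutive fronts drift apart: either their speeds differ, which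
    eta' -> 0 cannot compensate, or their distance tends to infinity by
    assumption. *)
Lemma front_ordered k : (1 <= k < n0)%N -> exists2 T, 0 < T &
  forall t, T <= t -> front_position k t <= front_position k.+1 t.
Proof.
move=> kI; have /andP[k1 kn] := kI.
have kI0 : (1 <= k <= n0)%N by rewrite k1 ltnW.
have kI1 : (1 <= k.+1 <= n0)%N by [].
have := terrace_speed_le Hter kI; rewrite le_eqVlt => /predU1P[ce|clt].
  have /cvgryPge /(_ 0) /near_pinfty_ge[T T0 hT] := eta_separate kI ce.
  exists T => // t /hT; rewrite /front_position ce; lra.
pose del := (c k.+1 - c k) / 4.
have del0 : 0 < del by rewrite /del; lra.
have [T1 T10 h1] := eta_small kI0 del0.
have [T2 T20 h2] := eta_small kI1 del0.
pose T := Num.max T1 T2.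
have m1 : T1 <= T by rewrite le_max lexx.
have m2 : T2 <= T by rewrite le_max lexx orbT.
pose gap t := front_position k.+1 t - front_position k t.
pose B := `|gap T| / del.
have B0 : 0 <= B by rewrite divr_ge0// ltW.
exists (T + B) => [|t Tt]; first by lra.
have h3 := h1 T t ltac:(apply/andP; split; lra).
have h4 := h2 T t ltac:(apply/andP; split; lra).
have : del * B <= del * (t - T) by rewrite ler_pM2l//; lra.
rewrite {1}/B mulrCA divff ?gt_eqF// mulr1.
have := ler_norm (- gap T); rewrite normrN.
move: h3 h4; rewrite !ler_norml /gap /front_position => /andP[h3 h4] /andP[h5 h6].
have : c k.+1 - c k = 4 * del by rewrite /del; field.
move=> hc h7 h8.
have : (c k.+1 - c k) * (t - T) = 4 * del * (t - T) by rewrite hc.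
have : 0 <= del * (t - T) by rewrite mulr_ge0//; lra.
lra.
Qed.

Definition terrace_sum r t := \sum_(1 <= k < n0.+1) (U k (r - c k * t - eta k t) - Q k).

Let terrace_sumE r t :
  terrace_sum r t = \sum_(1 <= k < n0.+1) (U k (r - front_position k t) - Q k).
Proof. by apply: eq_bigr => k _; rewrite /front_position opprD addrA. Qed.

(** Induction on the number of waves. The arguments xi k decrease in k, so when
    no wave is in transition the first j of them have passed and the others
    have not; the sum then telescopes to Q j. *)
Let platform_or_front A e (xi : nat -> R) n : 0 <= e -> 0 < A -> (n <= n0)%N ->
  (forall k, (1 <= k < n0)%N -> xi k.+1 <= xi k) ->
  (forall k, (1 <= k <= n0)%N -> forall s, A <= s -> `|U k s - Q k| <= e) ->
  (forall k, (1 <= k <= n0)%N -> forall s, s <= - A -> `|U k s - Q k.-1| <= e) ->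
  (exists2 k, (1 <= k <= n0)%N & - A <= xi k <= A) \/
  exists j, [/\ (j <= n)%N, ((j < n)%N -> xi n < - A) &
    `|\sum_(1 <= k < n.+1) (U k (xi k) - Q k) - (Q j - Q n)| <= n%:R * e].
Proof.
move=> e0 A0 + xi_decr Ur Ul.
elim: n => [_|n IH nn].
  right; exists 0%N; split => //.
  by rewrite big_geq// subrr subrr normr0 mul0r.
have [|[j [jn xin hj]]] := IH (ltnW nn); first by left.
have kI : (1 <= n.+1 <= n0)%N by [].
have [h1|h1] := leP (- A) (xi n.+1); last first.
  right; exists j; split => [||]; [exact: leqW|by []|].
  rewrite big_nat_recr //= mulrSr mulrDl mul1r.
  have := Ul _ kI _ (ltW h1); rewrite /= => h2.
  rewrite (_ : _ - (Q j - Q n.+1) = (\sum_(1 <= k < n.+1) (U k (xi k) - Q k)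
     - (Q j - Q n)) + (U n.+1 (xi n.+1) - Q n)); last by ring.
  exact: le_trans (ler_normD _ _) (lerD hj h2).
have [h2|h2] := leP (xi n.+1) A; first by left; exists n.+1; rewrite ?h1.
right; exists n.+1; split => [//||]; first by rewrite ltnn.
have jE : j = n.
  apply/eqP; rewrite eqn_leq jn /= leqNgt; apply/negP => jn'.
  have n1 : (1 <= n)%N by exact: leq_trans jn'.
  have nI : (1 <= n < n0)%N by rewrite n1.
  by have := xin jn'; have := xi_decr n nI; lra.
rewrite big_nat_recr //= mulrSr mulrDl mul1r subrr subr0.
have h3 := Ur _ kI _ (ltW h2).
apply: le_trans (ler_normD _ _) (lerD _ h3).
by move: hj; rewrite jE subrr subr0.
Qed.

Variable V : R -> R -> R.
Hypothesis V_terrace : forall e, 0 < e -> \forall t \near +oo,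
  forall r : R, 0 <= r -> `|V r t - terrace_sum r t| < e.

Let V_close e : 0 < e -> exists2 T, 0 < T & forall t, T <= t ->
  forall r, 0 <= r -> `|V r t - terrace_sum r t| <= e.
Proof.
move=> e0; have [T T0 hT] := near_pinfty_ge (V_terrace e0).
by exists T => // t Tt r r0; apply/ltW/hT.
Qed.

Let ler_big_nat (F G : nat -> R) : (forall k, (1 <= k <= n0)%N -> F k <= G k) ->
  \sum_(1 <= k < n0.+1) F k <= \sum_(1 <= k < n0.+1) G k.
Proof. by move=> h; rewrite !big_nat; apply: ler_sum => k /h. Qed.

(** Off the platforms some wave is in transition, and its translation by the
    front during the time tau raises the sum by a multiple of tau; the other
    waves do not decrease. The multiple does not depend on tau, only the time
    from which V is close enough to the sum does. *)
Lemma platform_or_increase eps : 0 < eps -> exists2 kap, 0 < kap &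
  forall tau, 0 < tau <= 1 -> exists2 T, 0 < T & forall t r, T <= t -> 0 <= r ->
    (exists2 k, (k <= n0)%N & `|V r t - Q k| <= eps) \/
    kap * tau <= V r (t + tau) - V r t.
Proof.
move=> eps0.
pose e := eps / (2 * (n0%:R + 1)).
have n00 : 0 <= n0%:R :> R by [].
have e0 : 0 < e by rewrite divr_gt0// mulr_gt0//; lra.
have n0e : n0%:R * e <= eps / 2.
  have -> : eps / 2 = (n0%:R + 1) * e by rewrite /e; field; rewrite gt_eqF//; lra.
  by rewrite ler_pM2r//; lra.
have [A1 A10 hA1] : exists2 A, 0 < A & forall k, (1 <= k <= n0)%N ->
    forall a, A <= a -> forall s, a <= s -> `|U k s - Q k| <= e.
  apply: finitely_many_large => k kI; have [A hA] := U_right kI e0.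
  by exists A => a Aa s as'; apply: hA; lra.
have [A2 A20 hA2] : exists2 A, 0 < A & forall k, (1 <= k <= n0)%N ->
    forall a, A <= a -> forall s, s <= - a -> `|U k s - Q k.-1| <= e.
  apply: finitely_many_large => k kI; have [A hA] := U_left kI e0.
  by exists A => a Aa s as'; apply: hA; lra.
pose A := Num.max A1 A2.
have A1A : A1 <= A by rewrite le_max lexx.
have A2A : A2 <= A by rewrite le_max lexx orbT.
have A0 : 0 < A by lra.
have [m m0 hm] := @finitely_many_small R n0 _ (fun k kI => U_drop kI A0).
exists (m / 2); first by lra.
move=> tau /andP[tau0 tau1].
have [T1 T10 hT1] : exists2 T, 0 < T & forall k, (1 <= k <= n0)%N ->
    forall t, T <= t -> forall tau, 0 <= tau ->
    c k / 2 * tau <= front_position k (t + tau) - front_position k t.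
  apply: finitely_many_large => k kI; have [T _ hT] := front_advance kI.
  by exists T => t Tt s; exact: hT.
have [T2 T20 hT2] : exists2 T, 0 < T & forall t, T <= t ->
    forall k, (1 <= k < n0)%N -> front_position k t <= front_position k.+1 t.
  have [k kI|T T0 hT] := @finitely_many_large R n0
      (fun k t => (k < n0)%N -> front_position k t <= front_position k.+1 t).
    have [kn|kn] := ltnP k n0; last by exists 0.
    have kI' : (1 <= k < n0)%N by case/andP: kI => ->.
    by have [T _ hT] := front_ordered kI'; exists T => t /hT.
  exists T => // t Tt k /andP[k1 kn]; apply: hT => //.
  by rewrite k1 ltnW.
have e10 : 0 < Num.min (m * tau / 4) (eps / 2).
  by rewrite lt_min !divr_gt0// mulr_gt0.
have [T3 T30 hT3] := V_close e10.
have E1 : Num.min (m * tau / 4) (eps / 2) <= m * tau / 4 by rewrite ge_min lexx.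
have E2 : Num.min (m * tau / 4) (eps / 2) <= eps / 2 by rewrite ge_min lexx orbT.
exists (T1 + T2 + T3) => [|t r Tt r0]; first by lra.
have V1 := hT3 t ltac:(lra) r r0.
have V2 := hT3 (t + tau) ltac:(lra) r r0.
have [|||[k kI xiI]|[j [jn _ hj]]] := @platform_or_front A e
    (fun k => r - front_position k t) n0 (ltW e0) A0 (leqnn _).
- by move=> k kI; have := hT2 t ltac:(lra) k kI; lra.
- by move=> k kI; apply: (hA1 k kI).
- by move=> k kI; apply: (hA2 k kI).
- right.
  suff : m * tau <= terrace_sum r (t + tau) - terrace_sum r t.
    by move: V1 V2; rewrite !ler_norml => /andP[h1 h2] /andP[h3 h4]; lra.
  rewrite !terrace_sumE -sumrB.
  have kin : k \in index_iota 1 n0.+1 by rewrite mem_index_iota ltnS.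
  rewrite (bigD1_seq k) ?iota_uniq //=.
  have adv i : (1 <= i <= n0)%N ->
      c i / 2 * tau <= front_position i (t + tau) - front_position i t.
    by move=> iI; apply: (hT1 i iI t); lra.
  have rest : 0 <= \sum_(1 <= i < n0.+1 | i != k)
      (U i (r - front_position i (t + tau)) - Q i - (U i (r - front_position i t) - Q i)).
    rewrite big_nat_cond; apply: sumr_ge0 => i /andP[iI _].
    have := adv i iI; have ci := terrace_speed_gt0 Hter iI.
    have : 0 <= c i / 2 * tau by rewrite mulr_ge0// ?divr_ge0// ltW.
    move=> h1 h2; have := @U_decr i (r - front_position i (t + tau))
      (r - front_position i t) iI ltac:(lra).
    by lra.
  have := hm k kI m ltac:(by rewrite m0 lexx) (r - front_position k t) tau xiI
    ltac:(by rewrite ltW).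
  have := @U_decr k (r - front_position k (t + tau))
    (r - front_position k t - c k / 2 * tau) kI ltac:(have := adv k kI; lra).
  by lra.
left; exists j => //.
move: hj V1; rewrite (terrace_last Hter) subr0 -terrace_sumE.
move=> hj V1; rewrite -(subrK (terrace_sum r t) (V r t)) -addrA.
apply: le_trans (ler_normD _ _) _; lra.
Qed.

Lemma terrace_far_small e : 0 < e -> exists2 T, 0 < T & forall t, T <= t ->
  exists r0, forall r, r0 <= r -> 0 <= r -> V r t <= e.
Proof.
move=> e0; have e2 : 0 < e / 2 by lra.
have [T T0 hT] := V_close e2; exists T => // t Tt.
pose d := e / (2 * (n0%:R + 1)).
have n00 : 0 <= n0%:R :> R by [].
have d0 : 0 < d by rewrite divr_gt0// mulr_gt0//; lra.
have n0d : n0%:R * d <= e / 2.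
  have -> : e / 2 = (n0%:R + 1) * d by rewrite /d; field; rewrite gt_eqF//; lra.
  by rewrite ler_pM2r//; lra.
have [A _ hA] : exists2 A, 0 < A & forall k, (1 <= k <= n0)%N ->
    forall r, A <= r -> U k (r - front_position k t) - Q k <= d.
  apply: finitely_many_large => k kI; have [A hA] := U_right kI d0.
  exists (A + front_position k t) => r Ar.
  by apply: le_trans (ler_norm _) _; apply: hA; lra.
exists A => r Ar r0.
have := hT t Tt r r0; rewrite ler_norml => /andP[_ h1].
suff : terrace_sum r t <= e / 2 by lra.
apply: le_trans n0d; rewrite terrace_sumE.
apply: (@le_trans _ _ (\sum_(1 <= k < n0.+1) d)).
  by apply: ler_big_nat => k kI; apply: (hA k kI).
by rewrite sumr_const_nat subn1 /= mulr_natl.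
Qed.

Lemma terrace_fills e r0 : 0 < e -> exists2 T, 0 < T &
  forall t r, T <= t -> 0 <= r <= r0 -> p - e <= V r t.
Proof.
move=> e0; have e2 : 0 < e / 2 by lra.
have [T T0 hT] := V_close e2.
pose d := e / (2 * (n0%:R + 1)).
have n00 : 0 <= n0%:R :> R by [].
have d0 : 0 < d by rewrite divr_gt0// mulr_gt0//; lra.
have n0d : n0%:R * d <= e / 2.
  have -> : e / 2 = (n0%:R + 1) * d by rewrite /d; field; rewrite gt_eqF//; lra.
  by rewrite ler_pM2r//; lra.
have [T' T'0 hT'] : exists2 T, 0 < T & forall k, (1 <= k <= n0)%N -> forall t, T <= t ->
    forall r, r <= r0 -> Q k.-1 - d <= U k (r - front_position k t).
  apply: finitely_many_large => k kI.
  have [A hA] := U_left kI d0.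
  have [S _ hS] := front_to_infinity (r0 + A) kI.
  exists S => t St r rr0; have h1 := hS t St.
  have := hA (r - front_position k t) ltac:(lra).
  by rewrite ler_norml => /andP[h2 _]; lra.
exists (T + T') => [|t r Tt /andP[rp rr0]]; first by lra.
have := hT t ltac:(lra) r rp; rewrite ler_norml => /andP[h1 _].
suff : p - e / 2 <= terrace_sum r t by lra.
rewrite terrace_sumE.
apply: (@le_trans _ _ (\sum_(1 <= k < n0.+1) (Q k.-1 - d - Q k))); last first.
  by apply: ler_big_nat => k kI; have := hT' k kI t ltac:(lra) r rr0; lra.
have -> : \sum_(1 <= k < n0.+1) (Q k.-1 - d - Q k) = (p - 0) - n0%:R * d.
  rewrite -(terrace_first Hter) -[X in Q 0%N - X](terrace_last Hter).
  elim: (n0) => [|n IH]; first by rewrite big_geq// mul0r; ring.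
  by rewrite big_nat_recr //= IH -natr1; ring.
lra.
Qed.

End terrace.

(** * Lebesgue measure of cubes *)

Section lower_integral.
Context d (T : measurableType d) (R : realType) (mu : {measure set T -> \bar R}).
Local Open Scope ereal_scope.

Import HBNNSimple.

(** The integral of a nonnegative function is a supremum over simple functions,
    so this bound holds for every integrand, measurable or not. *)
Lemma integral_ge_indic (B D : set T) (g : T -> \bar R) (del : R) :
  measurable B -> (0 <= del)%R -> (forall x, D x -> 0 <= g x) ->
  (forall x, B x -> D x /\ del%:E <= g x) ->
  del%:E * mu B <= \int[mu]_(x in D) g x.
Proof.
move=> mB d0 g0 hB; rewrite ge0_integralE//.
apply: ereal_sup_ubound; exists (scale_nnsfun (indic_nnsfun R mB) d0).
  move=> x /=; rewrite /patch.
  rewrite mindicE.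
  have [xB|xB] := boolP (x \in B).
    by have [Dx gx] := hB x (set_mem xB); rewrite mem_set// mulr1.
  rewrite mulr0; case: ifPn => // /set_mem; exact: g0.
by rewrite sintegralrM /= sintegral_indic.
Qed.

End lower_integral.

Section boxes.
Context {R : realType} {N : nat}.
Implicit Types (x a : 'rV[R]_N) (ab : 'rV[R]_N * 'rV[R]_N) (h : R).

Lemma box_vol_ge0 ab : 0 <= box_vol ab.
Proof. by apply: prodr_ge0 => i _; rewrite le_max lexx. Qed.

Definition set_coord x (i : 'I_N) (y : R) : 'rV[R]_N :=
  \row_j if j == i then y else x 0 j.

Definition half_space (i : 'I_N) (s : R) : set 'rV[R]_N := [set x | x 0 i <= s].

(** Every covering box is cut by the hyperplane into two boxes with the same
    total volume. *)
Lemma half_space_measurable (i : 'I_N) (s : R) :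
  measurable (half_space i s : set (leb_rV R N)).
Proof.
apply: le_caratheodory_measurable => X.
apply: le_ereal_inf_tmp => _ [D [ab [Xab ->]]].
pose lo k := ((ab k).1, set_coord (ab k).2 i (Num.min ((ab k).2 0 i) s)).
pose hi k := (set_coord (ab k).1 i (Num.max ((ab k).1 0 i) s), (ab k).2).
have vol k : box_vol (lo k) + box_vol (hi k) <= box_vol (ab k).
  rewrite /box_vol (bigD1 i) //= [X in _ + X](bigD1 i) //= [X in _ <= X](bigD1 i) //=.
  under eq_bigr => j ji do rewrite mxE (negbTE ji).
  under [X in _ + _ * X]eq_bigr => j ji do rewrite mxE (negbTE ji).
  rewrite -mulrDl ler_wpM2r//; first by apply: prodr_ge0 => j _; rewrite le_max lexx.
  rewrite !mxE eqxx /Num.min /Num.max.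
  by repeat case: ifPn; rewrite -?leNgt; lra.
have lo_cover : (lebesgue_outer (X `&` half_space i s)
    <= \esum_(k in D) (box_vol (lo k))%:E)%E.
  apply: ereal_inf_lbound; exists D, lo; split => // x [Xx /= xs].
  have [k Dk kx] := Xab x Xx; exists k => // j; have /andP[h1 h2] := kx j.
  rewrite /= h1 mxE; case: eqVneq => [ji|//].
  by rewrite ji le_min xs andbT -ji h2.
have hi_cover : (lebesgue_outer (X `&` ~` half_space i s)
    <= \esum_(k in D) (box_vol (hi k))%:E)%E.
  apply: ereal_inf_lbound; exists D, hi; split => // x [Xx /= /negP].
  rewrite -ltNge => xs.
  have [k Dk kx] := Xab x Xx; exists k => // j; have /andP[h1 h2] := kx j.
  rewrite /= h2 andbT mxE; case: eqVneq => [ji|//].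
  by rewrite ji gt_max xs -ji h1.
apply: le_trans (leeD lo_cover hi_cover) _.
rewrite -esumD; last 2 first.
- by move=> k _; rewrite lee_fin box_vol_ge0.
- by move=> k _; rewrite lee_fin box_vol_ge0.
by apply: le_esum => k _; rewrite -EFinD lee_fin.
Qed.

Lemma box_measurable ab : measurable (box ab : set (leb_rV R N)).
Proof.
rewrite (_ : box ab = \bigcap_(i in [set: 'I_N])
  (half_space i (ab.2 0 i) `\` half_space i (ab.1 0 i))).
  apply: fin_bigcap_measurable => [|i _]; first exact: finite_finset.
  by apply: measurableD; exact: half_space_measurable.
apply/seteqP; split => [x hx i _|x hx i].
  by have /andP[h1 h2] := hx i; split => //=; apply/negP; rewrite -ltNge.
by have [/= h1 /negP] := hx i I; rewrite -ltNge => h2; rewrite h2.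
Qed.

Definition cube_at a h : set 'rV[R]_N := box (a, a + const_mx h).

Lemma in_cube_at a h x : cube_at a h x <-> forall i, a 0 i < x 0 i <= a 0 i + h.
Proof. by split => hx i; have := hx i; rewrite /= !mxE. Qed.

Lemma lebesgue_cube_le a h : 0 <= h -> (lebesgue_outer (cube_at a h) <= (h ^+ N)%:E)%E.
Proof.
move=> h0; apply: ereal_inf_lbound; exists [set 0%N], (fun=> (a, a + const_mx h)).
split; first by move=> x hx; exists 0%N.
rewrite esum_set1 ?lee_fin ?box_vol_ge0// /box_vol /=.
rewrite (eq_bigr (fun=> h)) => [|i _]; first by rewrite prodr_const card_ord.
by rewrite !mxE addrAC subrr add0r max_r.
Qed.

(** A cover by boxes is integrated one coordinate at a time: F n k x is the
    volume of the k-th box in the first n coordinates times its indicator in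
    the others. For n = 0 the sum over k is at least 1 because the boxes
    cover, and each integration over a side of the cube gains a factor h. *)
Lemma lebesgue_cube_ge a h : 0 < h -> ((h ^+ N)%:E <= lebesgue_outer (cube_at a h))%E.
Proof.
move=> h0; apply: le_ereal_inf_tmp => _ [D [ab [cov ->]]].
pose ind k i (y : R) : R := \1_(`](ab k).1 0 i, (ab k).2 0 i]%classic : set R) y.
pose len k i : R := Num.max 0 ((ab k).2 0 i - (ab k).1 0 i).
pose F n k x := \prod_(i < N) (if (i < n)%N then len k i else ind k i (x 0 i)).
have len0 k i : 0 <= len k i by rewrite le_max lexx.
have ind0 k i y : 0 <= ind k i y by rewrite /ind indicE.
have F0 n k x : 0 <= F n k x by apply: prodr_ge0 => i _; case: ifP.
suff key n : (n <= N)%N -> forall x, cube_at a h x ->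
    ((h ^+ n)%:E <= \esum_(k in D) (F n k x)%:E)%E.
  apply: le_trans (key N (leqnn N) (a + const_mx h) _) _.
    by apply/in_cube_at => i; rewrite !mxE lexx ltrDl h0.
  apply: le_esum => k _; rewrite lee_fin /F /box_vol.
  by apply: ler_prod => i _; rewrite ltn_ord len0 lexx.
elim: n => [_ x hx|n IH nN x hx].
  have [k Dk kx] := cov x hx.
  apply: esum_ge; exists [set k].
    by split; [exact: finite_set1|move=> _ ->].
  rewrite fsbig_set1 lee_fin /F big1// => i _.
  rewrite /= /ind indicE mem_set//= in_itv /=.
  exact: kx.
pose i := Ordinal nN.
pose I := `]a 0 i, (a 0 i + h)]%classic : set R.
pose G k x := \prod_(j < N | j != i) (if (j < n.+1)%N then len k j else ind k j (x 0 j)).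
have G0 k : 0 <= G k x by apply: prodr_ge0 => j _; case: ifP.
have FS k : F n.+1 k x = len k i * G k x.
  by rewrite /F (bigD1 i) //= leqnn.
have Fn k y : F n k (set_coord x i y) = ind k i y * G k x.
  rewrite /F (bigD1 i) //= ltnn mxE eqxx; congr (_ * _).
  apply: eq_bigr => j ji; rewrite mxE (negbTE ji) ltnS [(j <= n)%N]leq_eqVlt.
  by rewrite (_ : (j == n :> nat) = false)//; apply/negbTE; move: ji; rewrite -(inj_eq val_inj).
pose g k y : \bar R := if k \in D then (ind k i y * G k x)%:E else 0%E.
have step y : I y -> ((h ^+ n)%:E <= \sum_(k <oo) g k y)%E.
  rewrite /I /= in_itv /= => yI.
  have hy : cube_at a h (set_coord x i y).
    apply/in_cube_at => j; rewrite mxE; case: eqVneq => [->//|_].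
    by move/in_cube_at: hx; exact.
  apply: le_trans (IH (ltnW nN) _ hy) _.
  rewrite esum_mkcond nneseries_esumT.
    by apply: le_esum => k _; rewrite /g; case: ifP => // _; rewrite Fn.
  by move=> k; rewrite /g; case: ifP => // _; rewrite lee_fin mulr_ge0.
have mI : measurable I by exact: measurable_itv.
have gE k y : g k y = ((if k \in D then (G k x)%:E else 0) * (ind k i y)%:E)%E.
  by rewrite /g; case: ifP => _; rewrite ?mul0e// -EFinM mulrC.
have mind k : measurable_fun I (EFin \o ind k i : R -> \bar R).
  by apply/measurable_EFinP; apply: measurable_indic; exact: measurable_itv.
have mg k : measurable_fun I (g k).
  rewrite (_ : g k = fun y => ((if k \in D then (G k x)%:E else 0) * (ind k i y)%:E)%E).
    apply: emeasurable_funM => //.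
    exact: mind.
  by apply/funext => y; exact: gE.
have g0 k y : (0 <= g k y)%E.
  by rewrite /g; case: ifP => // _; rewrite lee_fin mulr_ge0.
have lhs : (\int[lebesgue_measure]_(y in I) (h ^+ n)%:E)%E = (h ^+ n.+1)%:E.
  rewrite integral_cst//= /I lebesgue_measure_itv /= lte_fin ltrDl h0.
  by rewrite -EFinB addrAC subrr add0r -EFinM -exprSr.
have : ((h ^+ n.+1)%:E <= \int[lebesgue_measure]_(y in I) (\sum_(k <oo) g k y))%E.
  rewrite -lhs; apply: ge0_le_integral => //.
  - by move=> y _; rewrite lee_fin exprn_ge0// ltW.
  - exact: (ge0_emeasurable_sum (P := xpredT) (fun k y _ _ => g0 k y) (fun k _ => mg k)).
rewrite integral_nneseries// => /le_trans; apply.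
rewrite [leRHS]esum_mkcond nneseries_esumT => [|k]; last first.
  by apply: integral_ge0 => y _; exact: g0.
apply: le_esum => k _.
case: ifPn => kD; last first.
  rewrite (eq_integral (cst 0%E)) ?integral0// => y _.
  by rewrite /g (negbTE kD).
have -> : (\int[lebesgue_measure]_(y in I) g k y =
    \int[lebesgue_measure]_(y in I) ((G k x)%:E * (EFin \o ind k i) y))%E.
  by apply: eq_integral => y _; rewrite gE kD.
rewrite ge0_integralZl_EFin//; [|by move=> y _; rewrite lee_fin ind0|exact: mind].
rewrite FS mulrC EFinM; apply: lee_wpmul2l; first by rewrite lee_fin.
rewrite integral_indic//=.
apply: (@le_trans _ _ (lebesgue_measure `](ab k).1 0 i, (ab k).2 0 i]%classic)).
  apply: le_measure; rewrite ?inE//.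
    by apply: measurableI => //; exact: measurable_itv.
rewrite lebesgue_measure_itv /= lte_fin /len.
case: ifPn => hlt; first by rewrite -EFinB lee_fin le_max lexx orbT.
by rewrite lee_fin le_max lexx.
Qed.

Lemma lebesgue_cube a h : 0 < h -> lebesgue_outer (cube_at a h) = (h ^+ N)%:E.
Proof.
by move=> h0; apply/eqP; rewrite eq_le lebesgue_cube_ge// lebesgue_cube_le// ltW.
Qed.

End boxes.

(** * Averages of the solution over grids *)

Section finite_averages.
Context {R : realType} {N : nat}.
Implicit Types (x y : 'rV[R]_N) (z : 'rV[R]_N -> R -> R) (t c : R).

Lemma heat_at_sum (I : Type) (r : seq I) (z : I -> 'rV[R]_N -> R -> R) (c : I -> R) x t :
  (forall i, heat_at (z i) x t (c i)) ->
  heat_at (fun x t => \sum_(i <- r) z i x t) x t (\sum_(i <- r) c i).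
Proof.
move=> hz; elim: r => [|i r IH].
  rewrite big_nil (_ : (fun _ _ => _) = fun (_ : 'rV[R]_N) (_ : R) => 0).
    by apply: heat_at_time; exact: is_derive_cst.
  by apply/funext => y; apply/funext => s; rewrite big_nil.
rewrite big_cons.
rewrite (_ : (fun _ _ => _) = fun y s => z i y s + \sum_(j <- r) z j y s).
  exact: heat_at_funD.
by apply/funext => y; apply/funext => s; rewrite big_cons.
Qed.

Lemma heat_at_translate z x y t c : heat_at z (x + y) t c ->
  heat_at (fun x t => z (x + y) t) x t c.
Proof.
move=> h; have {}h : heat_at z (x + y) (t + 0) c by rewrite addr0.
have := heat_at_shift h.
rewrite (_ : (fun x t => z (x + y) (t + 0)) = (fun x t => z (x + y) t))//.
by apply/funext => x'; apply/funext => t'; rewrite addr0.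
Qed.

Lemma cube_lipschitz u x0 rho t : C1_pos u -> 0 < t -> exists2 B, 0 <= B &
  forall x y, (forall i, `|x 0 i - x0 0 i| <= rho) ->
    (forall i, `|y 0 i - x0 0 i| <= rho) ->
    `|u y t - u x t| <= B * \sum_i `|y 0 i - x 0 i|.
Proof.
move=> hu t0.
pose K : set 'rV[R]_N := [set x | forall i, `|x 0 i - x0 0 i| <= rho].
have cK : compact K.
  have := @rV_compact R N (fun i => `[x0 0 i - rho, x0 0 i + rho]%classic)
    (fun=> @segment_compact _ _ _).
  by congr compact; apply/seteqP; split => x /= h i; have := h i;
    rewrite in_itv /= ler_distl.
have [K0|/set0P Kne] := eqVneq K set0.
  exists 0 => // x y Kx _; have : K x by [].
  by rewrite K0.
have bnd i : exists B, forall x, K x -> `|partial (Some i) u x t| <= B.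
  have cp : {within K, continuous (fun x => `|partial (Some i) u x t|)}.
    apply: continuous_subspaceT => x; have [_ h] := hu (Some i) x t t0.
    have h1 : (fun x => partial (Some i) u x t) @ x --> partial (Some i) u x t.
      have hx : (fun x : 'rV[R]_N => x) @ x --> x by [].
      have ht : (fun _ : 'rV[R]_N => t) @ x --> t by exact: (@cst_continuous _ _ t x).
      have hp : (fun x : 'rV[R]_N => (x, t)) @ x --> (x, t) by exact: cvg_pair hx ht.
      exact: (@continuous_comp _ _ _ (fun x : 'rV[R]_N => (x, t))
        (fun q : 'rV[R]_N * R => partial (Some i) u q.1 q.2) _ hp h).
    exact: (@continuous_comp _ _ _ (fun x : 'rV[R]_N => partial (Some i) u x t)
      (fun r : R => `|r|) _ h1 (@norm_continuous _ _ _)).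
  have [c _ hc] := compact_EVT_max Kne cK cp.
  by exists `|partial (Some i) u c t| => x Kx; apply: hc; rewrite inE.
have [Bi hB] := choice bnd.
have B0 : 0 <= \sum_i `|Bi i| by exact: sumr_ge0.
exists (\sum_i `|Bi i|) => // x y Kx Ky.
apply: (@coord_lipschitz R N (fun i a => `|a - x0 0 i| <= rho) (u^~ t)) => //.
move=> w i h Kw Kwh.
have := @derive_bound_lipschitz R (fun s => u (w + s *: @unit_row R N i) t)
  (fun s => partial (Some i) u (w + s *: @unit_row R N i) t) 0 h (\sum_i `|Bi i|).
rewrite scale0r addr0 subr0; apply => s hs; split.
  exact: C1_along_is_derive (hu _) t0.
apply: (@le_trans _ _ `|Bi i|); last first.
  by rewrite (bigD1 i) //= lerDl sumr_ge0.
apply: le_trans (ler_norm _); apply: hB => j; rewrite coord_line.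
have [<-|ij] := eqVneq i j; last by rewrite mulr0 addr0.
rewrite mulr1; have := Kw i; move: Kwh; rewrite !ler_norml.
by move=> /andP[h1 h2] /andP[h3 h4]; case/orP: hs => /andP[h5 h6]; apply/andP; split; lra.
Qed.

Lemma measure_disjoint_union (I : choiceType) (r : seq I) (C : I -> set (leb_rV R N)) :
  uniq r -> (forall j, measurable (C j)) ->
  (forall i j, i != j -> C i `&` C j = set0) ->
  measurable (\big[setU/set0]_(j <- r) C j) /\
  (@lebesgue_rV R N (\big[setU/set0]_(j <- r) C j)
    = \sum_(j <- r) @lebesgue_rV R N (C j))%E.
Proof.
move=> + mC dC; elim: r => [_|i r IH /= /andP[ir ur]].
  by rewrite !big_nil measure0; split.
have [mU eU] := IH ur; rewrite !big_cons; split; first exact: measurableU.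
rewrite measureU//; first by rewrite -eU.
rewrite -subset0 => x [Cix].
rewrite -bigcup_seq => -[j /= jr Cjx].
have ij : i != j by apply: contraNneq ir => ->.
by have : (C i `&` C j) x by []; rewrite dC.
Qed.

End finite_averages.

Section initial_values.
Context {R : realType} {N : nat}.
Variables (f : R -> R) (u0 : 'rV[R]_N -> R) (u : 'rV[R]_N -> R -> R).
Hypothesis Hu : cauchy_solution f u0 u.
Implicit Types (x y : 'rV[R]_N) (s t h A D del M : R).

Lemma initial_L1_small (K : set 'rV[R]_N) s : compact K -> 0 < s ->
  exists2 d, 0 < d & forall t, 0 < t < d ->
    (\int[@lebesgue_rV R N]_(x in K) `|u x t - u0 x|%:E <= s%:E)%E.
Proof.
move=> cK s0; have := cauchy_init Hu cK.
move=> /(_ [set y : \bar R | (y < s%:E)%E]).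
have hn : nbhs (0%E : \bar R) [set y : \bar R | (y < s%:E)%E].
  apply: open_nbhs_nbhs; split; first exact: open_ereal_lt_ereal.
  by rewrite /= lte_fin.
move=> /(_ hn) [d /= d0 hd]; exists d => // t /andP[t0 td].
apply/ltW/hd => //; rewrite /ball /= sub0r normrN gtr0_norm//.
Qed.

(** The lower corners of the m ^ N cubes of side h / m that fill the cube of
    side h at the origin. *)
Definition grid_point h (m : nat) (j : {ffun 'I_N -> 'I_m}) : 'rV[R]_N :=
  \row_i (h / m%:R * (j i)%:R).

Lemma grid_cubes_disjoint x h m (i j : {ffun 'I_N -> 'I_m}) : 0 < h -> i != j ->
  cube_at (x + grid_point h i) (h / m%:R) `&` cube_at (x + grid_point h j) (h / m%:R)
    = set0.
Proof.
move=> h0 ij; rewrite -subset0 => y [/in_cube_at hi /in_cube_at hj].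
have [k kij] : exists k, i k != j k.
  apply/existsP; apply: contraNT ij; rewrite negb_exists => /forallP e.
  by apply/eqP/ffunP => k; apply/eqP; have := e k; rewrite negbK.
have m0 : 0 < m%:R :> R by rewrite ltr0n (leq_ltn_trans _ (ltn_ord (i k))).
have hm : 0 < h / m%:R by exact: divr_gt0.
have := hi k; have := hj k; rewrite !mxE.
have gap (a c : 'I_m) : (a < c)%N -> h / m%:R * a%:R + h / m%:R <= h / m%:R * c%:R.
  move=> ac; have : (a%:R + 1 : R) <= c%:R by rewrite natr1 ler_nat.
  by move=> /(ler_wpM2l (ltW hm)); rewrite mulrDr mulr1.
move=> /andP[h1 h2] /andP[h3 h4].
by case: (ltngtP (i k) (j k)) kij => [/gap|/gap|/val_inj->]; rewrite ?eqxx//; lra.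
Qed.

(** The convergence of the initial values in L^1 makes the set where u(tau)
    exceeds A + del small in measure. By the Lipschitz continuity of u(tau), a
    small grid cube whose corner has a value above A + 2 del lies in this set,
    so few cubes do, and they contribute at most del to the mean value over
    the grid. This replaces the initial values, known only almost everywhere,
    by pointwise ones. *)
Lemma grid_average x0 D h t1 A del M : 0 < D -> 0 < h <= 1 -> 0 < t1 -> 0 < del ->
  0 <= A -> 0 <= M ->
  {ae @lebesgue_rV R N, forall y, (forall i, `|y 0 i - x0 0 i| <= D + 1) -> u0 y <= A} ->
  (forall x t, 0 < t <= t1 -> u x t <= M) ->
  exists2 tau, 0 < tau < t1 & exists2 m : nat, (0 < m)%N &
    forall x, (forall i, `|x 0 i - x0 0 i| <= D) ->
      \sum_(j : {ffun 'I_N -> 'I_m}) u (x + grid_point h j) tau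
        <= (m ^ N)%:R * (A + 3 * del).
Proof.
move=> D0 /andP[h0 h1] t10 del0 A0 M0 [N0 [mN0 N00 aeA]] uM.
pose K : set 'rV[R]_N := [set y | forall i, `|y 0 i - x0 0 i| <= D + 1].
have cK : compact K.
  have := @rV_compact R N (fun i => `[x0 0 i - (D + 1), x0 0 i + (D + 1)]%classic)
    (fun=> @segment_compact _ _ _).
  by congr compact; apply/seteqP; split => x /= hx i; have := hx i;
    rewrite in_itv /= ler_distl.
(* With this bound on the integral, the cubes with a large value make up at most
   the fraction del / (M + 1) of the grid. *)
pose s := del * del * h ^+ N / (M + 1).
have hN0 : 0 < h ^+ N by exact: exprn_gt0.
have M1 : 0 < M + 1 by lra.
have s0 : 0 < s by rewrite divr_gt0// !mulr_gt0.
have [d d0 hd] := initial_L1_small cK s0.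
pose tau := Num.min d t1 / 2.
have m0 : 0 < Num.min d t1 by rewrite lt_min d0.
have md : Num.min d t1 <= d by rewrite ge_min lexx.
have mt : Num.min d t1 <= t1 by rewrite ge_min lexx orbT.
have tau0 : 0 < tau by rewrite /tau; lra.
have taud : tau < d by rewrite /tau; lra.
have taut : tau < t1 by rewrite /tau; lra.
exists tau; first by rewrite tau0.
have [B B0 hB] := @cube_lipschitz R N u x0 (D + 1) tau (cauchy_reg Hu).1 tau0.
pose m := (Num.bound (B * N%:R * h / del)).+1.
have mR : B * N%:R * h / del <= m%:R.
  have BN : 0 <= B * N%:R * h / del.
    by rewrite divr_ge0 ?mulr_ge0// ltW.
  apply: le_trans (ler_norm _) _; apply: le_trans (ltW (archi_boundP (normr_ge0 _))) _.
  by rewrite (ger0_norm BN) ler_nat.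
have mp : 0 < m%:R :> R by rewrite ltr0n.
exists m => // x hx.
pose J := {ffun 'I_N -> 'I_m}.
pose C (j : J) : set 'rV[R]_N := cube_at (x + grid_point h j) (h / m%:R).
have hm0 : 0 < h / m%:R by exact: divr_gt0.
have gpI (j : J) i : 0 <= grid_point h j 0 i /\ grid_point h j 0 i + h / m%:R <= h.
  rewrite mxE; split; first by rewrite mulr_ge0// ltW.
  have : ((j i).+1%:R : R) <= m%:R by rewrite ler_nat.
  move=> /(ler_wpM2l (ltW hm0)); rewrite -natr1 mulrDr mulr1.
  by rewrite divfK ?gt_eqF.
pose P : pred J := fun j => A + 2 * del < u (x + grid_point h j) tau.
pose n := #|P|.
pose U : set (leb_rV R N) := \big[setU/set0]_(j <- enum P) C j.
have xK (j : J) i y : x 0 i + grid_point h j 0 i <= y 0 i ->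
    y 0 i <= x 0 i + grid_point h j 0 i + h / m%:R -> `|y 0 i - x0 0 i| <= D + 1.
  move=> hy1 hy2; have [g1 g2] := gpI j i; have := hx i.
  rewrite !ler_norml => /andP[h3 h4].
  by clear -Hu hy1 hy2 g1 g2 h3 h4 h1; apply/andP; split; lra.
have cornerK (j : J) i : `|(x + grid_point h j) 0 i - x0 0 i| <= D + 1.
  have e : (x + grid_point h j) 0 i = x 0 i + grid_point h j 0 i by rewrite mxE.
  by apply: (xK j i (x + grid_point h j)); rewrite e; clear -Hu hm0; lra.
have osc (j : J) y : C j y -> `|u y tau - u (x + grid_point h j) tau| <= del.
  move=> /in_cube_at Cy.
  have yK i : `|y 0 i - x0 0 i| <= D + 1.
    by have := Cy i; rewrite mxE => /andP[h3 h4]; apply: (xK j) => //; exact: ltW.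
  apply: le_trans (hB _ _ (cornerK j) yK) _.
  apply: (@le_trans _ _ (B * \sum_(i < N) (h / m%:R))).
    apply: ler_wpM2l => //; apply: ler_sum => i _; have /andP[h3 h4] := Cy i.
    by clear -Hu h3 h4; rewrite ger0_norm; lra.
  rewrite sumr_const card_ord -[X in B * X]mulr_natl.
  rewrite ler_pdivrMr// in mR; rewrite !mulrA ler_pdivrMr//; clear -Hu mR; lra.
have Ubad y : U y -> exists2 j, P j & C j y.
  by rewrite /U -bigcup_seq => -[j /=]; rewrite mem_enum => Pj Cj; exists j.
have [mU eU] : measurable U /\ (@lebesgue_rV R N U = (n%:R * (h / m%:R) ^+ N)%:E)%E.
  have [h2 h3] := @measure_disjoint_union R N J (enum P) C (enum_uniq _)
    (fun j => box_measurable _) (fun i j => @grid_cubes_disjoint x h m i j h0).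
  split => //; rewrite h3 (eq_bigr (fun=> ((h / m%:R) ^+ N)%:E)); last first.
    by move=> j _; exact: lebesgue_cube.
  rewrite sumEFin; congr EFin.
  by rewrite big_const_seq count_predT -cardE iter_addr_0 mulr_natl.
have nsmall : del * (n%:R * (h / m%:R) ^+ N) <= s.
  rewrite -lee_fin EFinM -eU.
  apply: (@le_trans _ _ (del%:E * @lebesgue_rV R N (U `\` N0))%E).
    apply: lee_wpmul2l; first by rewrite lee_fin ltW.
    apply: (@le_trans _ _ (lebesgue_outer ((U `\` N0) `|` N0))).
      apply: le_outer_measure => y Uy.
      by have [Ny|Ny] := pselect (N0 y); [right|left].
    apply: le_trans (outer_measureU2 _ _ _) _.
    by rewrite /= [X in (_ + X)%E](_ : _ = 0%E) ?adde0//; exact: N00.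
  apply: le_trans (hd tau _); last by rewrite tau0.
  apply: integral_ge_indic => //; first exact: measurableD.
    by exact: ltW.
  move=> y [Uy N0y]; have [j Pj Cy] := Ubad y Uy.
  have yK : K y.
    move=> i; have /in_cube_at/(_ i) := Cy; rewrite mxE => /andP[h3 h4].
    by apply: (xK j) => //; exact: ltW.
  split => //; rewrite lee_fin.
  have u0A : u0 y <= A by apply: contrapT => nA; apply: N0y; apply: aeA => /(_ yK).
  have := osc j y Cy; rewrite ler_norml => /andP[h3 h4].
  apply: le_trans (ler_norm _); move: Pj; rewrite /P; clear -Hu h3 h4 u0A; lra.
have cardJ : #|{: J}| = (m ^ N)%N by rewrite card_ffun !card_ord.
have mNpos : 0 < (m ^ N)%:R :> R by rewrite ltr0n expn_gt0.
have nM : n%:R * M <= (m ^ N)%:R * del.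
  have e1 : h ^+ N = (h / m%:R) ^+ N * (m ^ N)%:R.
    by rewrite natrX -exprMn divfK// gt_eqF.
  have X0 : 0 < (h / m%:R) ^+ N by exact: exprn_gt0.
  move: nsmall; rewrite /s ler_pdivlMr// e1 => h2.
  have h3 : n%:R * (M + 1) * (del * (h / m%:R) ^+ N)
      <= (m ^ N)%:R * del * (del * (h / m%:R) ^+ N) by clear -Hu h2; lra.
  rewrite ler_pM2r ?mulr_gt0// in h3.
  have : n%:R * M <= n%:R * (M + 1) by rewrite ler_wpM2l//; clear -Hu x; lra.
  by clear -Hu h3; lra.
apply: (@le_trans _ _ (\sum_(j : J) ((A + 2 * del) + (if P j then M else 0)))).
  apply: ler_sum => j _; case: ifPn => [Pj|].
    have := uM (x + grid_point h j) tau; rewrite tau0 (ltW taut) => /(_ isT).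
    by clear -Hu A0 del0; lra.
  by rewrite /P -leNgt; clear -Hu x; lra.
have -> : \sum_(j : J) (A + 2 * del + (if P j then M else 0)) =
    (m ^ N)%:R * (A + 2 * del) + n%:R * M.
  rewrite big_split /= -big_mkcond /=; congr (_ + _).
    by rewrite sumr_const cardJ -[LHS]mulr_natl.
  by rewrite sumr_const -[LHS]mulr_natl.
clear -Hu nM.
by lra.
Qed.

End initial_values.

(** * Decay of the solution at infinity *)

Section initial_decay.
Context {R : realType} {N : nat}.
Variables (f : R -> R) (u0 : 'rV[R]_N -> R) (u : 'rV[R]_N -> R -> R) (b : R).
Hypothesis f_derivable : forall s : R, derivable f s 1.
Hypothesis Hu : cauchy_solution f u0 u.
Hypothesis Hb : 0 < b.
Hypothesis Hu0 : class_T b u0.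
Implicit Types (x y : 'rV[R]_N) (s t A D M : R).

Let ae_imp (P Q : 'rV[R]_N -> Prop) : (forall x, P x -> Q x) ->
  {ae @lebesgue_rV R N, forall x, P x} -> {ae @lebesgue_rV R N, forall x, Q x}.
Proof.
move=> PQ [N0 [mN0 N00 sub]]; exists N0; split => // x nQ.
by apply: sub => /PQ.
Qed.

Let essential_bound : exists2 r, 0 < r & exists2 A, 0 < A < b &
  {ae @lebesgue_rV R N, forall x, r < enorm x -> u0 x <= A}.
Proof.
have b0 := Hb; have [_ [r r0 hess]] := Hu0; exists r => //.
have [y /= ae_y yb] := ereal_inf_lt hess.
pose A := Num.max (b / 2) (fine y).
have A1 : b / 2 <= A by rewrite le_max lexx.
have A2 : fine y <= A by rewrite le_max lexx orbT.
exists A.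
  apply/andP; split; first by lra.
  rewrite gt_max; apply/andP; split; first by lra.
  by move: yb; case: (y) => [s| |] //=; rewrite lte_fin.
apply: ae_imp ae_y => x h /h.
by move: yb A2; case: (y) => [s| |] //= _ sA; rewrite lee_fin => /le_trans; apply.
Qed.

(** A mean of translates of u over the grid solves the heat equation with a
    right-hand side at most F, starts below A + 3 del near x0 and therefore
    stays below A + 5 del at x0 up to the time t1. So does one of its terms;
    as the grid shrinks to x0, u(x0, t1) inherits the bound. *)
Lemma initial_far_le : exists2 t1, 0 < t1 & exists2 A, 0 < A < b & far_le u t1 A.
Proof.
have b0 := Hb; have [r r0 [A /andP[A0 Ab] aeA]] := essential_bound.
pose del := (b - A) / 8.
have del0 : 0 < del by rewrite /del; lra.
have [M0 hM0] := cauchy_bounded Hu ltr01.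
pose M := `|M0| + 1 + b.
have Mp : 0 <= M by rewrite /M; have := normr_ge0 M0; lra.
have M0M : M0 <= M by rewrite /M; have := ler_norm M0; lra.
have [F F0 hF] : exists2 F, 0 <= F & forall a, - M <= a <= M -> f a <= F.
  have MM : - M <= M by lra.
  have [c _ hc] := EVT_max MM (continuous_subspaceT (derivable_continuous f_derivable)).
  exists `|f c| => // a aI; apply: le_trans (ler_norm _).
  by apply: hc; rewrite in_itv.
pose t1 := Num.min 1 (del / (F + 1)).
have t10 : 0 < t1 by rewrite lt_min ltr01 divr_gt0//; lra.
have t11 : t1 <= 1 by rewrite ge_min lexx.
have Ft1 : F * t1 <= del.
  have h1 : t1 <= del / (F + 1) by rewrite ge_min lexx orbT.
  rewrite ler_pdivlMr in h1; last by lra.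
  lra.
exists t1 => //; exists (A + 6 * del); first by rewrite /del; apply/andP; split; lra.
have AM : A + 3 * del <= M by rewrite /del /M; have := normr_ge0 M0; lra.
have [D D0 hD] := @affine_error_small R N (A + 3 * del) M 0 t1 del del0 AM (ltW t10).
have uM x t : 0 < t <= t1 -> `|u x t| <= M.
  by move=> tI; apply: le_trans M0M; apply: hM0; apply/andP; split; lra.
(* For x0 beyond this radius the cube of half-side D + 2 around x0 lies in the
   region where the essential bound holds. *)
exists (2 * (r ^+ 2 + 1) + 2 * (N%:R * (D + 2) ^+ 2)) => x0 hx0.
have far y : (forall i, `|y 0 i - x0 0 i| <= D + 1 + 1) -> r < enorm y.
  move=> hy; have h1 := sqnormB_ge y x0.
  have h2 : sqnorm (y - x0) <= N%:R * (D + 2) ^+ 2.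
    have -> : N%:R * (D + 2) ^+ 2 = \sum_(i < N) (D + 2) ^+ 2.
      by rewrite sumr_const card_ord mulr_natl.
    apply: ler_sum => i _; rewrite !mxE -(real_normK (num_real (_ - _))).
    rewrite ler_sqr ?nnegrE//; last by lra.
    by have := hy i; lra.
  have h3 : r ^+ 2 < sqnorm y by lra.
  rewrite /enorm -(ger0_norm (ltW r0)) -sqrtr_sqr.
  by rewrite ltr_sqrt// (le_lt_trans (sqr_ge0 r) h3).
have aeA' : {ae @lebesgue_rV R N, forall y,
    (forall i, `|y 0 i - x0 0 i| <= D + 1 + 1) -> u0 y <= A}.
  by apply: ae_imp aeA => y h /far; exact: h.
apply/ler_addgt0Pr => e e0.
have [d d0 hd] := (jointly_continuous_atP u x0 t1).1
  (@C1_pos_jointly_continuous R N u x0 t1 (cauchy_reg Hu).1 t10) e e0.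
pose h := Num.min 1 (d / 2).
have h0 : 0 < h by rewrite lt_min ltr01 divr_gt0.
have h1 : h <= 1 by rewrite ge_min lexx.
have hdd : h <= d / 2 by rewrite ge_min lexx orbT.
have D1 : 0 < D + 1 by lra.
have h01 : 0 < h <= 1 by rewrite h0.
have [tau /andP[tau0 tau1] [m m0 avg]] := @grid_average R N f u0 u Hu x0 (D + 1) h t1 A del M
  D1 h01 t10 del0 (ltW A0) Mp aeA'
  (fun x t tI => le_trans (ler_norm _) (uM x t tI)).
have mN0 : 0 < (m ^ N)%:R :> R by rewrite ltr0n expn_gt0 m0.
pose J := {ffun 'I_N -> 'I_m}.
have cardJ : #|{: J}| = (m ^ N)%N by rewrite card_ffun !card_ord.
pose k : R := ((m ^ N)%:R)^-1.
have k0 : 0 < k by rewrite invr_gt0.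
have mean c : k * \sum_(j : J) c = c.
  by rewrite sumr_const cardJ -[c *+ _]mulr_natl mulrA mulVf ?mul1r// gt_eqF.
pose w x t := k * \sum_(j : J) u (x + grid_point h j) t.
have wle c x t : (forall j : J, u (x + grid_point h j) t <= c) -> w x t <= c.
  by move=> hc; rewrite -[leRHS]mean ler_pM2l//; apply: ler_sum => j _; exact: hc.
have w_heat x t : tau <= t <= t1 -> exists2 c, heat_at w x t c & c <= F.
  case/andP=> h2 h3; have tp : 0 < t by exact: lt_le_trans tau0 h2.
  exists (k * \sum_(j : J) f (u (x + grid_point h j) t)).
    apply: heat_at_funZ; apply: heat_at_sum => j; apply: heat_at_translate.
    by apply: C21_pos_heat; [exact: cauchy_reg Hu|exact: cauchy_eq Hu|].
  rewrite -[leRHS]mean ler_pM2l//; apply: ler_sum => j _; apply: hF.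
  by rewrite -ler_norml; apply: uM; rewrite tp.
have w_le x t : tau <= t <= t1 -> w x t <= M.
  case/andP=> h2 h3; apply: wle => j; apply: le_trans (ler_norm _) _; apply: uM.
  by rewrite h3 (lt_le_trans tau0 h2).
have w_init x : sqnorm (x - x0) <= D -> w x tau <= A + 3 * del.
  move=> hx; rewrite /w /k mulrC ler_pdivrMr// mulrC; apply: avg => i.
  have := coord_sqr_le_sqnorm (x - x0) i; rewrite !mxE -(real_normK (num_real (_ - _))).
  set a := `|_| => ha; have a0 : 0 <= a by exact: normr_ge0.
  have a2 : a ^+ 2 <= D by exact: le_trans ha hx.
  clearbody a; clear -f_derivable Hu Hb Hu0 D0 a0 a2.
  by rewrite leNgt; apply/negP => Da; rewrite expr2 in a2; nra.
have w_end : w x0 t1 <= A + 5 * del.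
  have slope t c : tau <= t <= t1 -> A + 3 * del + F * (t - tau) <= c <= M ->
      F <= F + 0 * (c - (A + 3 * del + F * (t - tau))) by rewrite mul0r addr0.
  have := @local_affine_bound R N w (fun=> F) x0 tau t1 (A + 3 * del) F M 0 D (ltW tau1) D0
    (lexx 0) AM w_heat w_le slope w_init.
  rewrite !mul0r expR0 mulr1 => H.
  move: hD; rewrite mul0r expR0 mulr1 => hD.
  have h2 : (M - (A + 3 * del)) * (2 * N%:R * (t1 - tau)) / D <= del.
    apply: le_trans hD; rewrite ler_pM2r ?invr_gt0//.
    apply: ler_wpM2l; first by rewrite subr_ge0.
    by apply: ler_wpM2l; [exact: mulr_ge0|rewrite gerBl ltW].
  have h3 : F * (t1 - tau) <= F * t1 by apply: ler_wpM2l => //; rewrite gerBl ltW.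
  by clear -f_derivable Hu Hb Hu0 H h2 h3 Ft1; lra.
have [j hj] : exists j : J, u (x0 + grid_point h j) t1 <= A + 5 * del.
  apply/not_existsP => hn.
  have : A + 5 * del < w x0 t1.
    rewrite -[ltLHS]mean ltr_pM2l//; apply: ltr_sum => //.
      by apply/hasP; exists [ffun=> Ordinal m0]; rewrite ?mem_index_enum.
    by move=> j _; rewrite ltNge; apply/negP/hn.
  lra.
have close : `|x0 + grid_point h j - x0| < d.
  rewrite addrC addKr [`|_|]/normr /= mx_normrE; apply/bigmax_ltP; split => // -[a i] _ /=.
  rewrite (ord1 a) mxE ger0_norm; last first.
    by rewrite mulr_ge0// ltW// divr_gt0// ltr0n.
  apply: (@le_lt_trans _ _ h); first last.
    by apply: le_lt_trans hdd _; clear -f_derivable Hu Hb Hu0 d0; lra.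
  rewrite -[leRHS](divfK (_ : m%:R != 0 :> R)) ?pnatr_eq0 -?lt0n//.
  rewrite ler_pM2l ?divr_gt0 ?ltr0n// ler_nat ltnW//.
have := hd _ t1 close; rewrite subrr normr0 => /(_ d0).
rewrite ler_norml => /andP[h4 h5].
by clear -f_derivable Hu Hb Hu0 hj h4 h5 del0; lra.
Qed.

End initial_decay.

(** * The terrace solution as a barrier *)

Section stable_platforms.
Context {R : realType}.
Implicit Types (f : R -> R) (Q : nat -> R) (a b m L : R).

Lemma stable_platform_slope f Q n0 : continuous f^`() ->
  (forall k, (k <= n0)%N -> f^`() (Q k) < 0) ->
  exists2 m, 0 < m & forall k s, (k <= n0)%N -> `|s - Q k| <= 2 * m ->
    derive1 f s <= - m.
Proof.
move=> cf hQ.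
have [k /andP[k1 kn]|m m0 hm] := @finitely_many_small R n0.+1
    (fun k m => forall s, `|s - Q k.-1| <= 2 * m -> derive1 f s <= - m).
  have kn' : (k.-1 <= n0)%N by case: k k1 kn.
  pose q := - derive1 f (Q k.-1) / 2.
  have q0 : 0 < q by have := hQ _ kn'; rewrite /q; lra.
  have /cvgrPdist_le /(_ _ q0) := cf (Q k.-1).
  move=> /nbhs_ballP[d /= d0 hd].
  exists (Num.min (d / 4) q); first by rewrite lt_min q0 divr_gt0.
  move=> t /andP[t0]; rewrite le_min => /andP[td tq] s hs.
  have : `|derive1 f (Q k.-1) - derive1 f s| <= q.
    by apply: hd; rewrite /ball /= distrC; lra.
  by rewrite ler_norml /q in tq * => /andP[h1 h2]; lra.
exists m => // k s kn; apply: (hm k.+1) => //.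
by rewrite m0 lexx.
Qed.

(** The reaction absorbs a perturbation of height b - a: near a platform the
    slope of f is at most - m, and elsewhere the Lipschitz bound L is paid for by
    vt >= kap, where vt stands for the time derivative of v. *)
Lemma perturbation_slope f L m kap a b K Qk vt :
  (forall s : R, derivable f s 1) ->
  (forall a b, - K <= a <= K -> - K <= b <= K -> `|f a - f b| <= L * `|a - b|) ->
  0 <= L -> 0 < m -> 0 < kap -> 0 <= vt -> - K <= a -> a <= b -> b <= K ->
  (forall s, `|s - Qk| <= 2 * m -> derive1 f s <= - m) ->
  (`|a - Qk| <= 2 * m /\ `|b - Qk| <= 2 * m) \/ kap <= vt ->
  f b - f a <= ((L + m) / kap * vt - m) * (b - a).
Proof.
move=> df lip L0 m0 kap0 vt0 Ka ab bK slope [[ha hb]|hvt].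
  have fd s : a <= s <= b -> is_derive s 1 f (derive1 f s).
    by move=> _; rewrite derive1E; exact: derivableP.
  have [c cI ->] := MVT_is_derive ab fd.
  have hc : derive1 f c <= - m.
    apply: slope; move: ha hb; rewrite !ler_norml => /andP[h1 h2] /andP[h3 h4].
    by apply/andP; split; lra.
  apply: ler_wpM2r; first by rewrite subr_ge0.
  have : 0 <= (L + m) / kap * vt by rewrite mulr_ge0// divr_ge0; lra.
  lra.
have h1 : f b - f a <= L * (b - a).
  apply: le_trans (ler_norm _) _; apply: le_trans (lip _ _ _ _) _; try lra.
  by rewrite ger0_norm ?subr_ge0.
apply: le_trans h1 _; apply: ler_wpM2r; first by rewrite subr_ge0.
have : L + m <= (L + m) / kap * vt.
  rewrite mulrAC ler_pdivlMr// ler_wpM2l//; lra.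
lra.
Qed.

End stable_platforms.

Section main.
Context {R : realType} {N : nat}.
Variables (f : R -> R) (p : R) (n0 : nat) (Q : nat -> R) (U : nat -> R -> R).
Variables (c : nat -> R) (v : 'rV[R]_N -> R -> R) (V : R -> R -> R).
Hypothesis hf1 : cond_f1 f.
Hypothesis p_gt0 : 0 < p.
Hypothesis hterrace : propagating_terrace f p n0 Q U c.
Hypothesis hV : radial_terrace_solution f p n0 Q U c v V.
Implicit Types (x : 'rV[R]_N) (s t : R).

Let f_derivable (s : R) : derivable f s 1. Proof. by case: hf1. Qed.
Let f_C1 : continuous f^`(). Proof. by case: hf1. Qed.

Let v_C21 : C21_pos v.
Proof.
have h := rts_C2 hV.
by split; [exact: h.1|move=> i j; exact: h.2].
Qed.

Let v_range x t : 0 < t -> 0 <= v x t <= p.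
Proof. by move=> t0; have /andP[h1 h2] := rts_bounds hV x t0; rewrite !ltW. Qed.

Let v_time x t : 0 < t -> is_derive t 1 (v x) (partial None v x t).
Proof. by move=> t0; apply: C1_time_is_derive => //; exact: v_C21.1. Qed.

Lemma enorm_ge0 x : 0 <= enorm x. Proof. exact: sqrtr_ge0. Qed.

Lemma terrace_solution_nondecreasing x s t : 0 <= s -> s <= t -> v x s <= v x t.
Proof.
have pos a b : 0 < a -> a <= b -> v x a <= v x b.
  move=> a0 ab; have fd r : a <= r <= b -> is_derive r 1 (v x) (partial None v x r).
    by move=> rI; apply: v_time; lra.
  have [r rI e] := MVT_is_derive ab fd.
  rewrite -subr_ge0 e mulr_ge0 ?subr_ge0// ltW//.
  by apply: (rts_incr hV); lra.
rewrite le_eqVlt => /predU1P[<-|s0]; last exact: pos.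
rewrite le_eqVlt => /predU1P[<-//|t0].
apply/ler_addgt0Pr => e e0.
have /subspace_continuousP /(_ (x, 0) (lexx 0)) := rts_continuous hV.
move=> /cvgrPdist_le /(_ _ e0).
rewrite near_withinE => /nbhs_ballP[d /= d0 hd].
pose r := Num.min (d / 2) t.
have r0 : 0 < r by rewrite lt_min t0 divr_gt0.
have rd : r <= d / 2 by rewrite ge_min lexx.
have rt : r <= t by rewrite ge_min lexx orbT.
have := hd (x, r); rewrite /= => /(_ _ (ltW r0)) h.
have {h} : `|v x 0 - v x r| <= e.
  apply: h; split; first exact: ballxx.
  by rewrite /ball /= sub0r normrN gtr0_norm//; lra.
by rewrite ler_norml => /andP[_ h]; have := pos r t r0 rt; lra.
Qed.

Let range_lipschitz : exists2 L, 0 <= L & forall a b, - (p + 1) <= a <= p + 1 ->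
  - (p + 1) <= b <= p + 1 -> `|f a - f b| <= L * `|a - b|.
Proof. by apply: C1_bounded_lipschitz => //; have := p_gt0; lra. Qed.

(** On a short interval of length tau, v increases by kap tau, so v_t is at
    least kap at some intermediate time, and at t by uniform continuity. *)
Lemma platform_or_speed eps : 0 < eps -> exists2 kap, 0 < kap & exists2 T, 0 < T &
  forall x t, T <= t -> (exists2 k, (k <= n0)%N & `|v x t - Q k| <= eps) \/
    kap <= partial None v x t.
Proof.
move=> eps0.
have [eta [eta1 eta2 eta3 eta4]] := rts_terrace hV.
have [kap kap0 hkap] := platform_or_increase hterrace eta1 eta2 eta3 eta4 eps0.
have [L L0 lip] := range_lipschitz.
have [F hF] : exists F, forall a, 0 <= a <= p -> `|f a| <= F.
  exists (`|f 0| + L * p) => a aI.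
  rewrite -(subrK (f 0) (f a)) addrC; apply: le_trans (ler_normD _ _) _.
  have pp := p_gt0.
  rewrite lerD2l; apply: le_trans (lip _ _ _ _) _; try by apply/andP; split; lra.
  by rewrite subr0 ler_wpM2l// ger0_norm; lra.
have lip' a b : 0 <= a <= p -> 0 <= b <= p -> `|f a - f b| <= L * `|a - b|.
  by move=> aI bI; have pp := p_gt0; apply: lip; apply/andP; split; lra.
have k2 : 0 < kap / 2 by lra.
have [tau1 tau10 hmod] := time_derive_unif_continuous L0 lip' hF (rts_C2 hV) (rts_eq hV)
  v_range k2.
pose tau := Num.min 1 tau1.
have tau0 : 0 < tau by rewrite lt_min ltr01.
have tl1 : tau <= 1 by rewrite ge_min lexx.
have tl2 : tau <= tau1 by rewrite ge_min lexx orbT.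
have tauI : 0 < tau <= 1 by rewrite tau0.
have [T T0 hT] := hkap tau tauI.
exists (kap / 2) => //; exists (T + 4); first by lra.
move=> x t Tt; have Tt' : T <= t by lra.
have t0 : 0 < t by lra.
have [[k kn hk]|hinc] := hT t (enorm x) Tt' (enorm_ge0 x).
  by left; exists k => //; rewrite (rts_profile hV)// ltW.
right.
have ttau : 0 <= t + tau by lra.
rewrite -!(rts_profile hV) ?(ltW t0)// in hinc.
have le1 : t <= t + tau by lra.
have fd r : t <= r <= t + tau -> is_derive r 1 (v x) (partial None v x r).
  by move=> rI; apply: v_time; lra.
have [r rI e] := MVT_is_derive le1 fd.
rewrite e [t + tau - t]addrC addKr ler_pM2r// in hinc.
have t3 : 3 < t by lra.
have rtI : 0 <= r - t <= tau1 by lra.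
have := hmod x t (r - t) t3 rtI.
rewrite [t + _]addrC subrK ler_norml => /andP[h1 h2]; lra.
Qed.

Variable u : 'rV[R]_N -> R -> R.

(** For g = 1 the function v(x, theta) + sig e with
    theta = t - T + X - K e and e = exp (- m (t - T)) is a supersolution; for
    g = -1 the signs change and it is a subsolution. The acceleration
    theta' - 1 = g m K e contributes the term g m K e v_t, which
    perturbation_slope needs off the platforms, and K is chosen for that. *)
Lemma wave_comparison g L m kap T1 T X sig :
  (g = 1 \/ g = - 1) -> 0 <= L -> 0 < m -> 0 < kap -> 0 < T1 -> 0 < T ->
  (forall a b, - (p + 1) <= a <= p + 1 -> - (p + 1) <= b <= p + 1 ->
    `|f a - f b| <= L * `|a - b|) ->
  (forall k s, (k <= n0)%N -> `|s - Q k| <= 2 * m -> derive1 f s <= - m) ->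
  (forall x t, T1 <= t -> (exists2 k, (k <= n0)%N & `|v x t - Q k| <= m) \/
    kap <= partial None v x t) ->
  0 < sig -> sig <= m -> sig <= 1 ->
  (forall x t, 0 < t -> heat_at u x t (f (u x t))) ->
  (forall x t, T <= t -> - 1 <= u x t <= p + 1) ->
  let K := sig * (L + m) / (m * kap) in
  T1 + K <= X ->
  (forall x, g * u x T <= g * v x (X - g * K) + sig) ->
  forall x t, T <= t ->
    g * u x t <= g * v x (t - T + X - g * K * expR (- m * (t - T)))
                 + sig * expR (- m * (t - T)).
Proof.
move=> gE L0 m0 kap0 T10 T0 lip slope speed sig0 sigm sig1 u_heat u_range K XK init.
have gg : g * g = 1 by case: gE => ->; rewrite ?mulr1 ?mulrNN ?mulr1.
have gn : `|g| = 1 by case: gE => ->; rewrite ?normrN normr1.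
have pp := p_gt0.
have Lm0 : 0 <= L + m by lra.
have KE : K = sig * (L + m) / (m * kap) by [].
clearbody K.
have K0 : 0 <= K.
  by rewrite KE divr_ge0 ?mulr_ge0// ltW// mulr_gt0.
pose e t := expR (- m * (t - T)).
have e_gt0 t : 0 < e t by exact: expR_gt0.
have e_le1 t : T <= t -> e t <= 1.
  move=> Tt; rewrite /e -expR0 ler_expR mulNr oppr_le0 mulr_ge0//; lra.
have e_d t : is_derive t 1 e (- m * e t).
  have h := is_derive_affine t (- m) (m * T).
  have h2 := is_derive_comp (g := fun s => - m * s + m * T) (is_derive_expR (- m * t + m * T)) h.
  apply: is_derive_ext h2 _ _ => [r|]; rewrite /e; first by congr expR; ring.
  by rewrite mulrC; congr (_ * expR _); ring.
pose th t := 1 * t + (X - T) + - (g * K) * e t.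
have th_d t : is_derive t 1 th (1 + (g * K) * m * e t).
  have h := is_derive_funM (is_derive_cst (- (g * K)) t (1 : R)) (e_d t).
  apply: is_derive_ext (is_derive_funD (is_derive_affine t 1 (X - T)) h) _ _ => [r|] //=.
  by rewrite mul0r add0r; ring.
have th_ge t : T <= t -> T1 <= th t.
  move=> Tt; have e1 := e_le1 t Tt; have e0 := e_gt0 t.
  have : g * K * e t <= K.
    apply: le_trans (ler_norm _) _; rewrite !normrM gn mul1r.
    rewrite (ger0_norm K0) (gtr0_norm (e_gt0 t)).
    by rewrite -[leRHS]mulr1 ler_wpM2l.
  by rewrite /th; lra.
pose d x t := g * (u x t - v (x + 0) (th t)) - sig * e t.
have dE x t : d x t = g * u x t - g * v x (th t) - sig * e t.
  by rewrite /d addr0 mulrBr.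
have hd S x t : T <= t <= S -> exists2 c, heat_at d x t c &
    (T < t -> 0 <= d x t -> c <= L * d x t).
  move=> /andP[Tt _]; have t0 : 0 < t by lra.
  have tht := th_ge t Tt; have th0 : 0 < th t by lra.
  have v_heat : heat_at v (x + 0) (th t) (f (v (x + 0) (th t))).
    by apply: C21_pos_heat => //; exact: rts_eq hV.
  have H := heat_at_funB (heat_at_funZ g (heat_at_funB (u_heat x t t0)
    (heat_at_reparam v_heat (v_time _ th0) (th_d t))))
    (heat_at_time x (is_derive_funM (is_derive_cst sig t (1 : R)) (e_d t))).
  eexists; first exact: H.
  move=> _ d0; move: d0; rewrite !addr0 dE [cst sig t]/=.
  have := v_range x th0.
  have vt0 := ltW (rts_incr hV x th0).
  have sp := speed x _ tht.
  move: (v x (th t)) (partial None v x (th t)) vt0 sp => w wt wt0 sp wI d0.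
  set q := sig * e t.
  have q0 : 0 <= q by rewrite mulr_ge0// ltW.
  have q1 : q <= sig.
    by rewrite -[leRHS]mulr1 /q ler_wpM2l//; [exact: ltW|exact: e_le1].
  have uI := u_range x t Tt.
  have qm : q <= m by exact: le_trans q1 sigm.
  have [w1 w2 w3 w4] : [/\ - (p + 1) <= w, w + q <= p + 1, - (p + 1) <= w - q & w <= p + 1].
    by clear -hf1 p_gt0 hterrace hV wI q1 q0 sig1; clearbody q; split; lra.
  have [w5 w6] : w <= w + q /\ w - q <= w by rewrite lerDl gerBl.
  have core : g * (f (w + g * q) - f w) <= ((L + m) / kap * wt - m) * q.
    have nearQ (a : R) k : (k <= n0)%N -> `|w - Q k| <= m -> (a = w \/ `|a - w| <= m) ->
        `|a - Q k| <= 2 * m.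
      move=> _ hk [->|ha]; first by rewrite (le_trans hk)// ler_peMl ?ler1n ?(ltW m0).
      rewrite -(subrK w a) -addrA; apply: le_trans (ler_normD _ _) _.
      by rewrite mulr_natl mulr2n lerD.
    have alt a b : `|a - w| <= m -> `|b - w| <= m ->
        exists Qk, (forall s, `|s - Qk| <= 2 * m -> derive1 f s <= - m) /\
        ((`|a - Qk| <= 2 * m /\ `|b - Qk| <= 2 * m) \/ kap <= wt).
      move=> ha hb; case: sp => [[k kn hk]|hs].
        exists (Q k); split; first by move=> s; exact: slope.
        by left; split; apply: (nearQ _ k) => //; right.
      by exists (Q 0%N); split; [move=> s; exact: slope|right].
    have ww : `|w - w| <= m by rewrite subrr normr0 ltW.
    case: gE => ->.
      rewrite !mul1r.
      have wq : `|w + q - w| <= m by rewrite addrC addKr ger0_norm.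
      have [Qk [h1 h2]] := alt w (w + q) ww wq.
      have := @perturbation_slope R f L m kap w (w + q) (p + 1) Qk wt f_derivable lip L0 m0
        kap0 wt0.
      by rewrite [w + q - w]addrC addKr; apply.
    rewrite mulN1r opprB mulN1r.
    have wq : `|w - q - w| <= m by rewrite addrC addKr normrN ger0_norm.
    have [Qk [h1 h2]] := alt (w - q) w wq ww.
    have := @perturbation_slope R f L m kap (w - q) w (p + 1) Qk wt f_derivable lip L0 m0
      kap0 wt0.
    rewrite (_ : w - (w - q) = q); last by ring.
    exact.
  have u_w : g * (f (u x t) - f (w + g * q)) <= L * (g * u x t - g * w - q).
    have wqI : - (p + 1) <= w + g * q <= p + 1.
      case: gE => ->; rewrite ?mulN1r ?mul1r ?w3 ?(le_trans w6 w4)//.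
      by rewrite w2 (le_trans w1 w5).
    have uI' : - (p + 1) <= u x t <= p + 1.
      by case/andP: uI => u1 ->; rewrite andbT (le_trans _ u1)// lerN2 lerDr ltW.
    have dd : g * u x t - g * w - q = g * (u x t - (w + g * q)).
      by rewrite mulrBr mulrDr mulrA gg mul1r; ring.
    apply: le_trans (ler_norm _) _; rewrite normrM gn mul1r.
    apply: le_trans (lip _ _ uI' wqI) _.
    by rewrite dd in d0 *; rewrite -(ger0_norm d0) normrM gn mul1r.
  have gK : g * (wt * ((g * K) * m * e t)) = (L + m) / kap * wt * q.
    have -> : g * (wt * ((g * K) * m * e t)) = (g * g) * (wt * K * m * e t) by ring.
    by rewrite gg mul1r KE /q; field; rewrite !gt_eqF.
  have -> : wt * (1 + g * K * m * e t - 1) = wt * (g * K * m * e t) by ring.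
  have -> : g * (f (u x t) - (f w + wt * (g * K * m * e t))) =
     g * (f (u x t) - f (w + g * q)) + g * (f (w + g * q) - f w)
      - g * (wt * (g * K * m * e t)) by ring.
  rewrite gK.
  have -> : 0 * e t + sig * (- m * e t) = - m * q by rewrite /q; ring.
  lra.
have hdM S x t : T <= t <= S -> d x t <= 2 * (p + 1).
  move=> /andP[Tt _]; rewrite dE.
  have := u_range x t Tt; have := v_range x (lt_le_trans T10 (th_ge t Tt)).
  have : 0 <= sig * e t by rewrite mulr_ge0// ltW.
  by clear -hf1 p_gt0 hterrace hV gE; case: gE => -> h1 h2 h3; lra.
have thT : th T = X - g * K by rewrite /th /e subrr mulr0 expR0; ring.
have hd0 x : d x T <= 0.
  by rewrite dE thT /e subrr mulr0 expR0; have := init x; lra.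
move=> x t Tt; have tI : T <= t <= t by rewrite Tt lexx.
have := comparison L0 (hd t) (hdM t) hd0 x tI.
rewrite dE (_ : th t = t - T + X - g * K * e t); last by rewrite /th; ring.
by rewrite /e; lra.
Qed.

End main.

(** * Long-time bounds and conclusion *)

Section long_time_bounds.
Context {R : realType} {N : nat}.
Variables (f : R -> R) (p b : R) (u0 : 'rV[R]_N -> R) (u : 'rV[R]_N -> R -> R).
Hypothesis hf1 : cond_f1 f.
Hypothesis hf3 : cond_f3 f p.
Hypothesis hu : cauchy_solution f u0 u.
Implicit Types (x : 'rV[R]_N) (s t e : R).

Let f_derivable (s : R) : derivable f s 1. Proof. by case: hf1. Qed.
Let f_C1 : continuous f^`(). Proof. by case: hf1. Qed.

Lemma cauchy_heat x t : 0 < t -> heat_at u x t (f (u x t)).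
Proof. by move=> t0; apply: C21_pos_heat; [exact: cauchy_reg hu|exact: cauchy_eq hu|]. Qed.

Lemma cauchy_eventually_le e : 0 < e ->
  exists2 T, 0 < T & forall x t, T <= t -> u x t <= p + e.
Proof.
move=> e0; case: hf3 => _ _ fneg.
exact: (eventually_le_above f_derivable f_C1 cauchy_heat (cauchy_bounded hu)).
Qed.

(** The reflected function - u solves the equation for - f (- a), which is
    negative on the positive half-line. *)
Lemma cauchy_eventually_ge e : 0 < e ->
  exists2 T, 0 < T & forall x t, T <= t -> - e <= u x t.
Proof.
move=> e0; case: hf3 => _ fpos _.
pose g (a : R) := - f (- a).
have gd (a : R) : is_derive a 1 g (derive1 f (- a)).
  have h1 : is_derive (- 1 * a + 0) 1 f (derive1 f (- a)).
    by rewrite mulN1r addr0 derive1E; exact: derivableP.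
  have h2 := is_derive_comp (g := fun s => - 1 * s + 0) h1 (is_derive_affine a (- 1) 0).
  have h3 := is_derive_funB (is_derive_cst (0 : R) a (1 : R)) h2.
  apply: is_derive_ext h3 _ _ => [s|]; first by rewrite /g /= mulN1r addr0 sub0r.
  by rewrite sub0r mulrN1 opprK.
have gC1 : continuous g^`().
  rewrite (_ : g^`()%classic = (fun a => derive1 f (- a))); last first.
    by apply/funext => a; rewrite derive1E; have := gd a => h; exact: derive_val.
  move=> a; apply: (@continuous_comp _ _ _ (fun a : R => - a) (derive1 f)).
    exact: opp_continuous.
  exact: f_C1.
have gder (a : R) : derivable g a 1 by have := gd a => h; exact: ex_derive.
have z_heat x t : 0 < t -> heat_at (fun x t => - u x t) x t (g (- u x t)).
  by move=> t0; rewrite /g opprK; apply: heat_at_funN; exact: cauchy_heat.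
have z_bnd tau : 0 < tau -> exists M, forall x t, 0 < t <= tau -> `|- u x t| <= M.
  move=> tau0; have [M hM] := cauchy_bounded hu tau0.
  by exists M => x t tI; rewrite normrN; exact: hM.
have gneg a : 0 < a -> g a < 0 by move=> a0; rewrite oppr_lt0 fpos// oppr_lt0.
have [T T0 hT] := eventually_le_above gder gC1 z_heat z_bnd e0 gneg.
by exists T => // x t /(hT x); rewrite add0r lerNl.
Qed.

Hypothesis hb : is_b_star f p b.
Hypothesis hu0 : class_T b u0.

Lemma cauchy_far_le e : 0 < e ->
  exists2 T, 0 < T & forall t, T <= t -> far_le u t e.
Proof.
move=> e0; have [/andP[b0 _] _ fneg] := hb.
have [t1 t10 [A AI farA]] := initial_far_le f_derivable hu b0 hu0.
have [T T1 hT] := far_le_decay f_derivable f_C1 cauchy_heat (cauchy_bounded hu)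
  t10 AI fneg farA e0.
by exists T => //; exact: lt_le_trans T1.
Qed.

End long_time_bounds.

Theorem proposition1p7 (R : realType) (N : nat) (hN : (0 < N)%N)
    (f : R -> R) (p b : R)
    (n0 : nat) (Q : nat -> R) (U : nat -> R -> R) (c : nat -> R)
    (v : 'rV[R]_N -> R -> R) (V : R -> R -> R)
    (u0 : 'rV[R]_N -> R) (u : 'rV[R]_N -> R -> R)
    (hf1 : cond_f1 f) (hf2 : cond_f2 f p) (hf3 : cond_f3 f p)
    (hb : is_b_star f p b)
    (hterrace : propagating_terrace f p n0 Q U c)
    (hV : radial_terrace_solution f p n0 Q U c v V)
    (hu : cauchy_solution f u0 u) (hup : cvg_loc_unif u p)
    (hu0 : class_T b u0) :
  exists T T0 sigma beta : R,
    [/\ 0 < T, 0 < T0, 0 < sigma, 0 < beta &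
      forall (x : 'rV[R]_N) (t : R), T <= t ->
        V (enorm x) (t - T) - sigma * expR (- beta * (t - T)) <= u x t
        <= V (enorm x) (t + T0) + sigma * expR (- beta * (t - T))].
Proof.
have p0 : 0 < p by case: hf2.
have fd (s : R) : derivable f s 1 by case: hf1.
have fC1 : continuous f^`() by case: hf1.
have [m m0 slope] := stable_platform_slope fC1 (terrace_stable hterrace).
have [kap kap0 [T1 T10 speed]] := platform_or_speed hf1 p0 hterrace hV m0.
have pp1 : 0 <= p + 1 by lra.
have [L L0 lip] := C1_bounded_lipschitz fd fC1 pp1.
pose sig := Num.min m 1.
have sig0 : 0 < sig by rewrite lt_min m0 ltr01.
have sigm : sig <= m by rewrite ge_min lexx.
have sig1 : sig <= 1 by rewrite ge_min lexx orbT.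
have sig2 : 0 < sig / 2 by lra.
pose K := sig * (L + m) / (m * kap).
have K0 : 0 <= K.
  by rewrite /K divr_ge0 ?mulr_ge0// ltW ?mulr_gt0//; lra.
have [eta [eta1 eta2 eta3 eta4]] := rts_terrace hV.
have [T2 T20 hT2] := terrace_far_small hterrace eta4 sig2.
(* The lower barrier starts from v at time X + K, when v is past T1 and small far
   away. *)
pose X := T1 + K + T2.
have [XKp XK T2X] : [/\ 0 < X + K, T1 + K <= X & T2 <= X + K].
  by clear -T10 K0 T20; rewrite /X; clearbody K; split; lra.
have [r0 hr0] := hT2 (X + K) T2X.
have [Ta Ta0 ha] := cauchy_eventually_le hf1 hf3 hu sig2.
have [Tb Tb0 hb'] := cauchy_eventually_ge hf1 hf3 hu sig2.
have [Tc Tc0 hc] := cauchy_far_le hf1 hu hb hu0 sig0.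
have [Td Td0 hd] := near_pinfty_ge (hup (cube `|r0|) (@compact_cube R N _) sig sig0).
pose T := Ta + Tb + Tc + Td.
have [T0 TTa TTb TTc TTd] : [/\ 0 < T, Ta <= T, Tb <= T, Tc <= T & Td <= T].
  by clear -Ta0 Tb0 Tc0 Td0; rewrite /T; split; lra.
have [S hS] := hc T TTc.
have [Te Te0 he] := terrace_fills hterrace eta1 eta2 eta4 (Num.sqrt `|S|) sig2.
(* The upper barrier starts from v at time X' - K, when v has reached p on the
   ball outside which u is small at time T. *)
pose X' := T1 + K + K + Te.
have [X'0 XKp' XK' TeX] : [/\ 0 < X', 0 < X' - K, T1 + K <= X' & Te <= X' - K].
  by clear -T10 K0 Te0; rewrite /X'; clearbody K; split; lra.
exists T, X', sig, m; split => //.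
have u_range x t : T <= t -> - 1 <= u x t <= p + 1.
  move=> Tt; have h1 := ha x t (le_trans TTa Tt); have h2 := hb' x t (le_trans TTb Tt).
  by clear -h1 h2 sig0 sig1; apply/andP; split; lra.
have vV x t : 0 <= t -> v x t = V (enorm x) t by exact: rts_profile hV x t.
have far x : `|r0| < enorm x -> v x (X + K) <= sig / 2.
  move=> hx; rewrite vV ?(ltW XKp)//; apply: hr0; last exact: enorm_ge0.
  exact: le_trans (ler_norm r0) (ltW hx).
have lower_init x : - 1 * u x T <= - 1 * v x (X - - 1 * K) + sig.
  rewrite !mulN1r opprK.
  have := hb' x T TTb => h1.
  have [hx|hx] := leP (enorm x) `|r0|; last first.
    by have h2 := far x hx; clear -h1 h2; lra.
  have xc : cube `|r0| x.
    move=> i; apply: le_trans hx; rewrite /enorm -sqrtr_sqr ler_sqrt.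
      exact: coord_sqr_le_sqnorm.
    exact: sqnorm_ge0.
  have := hd T TTd x xc; rewrite ltr_norml => /andP[h2 _].
  have /andP[_ h3] := rts_bounds hV x XKp.
  by clear -h2 h3; lra.
have upper_init x : 1 * u x T <= 1 * v x (X' - 1 * K) + sig.
  rewrite !mul1r.
  have /andP[h1 _] := rts_bounds hV x XKp'.
  have [hx|hx] := leP S (sqnorm x).
    by have h2 := hS x hx; clear -h1 h2; lra.
  have hx' : 0 <= enorm x <= Num.sqrt `|S|.
    rewrite enorm_ge0 /enorm ler_sqrt//; apply: ltW; apply: lt_le_trans hx _.
    exact: ler_norm.
  have := he (X' - K) (enorm x) TeX hx'; rewrite -vV ?(ltW XKp')// => h2.
  by have h3 := ha x T TTa; clear -h2 h3; lra.
move=> x t Tt; have tT : 0 <= t - T by rewrite subr_ge0.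
have e0 : 0 < expR (- m * (t - T)) by exact: expR_gt0.
have e1 : expR (- m * (t - T)) <= 1.
  by rewrite -expR0 ler_expR mulNr oppr_le0 mulr_ge0// ltW.
have Ke : K * expR (- m * (t - T)) <= K by rewrite ler_piMr.
have Ke0 : 0 <= K * expR (- m * (t - T)) by rewrite mulr_ge0// ltW.
have uh := cauchy_heat hu.
rewrite -!vV//; last by rewrite addr_ge0 ?ltW// (lt_le_trans T0 Tt).
apply/andP; split.
  have := wave_comparison hf1 p0 hV (or_intror erefl) L0 m0 kap0 T10 T0 lip slope speed
    sig0 sigm sig1 uh u_range XK lower_init x Tt.
  rewrite -/K !mulN1r => h1.
  have le1 : t - T <= t - T + X - - K * expR (- m * (t - T)).
    by clear -T10 K0 XK Ke0; lra.
  have h2 := terrace_solution_nondecreasing hV x tT le1.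
  by clear -h1 h2; lra.
have := wave_comparison hf1 p0 hV (or_introl erefl) L0 m0 kap0 T10 T0 lip slope speed
  sig0 sigm sig1 uh u_range XK' upper_init x Tt.
rewrite -/K !mul1r => h1.
have le0 : 0 <= t - T + X' - K * expR (- m * (t - T)).
  by clear -tT XKp' Ke; lra.
have le1 : t - T + X' - K * expR (- m * (t - T)) <= t + X'.
  by clear -T0 Ke0; lra.
have h2 := terrace_solution_nondecreasing hV x le0 le1.
by clear -h1 h2; lra.
Qed.
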